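(* Let $(G_n)_{n\ge1}$ be a sequence of finite graphs such that $|V(G_n)|\to\infty$ as $n\to\infty$ and, for some positive constant $\delta$, $|E(G_n)|\ge\delta|V(G_n)|$ for all $n$ large enough. Assume that the maximum degrees of $(G_n)_{n\ge1}$ are bounded above by some constant $D$ and that $(G_n)_{n\ge1}$ has uniformly sub-exponential volume growth, i.e. for any $\alpha>0$ there exists $K$ such that $\Psi_{G_n}(R)\le K\exp(\alpha R)$ for all $n,R\ge1$. Consider the disordered monomer-dimer model on each $G_n$, and assume that the edge weights are i.i.d. standard Gaussian random variables and that the vertex weight distribution (not depending on $n$) has finite fourth moment. Then $$\frac{\langle|\mathsf{M}_{G_n}|\rangle_n-\mathbf{E}\langle|\mathsf{M}_{G_n}|\rangle_n}{\sqrt{\mathrm{Var}(\langle|\mathsf{M}_{G_n}|\rangle_n)}}\stackrel{d}{\to}N(0,1)\quad\text{as }n\to\infty,$$ where $\langle\cdot\rangle_n$ is the Gibbs expectation with respect to $\mu_{G_n}$ and $\stackrel{d}{\to}$ denotes convergence in distribution.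
   Context: Let $G=(V(G),E(G))$ be a finite graph. A (partial) matching of $G$ is a set of edges of $G$ no two of which share a vertex; $\mathcal{M}_G$ is the set of all matchings of $G$ (including the empty one). For $x\in V(G)$ and $M\in\mathcal{M}_G$, $x\notin M$ means that $x$ is not an endpoint of any edge of $M$ (it is unmatched). The edges carry i.i.d. real weights $(w_e)_{e\in E(G)}$ and the vertices carry i.i.d. real weights $(\nu_x)_{x\in V(G)}$; the edge weights are independent of the vertex weights. The disordered monomer-dimer model on $G$ (with inverse temperature normalized to $1$) is the random Gibbs measure $\mu_G(M)=Z_G^{-1}\exp(\sum_{e\in M}w_e+\sum_{x\notin M}\nu_x)$, $M\in\mathcal{M}_G$, where $Z_G$ is the normalizing constant. $\mathsf{M}_G$ denotes a random matching sampled from $\mu_G$ given the weights, and $|\mathsf{M}_G|$ its number of edges; the Gibbs expectation is taken for fixed weights. $\mathbf{E},\mathrm{Var}$ refer to the randomness of the weights. For $x\in V(G)$, $\mathbb{B}^x_R$ is the subgraph of $G$ induced by all vertices at graph distance at most $R$ from $x$, and the volume growth function is $\Psi_G(R)=\max_{x\in V(G)}|V(\mathbb{B}^x_R)|$. *)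

(* Defs.v *)
From HB Require Import structures.
From mathcomp Require Import all_boot all_order all_algebra.
From mathcomp Require Import all_classical all_reals all_analysis measurable_realfun.

Set Implicit Arguments.
Unset Strict Implicit.
Unset Printing Implicit Defensive.

Import Order.TTheory GRing.Theory Num.Theory.
Import numFieldNormedType.Exports.

Local Open Scope classical_set_scope.
Local Open Scope ring_scope.

Record sgraph := SGraph {
  vertex :> finType;
  adj : rel vertex;
  adj_sym : symmetric adj;
  adj_irrefl : irreflexive adj }.

Section Graph.
Variable G : sgraph.

Definition edge_set : {set {set G}} :=
  [set [set p.1; p.2] | p in [pred p : G * G | adj p.1 p.2]]%SET.

Definition edge : finType := {e : {set G} | e \in edge_set}.

Definition degree (x : G) : nat := #|[set y : G | adj x y]%SET|.

Definition max_degree : nat := (\max_(x : G) degree x)%N.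

(* The graph distance is the least length of a walk (and is infinite when there
   is no walk), so it is at most R iff some walk has length at most R. *)
Definition dist_le (R : nat) (x y : G) : bool :=
  [exists k : 'I_R.+1, exists p : k.-tuple G, path (@adj G) x p && (last x p == y)].

Definition ball (x : G) (R : nat) : {set G} := [set y | dist_le R x y]%SET.

Definition volume_growth (R : nat) : nat := (\max_(x : G) #|ball x R|)%N.

Definition is_matching (M : {set edge}) : bool :=
  [forall e in M, forall f in M, (e != f) ==> [disjoint val e & val f]].

Definition matchings : {set {set edge}} := [set M | is_matching M]%SET.

Definition unmatched (M : {set edge}) (x : G) : bool :=
  [forall e in M, x \notin val e].

End Graph.

Section MonomerDimer.
Variables (R : realType) (G : sgraph).
Implicit Types (w : edge G -> R) (nu : G -> R) (M : {set edge G}).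

Definition boltzmann w nu M : R :=
  expR (\sum_(e in M) w e + \sum_(x : G | unmatched M x) nu x).

Definition partition_function w nu : R :=
  \sum_(M in matchings G) boltzmann w nu M.

Definition gibbs w nu M : R := (partition_function w nu)^-1 * boltzmann w nu M.

Definition gibbs_expectation w nu (f : {set edge G} -> R) : R :=
  \sum_(M in matchings G) f M * gibbs w nu M.

End MonomerDimer.

Section Probability.
Context d (T : measurableType d) (R : realType) (P : probability T R).

Definition mutually_independent (I : finType) (X : I -> {RV P >-> R}) : Prop :=
  forall (J : {set I}) (B : I -> set R), (forall i, measurable (B i)) ->
  P (\bigcap_(i in [set` J]) (X i @^-1` B i)) =
  (\prod_(i in J) P (X i @^-1` B i))%E.

Definition standardize (X : {RV P >-> R}) : T -> R :=
  fun t => (X t - fine 'E_P[X]%E) / Num.sqrt (fine 'V_P[X]%E).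

Lemma measurable_standardize X : measurable_fun setT (standardize X).
Proof.
by apply: measurable_funM => //; apply: measurable_funB.
Qed.

HB.instance Definition _ X :=
  isMeasurableFun.Build _ _ _ _ (standardize X) (measurable_standardize X).

Variables (G : sgraph) (w : edge G -> {RV P >-> R}) (nu : G -> {RV P >-> R}).

Definition mean_size : T -> R := fun t =>
  gibbs_expectation (fun e => w e t) (fun x => nu x t) (fun M => #|M|%:R).

Let measurable_sum_cond (I : finType) (p : pred I) (h : I -> T -> R) :
  (forall i, p i -> measurable_fun setT (h i)) ->
  measurable_fun setT (fun t => \sum_(i | p i) h i t).
Proof.
move=> mh; rewrite (_ : (fun t => _) = fun t => \sum_i if p i then h i t else 0).
  by apply: measurable_sum => i; case pi: (p i) => //; exact: mh.
by apply/funext => t; rewrite big_mkcond.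
Qed.

Let measurable_boltzmann (M : {set edge G}) :
  measurable_fun setT (fun t => boltzmann (fun e => w e t) (fun x => nu x t) M).
Proof.
by apply: measurableT_comp => //; apply: measurable_funD; exact: measurable_sum_cond.
Qed.

Lemma measurable_mean_size : measurable_fun setT mean_size.
Proof.
apply: measurable_sum_cond => M _; apply: measurable_funM => //.
apply: measurable_funM; last exact: measurable_boltzmann.
pose Z t := partition_function (fun e => w e t) (fun x => nu x t).
rewrite (_ : (fun t => _) = (fun z : R => z `^ (-1)) \o Z).
  apply: measurableT_comp; first exact: measurable_powR.
  by apply: measurable_sum_cond => N _; exact: measurable_boltzmann.
apply/funext => t /=; rewrite powR_inv1// sumr_ge0// => N _; exact: expR_ge0.
Qed.

HB.instance Definition _ :=
  isMeasurableFun.Build _ _ _ _ mean_size measurable_mean_size.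

End Probability.

Arguments mutually_independent {d T R} P {I} X.
Arguments standardize {d T R} P X.

(* The variables X n may live on different probability spaces. *)
Definition cvg_in_distribution (R : realType) (d : nat -> measure_display)
    (T : forall n, measurableType (d n)) (P : forall n, probability (T n) R)
    (X : forall n, {RV (P n) >-> R}) (mu : probability (measurableTypeR R) R) : Prop :=
  forall t : R, {for t, continuous (fun s : R => mu `]-oo, s]%classic)} ->
  cdf (X n) t @[n --> \oo] --> mu `]-oo, t]%classic.

Arguments cvg_in_distribution {R d T} P X mu.

(* Main.v *)
Require Import Defs.
From HB Require Import structures.
From mathcomp Require Import all_boot all_order all_algebra.
From mathcomp Require Import ring lra zify.

Set Implicit Arguments.
Unset Strict Implicit.
Unset Printing Implicit Defensive.

Import Order.TTheory GRing.Theory Num.Theory.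

Local Open Scope ring_scope.

(** Dividing every Boltzmann weight by [exp (\sum_x nu_x)] turns the model into the
monomer-dimer model with edge activities [exp (w_e - nu_x - nu_y)]. Let [p_S x] be the
probability that the vertex [x] is free in a random matching of the subgraph spanned by
[S]. Each vertex is free or matched, so the mean size is half of [\sum_x (1 - p_V x)]
([gibbs_mean_card]), and the theorem is a central limit theorem for a sum of [n] random
variables that are bounded but depend on all weights. It needs two inputs: each [p_V x]
is almost a function of the weights near [x], and the variance of the sum is at least of
order [n].

Locality. Splitting matchings by the partner of [x] gives the recursion
[p_S x = 1 / (1 + \sum_e lam_e * p_(S - x) y_e)] over the edges [e] from [x] to [y_e]
([free_probE]). One step of it multiplies relative errors by at most
[Lam_x / (1 + Lam_x)], where [Lam_x] is the sum of the activities at [x]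
([free_prob_contract]). Hence the influence of what lies beyond distance [r] is at most
the largest product of such rates along a self-avoiding walk of length [r]
([free_prob_dist]). The rates are below 1, but not uniformly because the weights are
unbounded. A high power of the rate at [x] is, however, at most a small [delta] unless
some weight near [x] is atypically large. As every weight is near boundedly many vertices
and large weights are rare, a product of these powers over a set [A] has mean at most
[(2 * delta) ^+ #|A|] ([mean_prod_penalty]), which beats the number of walks. So
the mean error of replacing [V] by a ball of radius [r] decays exponentially in [r],
with constants depending on the degree bound and the weight laws only
([mean_free_dist]).

Variance. Raising all edge weights by [s] raises the mean size at a speed equal to the
Gibbs variance of the number of edges. That variance is at least of the order of the
cardinality of a large matching of [G] all of whose edges have moderate weights around
them ([gibbs_variance_ge]), hence typically of order [|E|]. With [s = |E| ^ (-1/2)] the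
shift changes the expectation of the mean size by order [|E| ^ (1/2)], whereas the joint
law of the Gaussian edge weights moves by a bounded chi-square distance only. By
Cauchy-Schwarz (the inequality of Hammersley, Chapman and Robbins,
[variance_shift_bound]) the variance is at least of order [|E|], that is, of order [n]
([size_variance_ge]).

Normal approximation. Take [r] of order [log n]. The error of localization is then a
large negative power of [n], and sub-exponential growth bounds the number of balls that
meet a given ball by a small power of [n]. Stein's method for sums with local dependence
([stein_local_dependence]) compares the expectations of smooth cut-off functions with
the Gaussian ones, up to an error that vanishes as the variance is of order [n]
([size_normal_approximation], [error_asymptotics]). Distribution functions are squeezed
between such cut-offs ([cdf_sandwich]). *)

(** * Matchings and the recursion for free vertices *)

Section Edges.
Variable G : sgraph.
Implicit Types (S : {set G}) (M : {set edge G}) (e f : edge G) (x y : G).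

Definition other x e : G := odflt x [pick y in val e :\ x].

Lemma edge_pair e : exists x y, [/\ val e = [set x; y], x != y & adj x y].
Proof.
case: e => s /=; case/imsetP => -[x y]; rewrite inE /= => xy ->.
exists x, y; split => //; apply/eqP => exy; move: xy; rewrite exy.
by rewrite adj_irrefl.
Qed.

Lemma otherP x e : x \in val e -> [/\ val e = [set x; other x e], other x e != x & adj x (other x e)].
Proof.
have [a [b [eab ab adab]]] := edge_pair e.
rewrite /other; case: pickP => [y|no] /=; last first.
  rewrite eab !inE => /orP[] /eqP xE.
    by have := no b; rewrite eab !inE eqxx orbT andbT xE eq_sym ab.
  by have := no a; rewrite eab !inE eqxx andbT xE ab.
rewrite eab !inE => /andP[yx] /orP[] /eqP yE /orP[] /eqP xE; subst y x.
- by rewrite eqxx in yx.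
- by rewrite setUC adj_sym.
- by [].
- by rewrite eqxx in yx.
Qed.

Lemma other_in x e : x \in val e -> other x e \in val e.
Proof. by move=> /otherP[-> _ _]; rewrite !inE eqxx orbT. Qed.

Definition incident x : {set edge G} := [set e : edge G | x \in val e].

Lemma card_incident x : (#|incident x| <= degree x)%N.
Proof.
rewrite /degree -(@card_in_imset _ _ (other x)); last first.
  move=> e f; rewrite !inE => /otherP[E1 _ _] /otherP[E2 _ _] E; apply: val_inj.
  by rewrite E1 E2 E.
apply: subset_leq_card; apply/subsetP => y /imsetP[e xe ->].
by move: xe; rewrite !inE => /otherP[].
Qed.

Definition inside S M := [forall e in M, val e \subset S].

Lemma insideP S M : reflect (forall e, e \in M -> val e \subset S) (inside S M).
Proof. exact: 'forall_implyP. Qed.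

Lemma matchingP M : reflect (forall e f, e \in M -> f \in M -> e != f -> [disjoint val e & val f])
  (M \in matchings G).
Proof.
rewrite inE; apply: (iffP 'forall_implyP) => [h e f eM fM ef|h e eM].
  by have /'forall_implyP/(_ f fM)/implyP/(_ ef) := h e eM.
by apply/'forall_implyP => f fM; apply/implyP => ef; exact: h.
Qed.

(** Adding [e] is a bijection from the matchings that avoid the endpoints of [e] to the
matchings that contain [e]. All recursions and identities below come from it. *)
Lemma matchingU1 e M : (e |: M \in matchings G) && (e \notin M) = (M \in matchings G) && inside (~: val e) M.
Proof.
apply/andP/andP => -[].
  move=> /matchingP h eM; split.
    by apply/matchingP => f g fM gM; apply: h; rewrite inE ?fM ?gM orbT.
  apply/insideP => f fM; rewrite -disjoints_subset; apply: h; rewrite ?inE ?eqxx ?fM ?orbT//.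
  by apply: contraNneq eM => <-.
move=> /matchingP h /insideP hi; split; last first.
  apply/negP => /hi; rewrite -disjoints_subset -setI_eq0 setIid => /eqP E.
  by have [a [b [+ _ _]]] := edge_pair e; rewrite E => /setP /(_ a); rewrite !inE eqxx.
apply/matchingP => f g; rewrite !inE => /predU1P[->|fM] /predU1P[->|gM].
- by rewrite eqxx.
- by move=> _; rewrite disjoint_sym disjoints_subset hi.
- by move=> _; rewrite disjoints_subset hi.
- exact: h.
Qed.

End Edges.

Section MatchingSum.
Variables (R : realFieldType) (G : sgraph) (lam : edge G -> R).
Hypothesis lam_gt0 : forall e, 0 < lam e.
Implicit Types (S : {set G}) (M : {set edge G}) (e f : edge G) (x y : G).

Definition activity M := \prod_(e in M) lam e.

Definition matching_sum S := \sum_(M in matchings G | inside S M) activity M.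

Lemma activity_gt0 M : 0 < activity M.
Proof. by apply: prodr_gt0. Qed.

Lemma matching_sum_gt0 S : 0 < matching_sum S.
Proof.
rewrite /matching_sum (bigD1 set0)/=; last first.
  apply/andP; split; first by apply/matchingP => e f; rewrite inE.
  by apply/insideP => e; rewrite inE.
rewrite ltr_pwDl ?activity_gt0// sumr_ge0// => M _; exact/ltW/activity_gt0.
Qed.

Lemma activityU1 e M : e \notin M -> activity (e |: M) = lam e * activity M.
Proof. by move=> eM; rewrite /activity big_setU1. Qed.

(** The bijection of [matchingU1], for sums weighted by activities. *)
Lemma sum_matchings_edge (E : {set edge G} -> R) S e : val e \subset S ->
  \sum_(M in matchings G | inside S M && (e \in M)) E M * activity M =
  lam e * \sum_(M in matchings G | inside (S :\: val e) M) E (e |: M) * activity M.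
Proof.
move=> eS; rewrite big_distrr /=.
rewrite (reindex_onto (fun M => e |: M) (fun M => M :\ e)) /=; last first.
  by move=> M /and3P[_ _ eM]; rewrite setD1K.
have key M : [&& e |: M \in matchings G, inside S (e |: M) && (e \in e |: M) & (e |: M) :\ e == M] =
   (M \in matchings G) && inside (S :\: val e) M.
  have -> : ((e |: M) :\ e == M) = (e \notin M).
    apply/eqP/idP => [<-|eM]; first by rewrite !inE eqxx.
    by rewrite setU1K.
  rewrite setU11 andbT andbCA matchingU1 andbCA; congr (_ && _).
  apply/andP/insideP => [[/insideP h1 /insideP h2] f fM|h].
    by rewrite setDE subsetI h2// h1// inE fM orbT.
  split; apply/insideP => f.
    rewrite in_setU1 => /predU1P[->//|/h]; rewrite setDE subsetI => /andP[]//.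
  by move=> /h; rewrite setDE subsetI => /andP[].
apply: eq_big => [M|M /andP[_ /eqP E1]]; first by rewrite -andbA; exact: key.
rewrite activityU1; last by rewrite -E1 !inE eqxx.
by rewrite mulrCA.
Qed.

Lemma matching_sum_edge S e : val e \subset S ->
  \sum_(M in matchings G | inside S M && (e \in M)) activity M = lam e * matching_sum (S :\: val e).
Proof.
move=> eS; have := sum_matchings_edge (fun=> 1) eS.
by under eq_bigr do rewrite mul1r; under [in RHS]eq_bigr do rewrite mul1r.
Qed.

Lemma matching_sum_unmatched S x :
  \sum_(M in matchings G | inside S M && [forall e in M, x \notin val e]) activity M =
  matching_sum (S :\ x).
Proof.
apply: eq_bigl => M; congr (_ && _).
apply/andP/insideP => [[/insideP h1 /'forall_implyP h2] e eM|h].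
  by rewrite subsetD1 h1// h2.
by split; [apply/insideP|apply/'forall_implyP] => e /h; rewrite subsetD1 => /andP[].
Qed.

(** In a matching, [x] is either free or covered by exactly one edge. *)
Lemma matching_sumD1 S x : matching_sum S = matching_sum (S :\ x) +
  \sum_(e in incident x | val e \subset S) lam e * matching_sum (S :\: val e).
Proof.
rewrite {1}/matching_sum (bigID (fun M => [forall e in M, x \notin val e])) /=.
rewrite -[in RHS]matching_sum_unmatched; congr (_ + _).
  by apply: eq_bigl => M; rewrite andbA.
transitivity (\sum_(M in matchings G | inside S M)
   \sum_(e in incident x | (val e \subset S) && (e \in M)) activity M).
  rewrite [RHS](bigID (fun M => [forall e in M, x \notin val e])) /=.
  rewrite [X in _ = X + _]big1 ?add0r => [|M]; last first.
    move=> /andP[_ /'forall_implyP h]; rewrite big_pred0// => e; rewrite inE.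
    by apply/negP => /and3P[xe _ /h]; rewrite xe.
  apply: eq_bigr => M /andP[/andP[/matchingP Mm /insideP MS]].
  rewrite negb_forall => /existsP[e]; rewrite negb_imply negbK => /andP[eM xe].
  rewrite (big_pred1 e)// => f; rewrite inE; apply/idP/eqP => [/and3P[xf _ fM]|->]; last first.
    by rewrite xe MS.
  apply/eqP; apply/negPn/negP => fe; have := Mm _ _ fM eM fe.
  by rewrite -setI_eq0 => /eqP/setP/(_ x); rewrite !inE xe xf.
rewrite (exchange_big_dep (fun e => (e \in incident x) && (val e \subset S)))/=; last first.
  by move=> M e _ /and3P[-> -> _].
apply: eq_bigr => e /andP[ex eS]; rewrite -matching_sum_edge//.
by apply: eq_bigl => M; rewrite ex eS /= andbA.
Qed.

Definition free_prob S x := matching_sum (S :\ x) / matching_sum S.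

Lemma free_prob_gt0 S x : 0 < free_prob S x.
Proof. by rewrite divr_gt0// matching_sum_gt0. Qed.

Definition local_activity x := \sum_(e in incident x) lam e.

Lemma local_activity_ge0 x : 0 <= local_activity x.
Proof. by apply: sumr_ge0 => e _; exact: ltW. Qed.

Definition neighbor_field S x := \sum_(e in incident x | val e \subset S) lam e * free_prob (S :\ x) (other x e).

Lemma neighbor_field_ge0 S x : 0 <= neighbor_field S x.
Proof. by apply: sumr_ge0 => e _; rewrite mulr_ge0// ltW// free_prob_gt0. Qed.

Lemma setDedge S x e : x \in val e -> S :\: val e = (S :\ x) :\ other x e.
Proof. by move=> /otherP[-> _ _]; rewrite setDDl. Qed.

(** [matching_sumD1] divided by the sum over [S :\ x]; deleting both endpoints of an
edge at [x] means deleting [x] and then the other endpoint, which leaves the free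
probability of the latter in [S :\ x]. *)
Lemma free_probE S x : free_prob S x = (1 + neighbor_field S x)^-1.
Proof.
have Z0 T : matching_sum T != 0 by rewrite gt_eqF// matching_sum_gt0.
rewrite /free_prob -invf_div; congr (_^-1).
rewrite (matching_sumD1 S x) mulrDl divff//; congr (_ + _).
rewrite mulr_suml; apply: eq_bigr => e /andP[]; rewrite inE => xe _.
by rewrite -mulrA (setDedge _ xe).
Qed.

Lemma free_prob_le1 S x : free_prob S x <= 1.
Proof. by rewrite free_probE invf_le1 ?ltr_pwDl ?neighbor_field_ge0// lerDl neighbor_field_ge0. Qed.

Lemma neighbor_field_le S x : neighbor_field S x <= local_activity x.
Proof.
rewrite /neighbor_field /local_activity [leRHS](bigID (fun e => val e \subset S))/=.
rewrite -[leLHS]addr0 lerD//; last by apply: sumr_ge0 => e _; exact: ltW.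
by apply: ler_sum => e _; rewrite ler_piMr ?free_prob_le1// ltW.
Qed.

Lemma free_prob_ge S x : (1 + local_activity x)^-1 <= free_prob S x.
Proof.
by rewrite free_probE lef_pV2 ?posrE ?ltr_pwDl ?neighbor_field_ge0 ?local_activity_ge0// lerD2l neighbor_field_le.
Qed.

(** The function [A |-> 1 / (1 + A)] has logarithmic derivative [- A / (1 + A)] with
respect to [ln A], and the field [A] at [x] never exceeds the local activity. *)
Definition contraction_rate x := local_activity x / (1 + local_activity x).

Lemma contraction_rate_ge0 x : 0 <= contraction_rate x.
Proof. by rewrite divr_ge0// ?addr_ge0 ?local_activity_ge0. Qed.

Lemma contraction_rate_le1 x : contraction_rate x <= 1.
Proof.
by rewrite ler_pdivrMr ?ltr_pwDl ?local_activity_ge0// mul1r lerDr.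
Qed.

(** Stated as a one-sided multiplicative comparison, a relative error can be passed
through the recursion without logarithms; both directions follow by exchanging [S] and
[S']. *)
Lemma free_prob_contract S S' x d :
  (forall e, x \in val e -> (val e \subset S) = (val e \subset S')) ->
  0 <= d ->
  (forall e, x \in val e -> val e \subset S ->
     (1 - d) * free_prob (S' :\ x) (other x e) <= free_prob (S :\ x) (other x e)) ->
  (1 - contraction_rate x * d) * free_prob S x <= free_prob S' x.
Proof.
move=> SS d0 h; set A' := neighbor_field S' x; set A := neighbor_field S x.
have A0 : 0 <= A by exact: neighbor_field_ge0.
have A'0 : 0 <= A' by exact: neighbor_field_ge0.
have AA : (1 - d) * A' <= A.
  rewrite /A /A' /neighbor_field mulr_sumr (eq_bigl (fun e => (e \in incident x) && (val e \subset S))); last first.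
    by move=> e; rewrite inE; case xe: (x \in val e) => //=; rewrite SS.
  apply: ler_sum => e /andP[]; rewrite inE => xe eS.
  by rewrite mulrCA ler_wpM2l ?h// ltW.
rewrite !free_probE -/A -/A' ler_pdivrMr ?ltr_pwDl// [leRHS]mulrC ler_pdivlMr ?ltr_pwDl//.
have hA : A' / (1 + A') <= contraction_rate x.
  rewrite /contraction_rate ler_pdivrMr ?ltr_pwDl// mulrAC ler_pdivlMr ?ltr_pwDl ?local_activity_ge0//.
  have : A' <= local_activity x by exact: neighbor_field_le.
  lra.
have : (1 - contraction_rate x * d) * (1 + A') <= 1 + (1 - d) * A'.
  have : A' <= contraction_rate x * (1 + A') by rewrite -ler_pdivrMr ?ltr_pwDl.
  move=> /(ler_wpM2l d0); lra.
lra.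
Qed.

(** The maximum, over the self-avoiding walks of length [r] in [S] that start at [x], of
the product of the contraction rates along the walk. *)
Fixpoint decay (r : nat) S x : R :=
  if r is r'.+1 then
    contraction_rate x * \big[Num.max/0]_(e in incident x | val e \subset S) decay r' (S :\ x) (other x e)
  else 1.

Lemma decay_ge0 r S x : 0 <= decay r S x.
Proof.
elim: r S x => [|r IH] S x //=; rewrite mulr_ge0 ?contraction_rate_ge0//.
by apply: (big_ind (fun v => 0 <= v)) => // a b a0 b0; rewrite le_max a0.
Qed.

Lemma decay_le1 r S x : decay r S x <= 1.
Proof.
elim: r S x => [|r IH] S x //=; rewrite mulr_ile1 ?contraction_rate_ge0 ?contraction_rate_le1//.
  by apply: (big_ind (fun v => 0 <= v)) => // [a b a0 b0|e _]; rewrite ?le_max ?a0 ?decay_ge0.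
by apply: (big_ind (fun v => v <= 1)) => // a b a0 b0; rewrite ge_max a0.
Qed.

Lemma dist_le0 x : dist_le 0 x x.
Proof.
by apply/existsP; exists ord0; apply/existsP; exists [tuple]; rewrite /= eqxx.
Qed.

Lemma dist_leS r x y z : adj x y -> dist_le r y z -> dist_le r.+1 x z.
Proof.
move=> xy /existsP[k] /existsP[p] /andP[yp /eqP yz].
apply/existsP; exists (lift ord0 k); apply/existsP.
by exists [tuple of y :: p]; rewrite /= xy yp yz eqxx.
Qed.

Lemma dist_le_mono r s x y : (r <= s)%N -> dist_le r x y -> dist_le s x y.
Proof.
move=> rs /existsP[k kp]; apply/existsP; exists (widen_ord (n := r.+1) (m := s.+1) rs k).
exact: kp.
Qed.

(** At radius 0 the relative error is at most 1 since probabilities are nonnegative;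
each further unit of radius gains one contraction. *)
Lemma free_prob_local r S S' x :
  (forall y, dist_le r x y -> (y \in S) = (y \in S')) ->
  (1 - decay r S x) * free_prob S x <= free_prob S' x /\
  (1 - decay r S x) * free_prob S' x <= free_prob S x.
Proof.
elim: r S S' x => [|r IH] S S' x SS'.
  by rewrite /= subrr !mul0r; split; exact/ltW/free_prob_gt0.
have eSS' e : x \in val e -> (val e \subset S) = (val e \subset S').
  move=> xe; have [-> _ ad] := otherP xe; rewrite !subUset !sub1set !SS'//.
    exact: dist_leS ad (dist_le_mono (leq0n r) (dist_le0 _)).
  exact: dist_le_mono (dist_le0 _).
have step e : x \in val e -> forall y, dist_le r (other x e) y -> (y \in S :\ x) = (y \in S' :\ x).
  by move=> xe y ry; have [_ _ ad] := otherP xe; rewrite !inE SS'//; exact: dist_leS ry.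
have dm e : x \in val e -> val e \subset S -> decay r (S :\ x) (other x e) <=
   \big[Num.max/0]_(e in incident x | val e \subset S) decay r (S :\ x) (other x e).
  by move=> xe eS; rewrite (bigD1 e)/= ?inE ?xe// le_max lexx.
have m0 : 0 <= \big[Num.max/0]_(e in incident x | val e \subset S) decay r (S :\ x) (other x e).
  by apply: (big_ind (fun v => 0 <= v)) => // [a b a0 b0|e _]; rewrite ?le_max ?a0 ?decay_ge0.
split; apply: free_prob_contract => // e xe.
- move=> eS; have [_] := IH _ _ (other x e) (step e xe).
  apply: le_trans; rewrite ler_wpM2r ?(ltW (free_prob_gt0 _ _))// lerD2l lerN2; exact: dm.
- by rewrite eSS'.
- rewrite -eSS'// => eS; have [+ _] := IH _ _ (other x e) (step e xe).
  apply: le_trans; rewrite ler_wpM2r ?(ltW (free_prob_gt0 _ _))// lerD2l lerN2; exact: dm.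
Qed.

Lemma free_prob_dist r S S' x :
  (forall y, dist_le r x y -> (y \in S) = (y \in S')) ->
  `|free_prob S x - free_prob S' x| <= decay r S x.
Proof.
move=> /free_prob_local[]; have := decay_ge0 r S x.
have := free_prob_le1 S x; have := free_prob_le1 S' x.
have := free_prob_gt0 S x; have := free_prob_gt0 S' x.
rewrite ler_norml; nra.
Qed.

(** The sum over walks that dominates the maximum defining [decay]: a sum has a
computable expectation. *)
Fixpoint walk_sum (h : G -> R) (r : nat) S x : R :=
  if r is r'.+1 then
    h x * \sum_(e in incident x | val e \subset S) walk_sum h r' (S :\ x) (other x e)
  else 1.

(** The exponent [m] is what makes the passage from the maximum to the sum affordable:
rates are merely below 1, but their [m]-th powers can be small compared with the inverse
of the degree. *)
Lemma decay_expn (h : G -> R) m r S x : (0 < m)%N ->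
  (forall x, contraction_rate x ^+ m <= h x) -> decay r S x ^+ m <= walk_sum h r S x.
Proof.
move=> m0 hh; elim: r S x => [|r IH] S x /=; first by rewrite expr1n.
rewrite exprMn ler_pM ?exprn_ge0 ?contraction_rate_ge0//.
  by apply: (big_ind (fun v => 0 <= v)) => // [a b a0 b0|e _]; rewrite ?le_max ?a0 ?decay_ge0.
suff [] : 0 <= \big[Num.max/0]_(e in incident x | val e \subset S) decay r (S :\ x) (other x e) /\
  (\big[Num.max/0]_(e in incident x | val e \subset S) decay r (S :\ x) (other x e)) ^+ m <=
  \sum_(e in incident x | val e \subset S) walk_sum h r (S :\ x) (other x e) by [].
elim/big_rec2 : _ => [|e a b _ [b0 ba]]; first by rewrite expr0n gtn_eqF.
split; first by rewrite le_max b0 orbT.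
have d0 := decay_ge0 r (S :\ x) (other x e).
rewrite /Num.max; case: ifP => _.
  by rewrite (le_trans ba)// lerDr (le_trans _ (IH _ _))// exprn_ge0.
by rewrite (le_trans (IH _ _))// lerDl (le_trans _ ba)// exprn_ge0.
Qed.

End MatchingSum.

Section Gibbs.
Variables (R : realFieldType) (G : sgraph).
Implicit Types (S : {set G}) (M : {set edge G}) (e f : edge G) (x y : G).

(** The edges of a matching partition the set of matched vertices. *)
Lemma sum_matched M (F : G -> R) : M \in matchings G ->
  \sum_(e in M) \sum_(x in val e) F x = \sum_(x | ~~ unmatched M x) F x.
Proof.
move=> /matchingP Mm; rewrite (exchange_big_dep (fun x => ~~ unmatched M x))/=; last first.
  move=> e x eM xe; rewrite negb_forall; apply/existsP; exists e.
  by rewrite eM /= negbK.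
apply: eq_bigr => x; rewrite negb_forall => /existsP[e]; rewrite negb_imply negbK => /andP[eM xe].
rewrite (big_pred1 e)// => f; apply/andP/eqP => [[fM xf]|->//].
apply/eqP; apply/negPn/negP => fe; have := Mm _ _ fM eM fe.
by rewrite -setI_eq0 => /eqP/setP/(_ x); rewrite !inE xe xf.
Qed.

Lemma card_edge_val e : #|val e| = 2%N.
Proof. by have [x [y [-> xy _]]] := edge_pair e; rewrite cards2 xy. Qed.

(** A matching of maximal size meets every edge, so the edges are covered by those
incident to one of its [2 * #|M|] endpoints. *)
Lemma large_matching D : (forall x, degree x <= D)%N ->
  exists2 M, M \in matchings G & (#|edge G| <= 2 * D * #|M|)%N.
Proof.
move=> dD; have m0 : set0 \in matchings G by apply/matchingP => e f; rewrite inE.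
case: (arg_maxnP (fun M : {set edge G} => #|M|) m0) => M MG Mmax; have Mm : M \in matchings G by []; exists M => //.
have cov e : e \in \bigcup_(f in M) \bigcup_(x in val f) incident x.
  apply/negPn/negP => /bigcupP h.
  have eM : inside (~: val e) M.
    apply/insideP => f fM; apply/subsetP => x xf; rewrite inE; apply/negP => xe.
    by apply: h; exists f => //; apply/bigcupP; exists x => //; rewrite inE.
  have : (M \in matchings G) && inside (~: val e) M by rewrite Mm eM.
  rewrite -matchingU1 => /andP[/Mmax]; rewrite cardsU1 => + eNM.
  by rewrite eNM add1n /geq /= ltnn.
have <- : #|[set: edge G]| = #|edge G| by rewrite cardsT.
apply: (@leq_trans #|\bigcup_(f in M) \bigcup_(x in val f) incident x|).
  by apply: subset_leq_card; apply/subsetP.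
have cardU (J : finType) (A : {set J}) (B : J -> {set edge G}) n :
    (forall j, j \in A -> #|B j| <= n)%N -> (#|\bigcup_(j in A) B j| <= #|A| * n)%N.
  move=> Bn; rewrite -sum_nat_const; elim/big_rec2 : _ => [|j m C jA mC]; first by rewrite cards0.
  by rewrite (leq_trans (leq_card_setU _ _).1)// leq_add// Bn.
rewrite [X in (_ <= X)%N]mulnC; apply: (cardU _ _ _ _) => f _; rewrite -(card_edge_val f); apply: (cardU _ _ _ _) => x _.
exact: leq_trans (card_incident x) (dD x).
Qed.

Lemma edge_prob_free (lam : edge G -> R) e x : (forall e, 0 < lam e) -> x \in val e ->
  lam e * matching_sum lam (~: val e) / matching_sum lam setT =
  lam e * free_prob lam setT x * free_prob lam (setT :\ x) (other x e).
Proof.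
move=> lam0 xe; rewrite -setTD (setDedge _ xe) /free_prob.
have Z0 S : matching_sum lam S != 0 by rewrite gt_eqF// matching_sum_gt0.
by field; rewrite !Z0.
Qed.

Section mean.
Variable lam : edge G -> R.
Hypothesis lam_gt0 : forall e, 0 < lam e.

Let Z := matching_sum lam setT.
Let Z_gt0 : 0 < Z. Proof. exact: matching_sum_gt0. Qed.

Lemma inside_setT M : inside setT M.
Proof. by apply/insideP => e _; exact: subsetT. Qed.

Definition gibbs_mean (F : {set edge G} -> R) :=
  (\sum_(M in matchings G) F M * activity lam M) / matching_sum lam setT.

Lemma matching_sumT : matching_sum lam setT = \sum_(M in matchings G) activity lam M.
Proof. by apply: eq_bigl => M; rewrite inside_setT andbT. Qed.

Lemma gibbs_mean_cst c : gibbs_mean (fun=> c) = c.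
Proof. by rewrite /gibbs_mean -mulr_sumr -matching_sumT mulfK// gt_eqF. Qed.

Lemma gibbs_meanD F1 F2 : gibbs_mean (fun M => F1 M + F2 M) = gibbs_mean F1 + gibbs_mean F2.
Proof.
by rewrite /gibbs_mean -mulrDl -big_split/=; under eq_bigr do rewrite mulrDl.
Qed.

Lemma gibbs_meanZ c F : gibbs_mean (fun M => c * F M) = c * gibbs_mean F.
Proof.
by rewrite /gibbs_mean mulrA mulr_sumr; under eq_bigr do rewrite -mulrA.
Qed.

Lemma gibbs_mean_sum (I : finType) (p : pred I) (F : I -> {set edge G} -> R) :
  gibbs_mean (fun M => \sum_(i | p i) F i M) = \sum_(i | p i) gibbs_mean (F i).
Proof.
rewrite /gibbs_mean -mulr_suml; congr (_ / _).
by rewrite exchange_big/=; apply: eq_bigr => M _; rewrite mulr_suml.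
Qed.

Lemma gibbs_mean_ge0 F : (forall M, 0 <= F M) -> 0 <= gibbs_mean F.
Proof.
move=> F0; rewrite divr_ge0 ?(ltW Z_gt0)// sumr_ge0// => M _.
by rewrite mulr_ge0// ltW// activity_gt0.
Qed.

Lemma eq_gibbs_mean F1 F2 : {in matchings G, F1 =1 F2} -> gibbs_mean F1 = gibbs_mean F2.
Proof. by move=> h; congr (_ / _); apply: eq_bigr => M /h ->. Qed.

Lemma gibbs_mean_card : gibbs_mean (fun M => #|M|%:R) =
  2^-1 * \sum_(x : G) (1 - free_prob lam setT x).
Proof.
transitivity (gibbs_mean (fun M => 2^-1 * \sum_x (1 - (unmatched M x)%:R))).
  apply: eq_gibbs_mean => M Mm.
  have := sum_matched (fun=> 1) Mm.
  under eq_bigr do rewrite sumr_const card_edge_val.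
  rewrite sumr_const -mulrnA => E.
  rewrite (_ : \sum_x _ = (2 * #|M|)%:R :> R); last first.
    rewrite [RHS]E [RHS]big_mkcond /=; apply: eq_bigr => x _.
    by case: unmatched; rewrite /= ?subrr ?subr0.
  by rewrite natrM mulKf// pnatr_eq0.
rewrite gibbs_meanZ gibbs_mean_sum; congr (_ * _); apply: eq_bigr => x _.
rewrite (gibbs_meanD (fun=> 1) (fun M => - (unmatched M x)%:R)) gibbs_mean_cst; congr (_ + _).
rewrite (eq_gibbs_mean (F2 := fun M => -1 * (unmatched M x)%:R)); last by move=> M _; rewrite mulN1r.
rewrite gibbs_meanZ mulN1r; congr (- _).
rewrite /gibbs_mean /free_prob -matching_sum_unmatched; congr (_ / _).
rewrite [RHS](eq_bigl (fun M => (M \in matchings G) && unmatched M x)); last first.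
  by move=> M; rewrite inside_setT.
by rewrite [RHS]big_mkcondr; apply: eq_bigr => M _; case: unmatched; rewrite ?mul1r ?mul0r.
Qed.

Definition edge_prob e := lam e * matching_sum lam (~: val e) / matching_sum lam setT.

Definition free_at e M := inside (~: val e) M.

(** Given the other edges of the matching, the edge [e] is present with odds [lam e] if
its endpoints are otherwise free, and absent if not. The score therefore has mean zero
conditionally on these other edges. *)
Definition edge_score e M : R := (e \in M)%:R - lam e * (free_at e M)%:R.

(** A discrete integration by parts, pairing [M] with [e |: M]. *)
Lemma gibbs_mean_score e F : gibbs_mean (fun M => edge_score e M * F M) =
  lam e * (\sum_(M in matchings G | free_at e M) (F (e |: M) - F M) * activity lam M) /
    matching_sum lam setT.
Proof.
congr (_ / _).
under [X in _ = lam e * X]eq_bigr do rewrite mulrBl.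
rewrite big_split/= mulrDr /free_at -[~: val e]setTD -(sum_matchings_edge lam F (subsetT _)).
rewrite [X in _ = X + _](eq_bigl (fun M => (M \in matchings G) && (e \in M))); last first.
  by move=> M; rewrite inside_setT.
rewrite big_mkcondr /= mulr_sumr [X in _ = _ + X]big_mkcondr -big_split/=.
apply: eq_bigr => M _; rewrite /edge_score /free_at setTD.
by case: ifP => _; case: ifP => _ /=; ring.
Qed.

Lemma edge_prob_ge0 e : 0 <= edge_prob e.
Proof. by rewrite divr_ge0 ?(ltW Z_gt0)// mulr_ge0// ltW// matching_sum_gt0. Qed.

Lemma free_at_notin e M : free_at e M -> e \notin M.
Proof.
move=> /insideP h; apply/negP => /h; rewrite -disjoints_subset -setI_eq0 setIid => /eqP E.
by have := card_edge_val e; rewrite E cards0.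
Qed.

Lemma gibbs_mean_score_card e : gibbs_mean (fun M => edge_score e M * #|M|%:R) = edge_prob e.
Proof.
rewrite gibbs_mean_score /edge_prob; congr (_ * _ / _).
by apply: eq_bigr => M /andP[_ /free_at_notin eM]; rewrite cardsU1 eM natrD addrK mul1r.
Qed.

Lemma gibbs_mean_score_score e f : (e != f -> [disjoint val e & val f]) ->
  gibbs_mean (fun M => edge_score e M * edge_score f M) =
  if e == f then (1 + lam e) * edge_prob e else 0.
Proof.
move=> ef; rewrite gibbs_mean_score /edge_prob; case: eqVneq => [<-|nef].
  rewrite (_ : \sum_(M in _ | _) _ = (1 + lam e) * matching_sum lam (~: val e)); first by ring.
  rewrite /matching_sum mulr_sumr.
  apply: eq_bigr => M /andP[_ eM]; congr (_ * _).
  rewrite /edge_score setU11 eM (negbTE (free_at_notin eM)).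
  rewrite (_ : free_at e (e |: M) = false) /=; first by ring.
  by apply/negP => /free_at_notin; rewrite setU11.
rewrite big1 ?mulr0 ?mul0r// => M _.
suff -> : edge_score f (e |: M) = edge_score f M by rewrite subrr mul0r.
rewrite /edge_score !inE eq_sym (negbTE nef) /=; congr (_ - _ * _%:R).
congr nat_of_bool; apply/insideP/insideP => h g gM; first by apply: h; rewrite inE gM orbT.
move: gM; rewrite in_setU1 => /predU1P[->|]; last exact: h.
by rewrite -disjoints_subset ef.
Qed.

(** Cauchy-Schwarz for the covariance of the number of edges with a combination of
scores. The scores of disjoint edges are orthogonal, each has covariance [edge_prob e]
with the number of edges and variance [(1 + lam e) * edge_prob e], so the best
coefficients are [(1 + lam e)^-1]. *)
Lemma gibbs_variance_ge (E : {set edge G}) : E \in matchings G ->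
  \sum_(e in E) edge_prob e / (1 + lam e) <=
  gibbs_mean (fun M => #|M|%:R ^+ 2) - gibbs_mean (fun M => #|M|%:R) ^+ 2.
Proof.
move=> /matchingP Em.
pose c e := (1 + lam e)^-1.
pose g M := \sum_(e in E) c e * edge_score e M.
set V := \sum_(e in E) _; set m := gibbs_mean (fun M => #|M|%:R).
have lam1 e : 1 + lam e != 0 by rewrite gt_eqF// addr_gt0.
have gF F : gibbs_mean (fun M => g M * F M) =
    \sum_(e in E) c e * gibbs_mean (fun M => edge_score e M * F M).
  under [RHS]eq_bigr do rewrite -gibbs_meanZ.
  rewrite -gibbs_mean_sum; apply: eq_gibbs_mean => M _.
  by rewrite mulr_suml; apply: eq_bigr => e _; rewrite mulrA.
have gcard : gibbs_mean (fun M => g M * #|M|%:R) = V.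
  by rewrite gF; apply: eq_bigr => e _; rewrite gibbs_mean_score_card mulrC.
have g1 : gibbs_mean (fun M => g M * 1) = 0.
  rewrite gF big1// => e _; rewrite gibbs_mean_score big1 => [|M _]; first by rewrite !(mulr0, mul0r).
  by rewrite subrr mul0r.
have gg : gibbs_mean (fun M => g M * g M) = V.
  rewrite gF; apply: eq_bigr => e eE.
  rewrite (eq_gibbs_mean (F2 := fun M => g M * edge_score e M)); last by move=> M _; rewrite mulrC.
  rewrite gF (bigD1 e)//= gibbs_mean_score_score ?eqxx// big1 ?addr0.
    by rewrite /c; field.
  move=> f /andP[fE fe]; rewrite gibbs_mean_score_score ?(negbTE fe) ?mulr0// => _.
  exact: Em.
have : 0 <= gibbs_mean (fun M => (#|M|%:R - m - g M) ^+ 2).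
  by apply: gibbs_mean_ge0 => M; exact: sqr_ge0.
(* Expand the square so that each term is one of the means computed above. *)
rewrite (eq_gibbs_mean (F2 := fun M => #|M|%:R ^+ 2 + (- 2 * m * #|M|%:R + (m ^+ 2 +
   (g M * g M + (-2 * (g M * #|M|%:R) + (2 * m) * (g M * 1))))))); last by move=> M _; ring.
rewrite !gibbs_meanD gg gibbs_mean_cst.
rewrite !(gibbs_meanZ, gcard, g1) -/m.
set X := gibbs_mean _; nra.
Qed.

End mean.

End Gibbs.

From mathcomp Require Import all_classical all_reals all_analysis.
From mathcomp Require Import measurable_realfun.

Import numFieldNormedType.Exports.

Local Open Scope ring_scope.

(** * From Boltzmann weights to edge activities *)

Section Gibbs.
Variables (R : realType) (G : sgraph).
Implicit Types (S : {set G}) (M : {set edge G}) (e f : edge G) (x y : G).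

(** The weight that an edge brings relative to leaving its two endpoints free. *)
Definition edge_activity (w : edge G -> R) (nu : G -> R) e := expR (w e - \sum_(x in val e) nu x).

Lemma edge_activity_gt0 w nu e : 0 < edge_activity w nu e.
Proof. exact: expR_gt0. Qed.

Lemma boltzmann_activity w nu M : M \in matchings G ->
  boltzmann w nu M = expR (\sum_x nu x) * activity (edge_activity w nu) M.
Proof.
move=> Mm; rewrite /activity /edge_activity -expR_sum -expRD /boltzmann; congr expR.
rewrite big_split/= sumrN (sum_matched nu Mm) [in RHS](bigID (unmatched M))/=; ring.
Qed.

Lemma gibbs_expectationE w nu F : gibbs_expectation w nu F = gibbs_mean (edge_activity w nu) F.
Proof.
rewrite /gibbs_expectation /gibbs /gibbs_mean /partition_function mulr_suml.
rewrite (eq_bigr _ (fun M Mm => boltzmann_activity w nu Mm)) -mulr_sumr -matching_sumT.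
apply: eq_bigr => M Mm; rewrite boltzmann_activity//.
have E0 : expR (\sum_x nu x) != 0 by rewrite gt_eqF// expR_gt0.
have Z0 : matching_sum (edge_activity w nu) [set: G]%SET != 0 by rewrite gt_eqF// matching_sum_gt0// => e; exact: edge_activity_gt0.
by field; rewrite Z0 E0.
Qed.

End Gibbs.

Local Open Scope classical_set_scope.
Local Open Scope ring_scope.

(** * Functionals of independent coordinates *)

Section Law.
Variable R : realType.

(** Measurability for the product structure, expressed by substituting random variables
for the coordinates: no measurable structure on [I -> R] has to be fixed. *)
Definition measurable_functional (I : Type) (F : (I -> R) -> R) : Prop :=
  forall d (T : measurableType d) (X : I -> T -> R),
    (forall i, measurable_fun setT (X i)) -> measurable_fun setT (fun t => F (X^~ t)).

Section law_unique.
Context (I : finType) d1 d2 (T1 : measurableType d1) (T2 : measurableType d2)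
  (P1 : probability T1 R) (P2 : probability T2 R) (X1 : I -> T1 -> R) (X2 : I -> T2 -> R).
Hypothesis mX1 : forall i, measurable_fun setT (X1 i).
Hypothesis mX2 : forall i, measurable_fun setT (X2 i).
Hypothesis X12 : forall B : I -> set R, (forall i, measurable (B i)) ->
  P1 [set t | forall i, B i (X1 i t)] = P2 [set t | forall i, B i (X2 i t)].

Let box : set (set (I -> R)) :=
  [set [set x | forall i, B i (x i)] | B in [set B : I -> set R | forall i, measurable (B i)]].
Let C := g_sigma_algebraType box.

Let measurable_config d (T : measurableType d) (X : I -> T -> R) :
  (forall i, measurable_fun setT (X i)) -> measurable_fun setT ((fun t i => X i t) : T -> C).
Proof.
move=> mX; apply: (@measurability _ _ T C setT _ box) => //.
move=> _ [_ [B mB <-] <-]; rewrite setTI.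
rewrite (_ : _ @^-1` _ = \big[setI/setT]_(i : I) (X i @^-1` B i)); last first.
  by rewrite -bigcap_seq; apply/seteqP; split => t /= h i; [move=> _|]; apply: h; rewrite /= ?mem_index_enum.
by apply: bigsetI_measurable => i _; rewrite -[_ @^-1` _]setTI; exact: mX.
Qed.

(** Boxes form a generating pi-system for the coarsest structure that makes the
coordinates measurable, so the law of the family is determined by its values on
boxes. *)
Lemma law_unique (F : (I -> R) -> R) : measurable_functional F -> (forall x, 0 <= F x) ->
  (\int[P1]_t (F (X1^~ t))%:E = \int[P2]_t (F (X2^~ t))%:E)%E.
Proof.
move=> mF F0.
have mFC : measurable_fun setT (F : C -> R).
  apply: (mF _ C (fun i x => x i)) => i.
  move=> _ A mA; rewrite setTI; apply: sub_sigma_algebra.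
  exists (fun j => if j == i then A else setT); first by move=> j /=; case: ifP.
  apply/seteqP; split => x /=.
    by move/(_ i); rewrite eqxx.
  by move=> Ax j; case: eqVneq => // ->.
have mFE : measurable_fun setT (EFin \o (F : C -> R)) by exact/measurable_EFinP.
have m1 := measurable_config mX1; have m2 := measurable_config mX2.
pose m1m := isMeasurableFun.Build _ _ _ _ _ m1.
pose m2m := isMeasurableFun.Build _ _ _ _ _ m2.
pose Y1 : {mfun T1 >-> C} := HB.pack ((fun t i => X1 i t) : T1 -> C) m1m.
pose Y2 : {mfun T2 >-> C} := HB.pack ((fun t i => X2 i t) : T2 -> C) m2m.
rewrite -(@ge0_integral_distribution _ _ _ _ _ P1 Y1 _ mFE); last by move=> y; rewrite lee_fin.
rewrite -(@ge0_integral_distribution _ _ _ _ _ P2 Y2 _ mFE); last by move=> y; rewrite lee_fin.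
apply: eq_measure_integral => /= A mA _.
apply: (@measure_unique _ R C box (fun=> setT) erefl _ _ _ (distribution P1 Y1) (distribution P2 Y2)) => //.
- move=> _ _ [B mB <-] [B' mB' <-].
  exists (fun i => B i `&` B' i); first by move=> i; exact: measurableI.
  by apply/seteqP; split => x /= => [h|[h1 h2] i]; [split => i; have [] := h i|split].
- by move=> _; exists (fun=> setT) => //; apply/seteqP; split.
- by rewrite bigcup_const//; exists 0%N.
- by move=> _ [B mB <-]; exact: X12.
- by move=> _; rewrite (le_lt_trans (probability_le1 _ measurableT))// ltry.
Qed.

End law_unique.

Section expectation.
Context d (T : measurableType d) (P : probability T R).
Implicit Types f g : T -> R.

Definition bounded_measurable f := measurable_fun setT f /\ exists C, forall t, `|f t| <= C.

Lemma bounded_measurable_cst c : bounded_measurable (fun=> c).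
Proof. by split; [exact: measurable_cst|exists `|c|]. Qed.

Lemma bounded_measurableD f g : bounded_measurable f -> bounded_measurable g ->
  bounded_measurable (fun t => f t + g t).
Proof.
move=> [mf [C fC]] [mg [D gD]]; split; first exact: measurable_funD.
by exists (C + D) => t; rewrite (le_trans (ler_normD _ _))// lerD.
Qed.

Lemma bounded_measurableM f g : bounded_measurable f -> bounded_measurable g ->
  bounded_measurable (fun t => f t * g t).
Proof.
move=> [mf [C fC]] [mg [D gD]]; split; first exact: measurable_funM.
by exists (C * D) => t; rewrite normrM ler_pM.
Qed.

Lemma bounded_measurableZ c f : bounded_measurable f -> bounded_measurable (fun t => c * f t).
Proof. exact/bounded_measurableM/bounded_measurable_cst. Qed.

Lemma bounded_measurableN f : bounded_measurable f -> bounded_measurable (fun t => - f t).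
Proof.
move=> bf; rewrite (_ : (fun _ => _) = fun t => -1 * f t); first exact: bounded_measurableZ.
by apply/funext => t; rewrite mulN1r. Qed.

Lemma bounded_measurableB f g : bounded_measurable f -> bounded_measurable g ->
  bounded_measurable (fun t => f t - g t).
Proof. by move=> bf bg; apply: bounded_measurableD => //; exact: bounded_measurableN. Qed.

Lemma bounded_measurableX n f : bounded_measurable f -> bounded_measurable (fun t => f t ^+ n).
Proof.
move=> bf; elim: n => [|n IH]; first exact: bounded_measurable_cst.
by under eq_fun do rewrite exprS; exact: bounded_measurableM.
Qed.

Lemma bounded_measurable_norm f : bounded_measurable f -> bounded_measurable (fun t => `|f t|).
Proof.
move=> [mf [C fC]]; split; first exact: measurableT_comp.
by exists C => t; rewrite normr_id.
Qed.

Lemma bounded_measurable_sum (I : Type) (r : seq I) (p : pred I) (f : I -> T -> R) :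
  (forall i, p i -> bounded_measurable (f i)) ->
  bounded_measurable (fun t => \sum_(i <- r | p i) f i t).
Proof.
move=> bf; elim: r => [|i r IH].
  rewrite (_ : (fun _ => _) = fun=> 0); first exact: bounded_measurable_cst.
  by apply/funext => t; rewrite big_nil.
case pi : (p i).
  rewrite (_ : (fun _ => _) = fun t => f i t + \sum_(i <- r | p i) f i t).
    by apply: bounded_measurableD => //; exact: bf.
  by apply/funext => t; rewrite big_cons pi.
by rewrite (_ : (fun _ => _) = fun t => \sum_(i <- r | p i) f i t)//; apply/funext => t; rewrite big_cons pi.
Qed.

Lemma bounded_measurable_integrable f : bounded_measurable f -> P.-integrable setT (EFin \o f).
Proof.
move=> [mf [C fC]]; apply: measurable_bounded_integrable => //.
  by rewrite (le_lt_trans (probability_le1 _ measurableT))// ltry.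
exists C; split; first by rewrite num_real.
by move=> x Cx t _; apply: le_trans (fC t) (ltW Cx).
Qed.

Definition mean f : R := \int[P]_t f t.

Definition var f : R := mean (fun t => (f t - mean f) ^+ 2).

Lemma eq_mean f g : f =1 g -> mean f = mean g.
Proof. by move=> fg; apply: eq_Rintegral => t _; exact: fg. Qed.

Lemma mean_cst c : mean (fun=> c) = c.
Proof. by rewrite /mean Rintegral_cst//= probability_setT/= mulr1. Qed.

Lemma meanD f g : bounded_measurable f -> bounded_measurable g ->
  mean (fun t => f t + g t) = mean f + mean g.
Proof. by move=> bf bg; apply: RintegralD => //; exact: bounded_measurable_integrable. Qed.

Lemma meanB f g : bounded_measurable f -> bounded_measurable g ->
  mean (fun t => f t - g t) = mean f - mean g.
Proof. by move=> bf bg; apply: RintegralB => //; exact: bounded_measurable_integrable. Qed.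

Lemma meanZ c f : bounded_measurable f -> mean (fun t => c * f t) = c * mean f.
Proof. by move=> bf; apply: RintegralZl => //; exact: bounded_measurable_integrable. Qed.

Lemma mean_sum (I : Type) (r : seq I) (p : pred I) (f : I -> T -> R) :
  (forall i, p i -> bounded_measurable (f i)) ->
  mean (fun t => \sum_(i <- r | p i) f i t) = \sum_(i <- r | p i) mean (f i).
Proof.
move=> bf; elim: r => [|i r IH].
  by rewrite big_nil -[RHS](mean_cst 0); apply: eq_mean => t; rewrite big_nil.
rewrite big_cons -IH; case: ifP => pi; last by apply: eq_mean => t; rewrite big_cons pi.
rewrite -meanD//; [|exact: bf|exact: bounded_measurable_sum].
by apply: eq_mean => t; rewrite big_cons pi.
Qed.

Lemma mean_ge0 f : (forall t, 0 <= f t) -> 0 <= mean f.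
Proof. by move=> f0; apply: Rintegral_ge0. Qed.

Lemma le_mean f g : bounded_measurable f -> bounded_measurable g -> (forall t, f t <= g t) ->
  mean f <= mean g.
Proof.
by move=> bf bg fg; apply: le_Rintegral => //; exact: bounded_measurable_integrable.
Qed.

Lemma mean_norm f : bounded_measurable f -> `|mean f| <= mean (fun t => `|f t|).
Proof. by move=> bf; apply: le_normr_Rintegral => //; exact: bounded_measurable_integrable. Qed.

Lemma mean_norm_le f c : bounded_measurable f -> (forall t, `|f t| <= c) -> `|mean f| <= c.
Proof.
move=> bf fc; rewrite (le_trans (mean_norm bf))// -[leRHS]mean_cst.
by apply: le_mean => //; [exact: bounded_measurable_norm|exact: bounded_measurable_cst].
Qed.

Lemma mean_EFin f : bounded_measurable f -> (\int[P]_t (f t)%:E)%E = (mean f)%:E.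
Proof.
move=> bf; rewrite /mean /Rintegral fineK//; apply: integrable_fin_num => //.
exact: bounded_measurable_integrable.
Qed.

Lemma sqr_mean_le f : bounded_measurable f -> mean f ^+ 2 <= mean (fun t => f t ^+ 2).
Proof.
move=> bf; have b2 := bounded_measurableX 2 bf.
have : 0 <= mean (fun t => (f t - mean f) ^+ 2) by apply: mean_ge0 => t; exact: sqr_ge0.
rewrite (@eq_mean _ (fun t => f t ^+ 2 + (- 2 * mean f * f t + mean f ^+ 2))); last by move=> t; ring.
have bc := bounded_measurable_cst (mean f ^+ 2).
have bl := bounded_measurableZ (- 2 * mean f) bf.
rewrite meanD//; last exact: bounded_measurableD.
rewrite meanD// meanZ// mean_cst; lra.
Qed.

End expectation.

Section independence.
Context d (T : measurableType d) (P : probability T R) (I : finType) (X : I -> {RV P >-> R}).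
Hypothesis indep : mutually_independent P X.

Lemma indep_event (J : {set I}) (B : I -> set R) : (forall i, measurable (B i)) ->
  P [set t | forall i, i \in J -> B i (X i t)] = (\prod_(i in J) P (X i @^-1` B i))%E.
Proof. by move=> mB; rewrite -indep//; congr (P _); apply/seteqP; split. Qed.

(** Replacing the coordinates outside [J] by an independent copy does not change the
joint law, since both families give the same probability to every box. This turns
independence into an iterated integral. *)
Lemma indep_resample (J : {set I}) (F : (I -> R) -> R) : measurable_functional F ->
  (forall x, 0 <= F x) ->
  (\int[P]_t (F (X^~ t))%:E =
   \int[P]_s \int[P]_t (F (fun i => X i (if i \in J then s else t)))%:E)%E.
Proof.
move=> mF F0.
pose Y (i : I) (z : T * T) := X i (if i \in J then z.1 else z.2).
have mY i : measurable_fun setT (Y i).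
  by rewrite /Y; case: (i \in J); apply: measurableT_comp.
have FP : measurable_fun setT (fun z : T * T => (F (Y^~ z))%:E).
  by apply/measurable_EFinP; exact: mF.
rewrite (@law_unique _ _ _ _ _ P (P \x P)%E (fun i => X i) Y _ _ _ F)//.
  by rewrite fubini_tonelli1//= => z; rewrite lee_fin.
move=> B mB.
(* The box event of the mixed family is a product of an event on each copy. *)
pose A1 := [set t | forall i, i \in J -> B i (X i t)].
pose A2 := [set t | forall i, i \in ~: J -> B i (X i t)].
have mA (K : {set I}) : measurable [set t | forall i, i \in K -> B i (X i t)].
  rewrite (_ : mkset _ = \big[setI/setT]_(i in K) (X i @^-1` B i)); last first.
    by rewrite -bigcap_seq_cond; apply/seteqP; split => t /= h i => [/andP[_]|iK];
      [exact: h|apply: h; rewrite /= mem_index_enum].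
  by apply: bigsetI_measurable => i _; rewrite -[_ @^-1` _]setTI; exact: measurable_funP.
rewrite (_ : [set t | forall i, B i (Y i t)] = A1 `*` A2); last first.
  apply/seteqP; split => -[s t] /=.
    move=> h; split => i; first by move=> iJ; have := h i; rewrite /Y iJ.
    by rewrite inE => iJ; have := h i; rewrite /Y (negbTE iJ).
  move=> [h1 h2] i; rewrite /Y/=; case: ifPn => iJ; first exact: h1.
  by apply: h2; rewrite inE.
transitivity (P A1 * P A2)%E; last by apply/esym/product_measure1E; exact: mA.
rewrite !indep_event// (_ : [set t | _] = [set t | forall i, i \in [set: I]%SET -> B i (X i t)]).
  rewrite indep_event// (bigID (mem J))/=; congr (_ * _)%E; apply: eq_bigl => i; by rewrite !inE.
by apply/seteqP; split => t /= h i; [move=> _; exact: h|apply: h; rewrite inE].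
Qed.

Definition depends_on (J : {set I}) (F : (I -> R) -> R) :=
  forall x y, (forall i, i \in J -> x i = y i) -> F x = F y.

Definition bounded_functional (F : (I -> R) -> R) :=
  measurable_functional F /\ exists C, forall x, `|F x| <= C.

Lemma bounded_functional_measurable F : bounded_functional F ->
  bounded_measurable (fun t => F (X^~ t)).
Proof. by move=> [mF [C FC]]; split; [exact: mF|exists C]. Qed.

Lemma mean_indep_ge0 (J : {set I}) F1 F2 : bounded_functional F1 -> bounded_functional F2 ->
  (forall x, 0 <= F1 x) -> (forall x, 0 <= F2 x) ->
  depends_on J F1 -> depends_on (~: J) F2 ->
  mean P (fun t => F1 (X^~ t) * F2 (X^~ t)) =
  mean P (fun t => F1 (X^~ t)) * mean P (fun t => F2 (X^~ t)).
Proof.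
move=> b1 b2 p1 p2 d1 d2; apply: EFin_inj.
have [b1' b2'] := (bounded_functional_measurable b1, bounded_functional_measurable b2).
rewrite EFinM -!mean_EFin//; last exact: bounded_measurableM.
rewrite (@indep_resample J (fun x => F1 x * F2 x)); last 2 first.
- by move=> d' T' X' mX'; apply: measurable_funM; [apply: b1.1|apply: b2.1].
- by move=> x; rewrite mulr_ge0.
have m2 : measurable_fun setT (fun t => (F2 (X^~ t))%:E).
  by apply/measurable_EFinP; exact: b2'.1.
have m1 : measurable_fun setT (fun t => (F1 (X^~ t))%:E).
  by apply/measurable_EFinP; exact: b1'.1.
rewrite -ge0_integralZr//; [|by move=> t _; rewrite lee_fin|by apply: integral_ge0 => t _; rewrite lee_fin].
apply: eq_integral => s _.
rewrite -ge0_integralZl ?lee_fin//; last by move=> t _; rewrite lee_fin.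
apply: eq_integral => t _; rewrite EFinM; congr (_%:E * _%:E)%E.
  by apply: d1 => i ->.
by apply: d2 => i; rewrite inE => /negbTE ->.
Qed.

(** Adding constants to the functionals reduces the claim to nonnegative ones, for which
integrals can be exchanged without integrability conditions. *)
Lemma mean_indep (J K : {set I}) F1 F2 : bounded_functional F1 -> bounded_functional F2 ->
  depends_on J F1 -> depends_on K F2 -> [disjoint J & K]%B ->
  mean P (fun t => F1 (X^~ t) * F2 (X^~ t)) =
  mean P (fun t => F1 (X^~ t)) * mean P (fun t => F2 (X^~ t)).
Proof.
move=> b1 b2 d1 d2 JK.
have [[m1 [C1 FC1]] [m2 [C2 FC2]]] := (b1, b2).
have [b1' b2'] := (bounded_functional_measurable b1, bounded_functional_measurable b2).
have bD F C : bounded_functional F -> bounded_functional (fun x => F x + C).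
  move=> [mF [D FD]]; split.
    by move=> d' T' X' mX'; apply: measurable_funD => //; exact: mF.
  by exists (D + `|C|) => x; rewrite (le_trans (ler_normD _ _))// lerD.
have /(_ J) := @mean_indep_ge0 _ _ _ (bD _ C1 b1) (bD _ C2 b2).
have h (F : (I -> R) -> R) C : (forall x, `|F x| <= C) -> forall x, 0 <= F x + C.
  by move=> FC x; have := FC x; rewrite ler_norml; lra.
move=> /(_ (h _ _ FC1) (h _ _ FC2)).
have d1' : depends_on J (fun x => F1 x + C1) by move=> x y xy; rewrite (d1 x y).
have d2' : depends_on (~: J) (fun x => F2 x + C2).
  move=> x y xy; rewrite (d2 x y)// => i iK; apply: xy; rewrite inE.
  by move: JK; rewrite disjoint_sym => /disjointFr/(_ iK) ->.
move=> /(_ d1' d2').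
have bc c := @bounded_measurable_cst _ T c.
have b12 := bounded_measurableM b1' b2'.
rewrite (@eq_mean _ _ _ _ (fun t => F1 (X^~ t) * F2 (X^~ t) + (C2 * F1 (X^~ t) +
   (C1 * F2 (X^~ t) + C1 * C2)))); last by move=> t; ring.
rewrite !(meanD, meanZ, mean_cst)//; first by lra.
- by apply: bounded_measurableZ.
- by apply: bounded_measurableZ.
- by apply: bounded_measurableD => //; exact: bounded_measurableZ.
- by apply: bounded_measurableD; [exact: bounded_measurableZ|
    apply: bounded_measurableD => //; exact: bounded_measurableZ].
Qed.

End independence.
End Law.

(** * Products of penalties for large coordinates *)

Section Functionals.
Variables (R : realType) (I : finType).
Implicit Types F : (I -> R) -> R.

Lemma measurable_functional_cst c : measurable_functional (fun _ : I -> R => c).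
Proof. by move=> d T X mX; exact: measurable_cst. Qed.

Lemma measurable_functional_coord i : measurable_functional (fun x : I -> R => x i).
Proof. by move=> d T X mX; exact: mX. Qed.

Lemma measurable_functionalD F1 F2 : measurable_functional F1 -> measurable_functional F2 ->
  measurable_functional (fun x => F1 x + F2 x).
Proof. by move=> m1 m2 d T X mX; apply: measurable_funD; [exact: m1|exact: m2]. Qed.

Lemma measurable_functionalM F1 F2 : measurable_functional F1 -> measurable_functional F2 ->
  measurable_functional (fun x => F1 x * F2 x).
Proof. by move=> m1 m2 d T X mX; apply: measurable_funM; [exact: m1|exact: m2]. Qed.

Lemma measurable_functional_comp (g : R -> R) F : measurable_fun setT g ->
  measurable_functional F -> measurable_functional (fun x => g (F x)).
Proof. by move=> mg m1 d T X mX; apply: (measurableT_comp mg); exact: m1. Qed.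

Lemma measurable_functional_sum (J : Type) (r : seq J) (p : pred J) (F : J -> (I -> R) -> R) :
  (forall j, measurable_functional (F j)) ->
  measurable_functional (fun x => \sum_(j <- r | p j) F j x).
Proof.
move=> mF; elim: r => [|j r IH].
  rewrite (_ : (fun _ => _) = fun=> 0); first exact: measurable_functional_cst.
  by apply/funext => t; rewrite big_nil.
case pj : (p j).
  rewrite (_ : (fun _ => _) = fun t => F j t + \sum_(j <- r | p j) F j t).
    exact: measurable_functionalD.
  by apply/funext => t; rewrite big_cons pj.
by rewrite (_ : (fun _ => _) = fun t => \sum_(j <- r | p j) F j t)//; apply/funext => t; rewrite big_cons pj.
Qed.

Lemma measurable_functional_prod (J : Type) (r : seq J) (p : pred J) (F : J -> (I -> R) -> R) :
  (forall j, measurable_functional (F j)) ->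
  measurable_functional (fun x => \prod_(j <- r | p j) F j x).
Proof.
move=> mF; elim: r => [|j r IH].
  rewrite (_ : (fun _ => _) = fun=> 1); first exact: measurable_functional_cst.
  by apply/funext => t; rewrite big_nil.
case pj : (p j).
  rewrite (_ : (fun _ => _) = fun t => F j t * \prod_(j <- r | p j) F j t).
    exact: measurable_functionalM.
  by apply/funext => t; rewrite big_cons pj.
by rewrite (_ : (fun _ => _) = fun t => \prod_(j <- r | p j) F j t)//; apply/funext => t; rewrite big_cons pj.
Qed.

Lemma measurable_functional_div F1 F2 : measurable_functional F1 -> measurable_functional F2 ->
  (forall x, 0 <= F2 x) -> measurable_functional (fun x => F1 x / F2 x).
Proof.
move=> m1 m2 p2; apply: measurable_functionalM => //.
rewrite (_ : (fun _ => _) = fun x => F2 x `^ (-1)).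
  by apply: (@measurable_functional_comp (fun y => y `^ (-1)) F2) => //; exact: measurable_powR.
by apply/funext => x; rewrite powR_inv1.
Qed.

Lemma measurable_functional_indic i (A : set R) : measurable A ->
  measurable_functional (fun x : I -> R => \1_A (x i)).
Proof.
move=> mA; apply: (@measurable_functional_comp (\1_A) (fun x => x i)); last exact: measurable_functional_coord.
exact: measurable_indic.
Qed.

Section bounded.
Lemma bounded_functionalM F1 F2 : bounded_functional F1 -> bounded_functional F2 ->
  bounded_functional (fun x => F1 x * F2 x).
Proof.
move=> [m1 [C1 b1]] [m2 [C2 b2]]; split; first exact: measurable_functionalM.
by exists (C1 * C2) => x; rewrite normrM ler_pM.
Qed.

Lemma bounded_functionalD F1 F2 : bounded_functional F1 -> bounded_functional F2 ->
  bounded_functional (fun x => F1 x + F2 x).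
Proof.
move=> [m1 [C1 b1]] [m2 [C2 b2]]; split; first exact: measurable_functionalD.
by exists (C1 + C2) => x; rewrite (le_trans (ler_normD _ _))// lerD.
Qed.

Lemma bounded_functional_cst c : bounded_functional (fun _ : I -> R => c).
Proof. by split; [exact: measurable_functional_cst|exists `|c|]. Qed.

Lemma bounded_functional_indic i (A : set R) : measurable A ->
  bounded_functional (fun x : I -> R => \1_A (x i)).
Proof.
move=> mA; split; first exact: measurable_functional_indic.
by exists 1 => x; rewrite indicE; case: (_ \in _); rewrite ?normr1 ?normr0.
Qed.

Lemma bounded_functional_sum (J : Type) (r : seq J) (p : pred J) (F : J -> (I -> R) -> R) :
  (forall j, bounded_functional (F j)) ->
  bounded_functional (fun x => \sum_(j <- r | p j) F j x).
Proof.
move=> bF; split; first by apply: measurable_functional_sum => j; case: (bF j).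
elim: r => [|j r [C IH]]; first by exists 0 => x; rewrite big_nil normr0.
have [_ [Cj FC]] := bF j; exists (`|Cj| + C) => x; rewrite big_cons; case: ifP => _.
  rewrite (le_trans (ler_normD _ _))// lerD//; exact: le_trans (FC x) (ler_norm _).
by rewrite (le_trans (IH x))// lerDr.
Qed.

Lemma bounded_functional_prod (J : Type) (r : seq J) (p : pred J) (F : J -> (I -> R) -> R) :
  (forall j, bounded_functional (F j)) ->
  bounded_functional (fun x => \prod_(j <- r | p j) F j x).
Proof.
move=> bF; split; first by apply: measurable_functional_prod => j; case: (bF j).
elim: r => [|j r [C IH]]; first by exists 1 => x; rewrite big_nil normr1.
have [_ [Cj FC]] := bF j; exists (`|Cj| * `|C| + `|C|) => x; rewrite big_cons.
have {}IH : `|\prod_(j <- r | p j) F j x| <= `|C| by exact: le_trans (IH x) (ler_norm _).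
case: ifP => _; last by rewrite (le_trans IH)// lerDr mulr_ge0.
have {}FC : `|F j x| <= `|Cj| by exact: le_trans (FC x) (ler_norm _).
by rewrite normrM (le_trans (ler_pM _ _ FC IH))// lerDl.
Qed.
End bounded.

End Functionals.

Lemma measurable_norm_gt (R : realType) (a : R) : measurable [set y : R | a < `|y|].
Proof.
rewrite (_ : mkset _ = (fun y => `|y|) @^-1` `]a, +oo[); last first.
  by apply/seteqP; split => y /=; rewrite in_itv/= andbT.
by rewrite -[_ @^-1` _]setTI; exact: normr_measurable.
Qed.

Section BadCoordinates.
Context (R : realType) d (T : measurableType d) (P : probability T R) (I : finType)
  (X : I -> {RV P >-> R}).
Hypothesis indep : mutually_independent P X.
Variables (bad : set R) (q : R).
Hypothesis mbad : measurable bad.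
Hypothesis badq : forall i, (P (X i @^-1` bad) <= q%:E)%E.

Lemma mean_indic i : @mean R _ _ P (fun t => \1_bad (X i t)) = fine (P (X i @^-1` bad)).
Proof.
rewrite /mean /Rintegral; congr fine.
rewrite (_ : (fun t => _) = fun t => (\1_(X i @^-1` bad) t)%:E); last first.
  by apply/funext => t; rewrite !indicE.
by rewrite integral_indic ?setIT// -[_ @^-1` _]setTI; exact: measurable_funP.
Qed.

Lemma mean_prod_bad (c : R) (J : {set I}) : 0 <= c -> 0 <= q ->
  mean P (fun t => \prod_(i in J) (1 + c * \1_bad (X i t))) <= (1 + c * q) ^+ #|J|.
Proof.
move=> c0 q0; rewrite cardE.
have -> : (fun t => \prod_(i in J) (1 + c * \1_bad (X i t))) =
   (fun t => \prod_(i <- enum J) (1 + c * \1_bad (X i t))).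
  by apply/funext => t; rewrite big_enum.
elim: (enum J) (enum_uniq J) => [_|i s IH /= /andP[iNs us]].
  by under eq_mean do rewrite big_nil; rewrite mean_cst expr0.
pose F1 (x : I -> R) := 1 + c * \1_bad (x i).
pose F2 (x : I -> R) := \prod_(i <- s) (1 + c * \1_bad (x i)).
have bF j : bounded_functional (fun x : I -> R => 1 + c * \1_bad (x j)).
  apply: bounded_functionalD; first exact: bounded_functional_cst.
  apply: bounded_functionalM; first exact: bounded_functional_cst.
  exact: bounded_functional_indic.
under eq_mean do rewrite big_cons.
have := @mean_indep _ _ _ P I X indep [set i]%SET [set j in s]%SET F1 F2.
rewrite /F1 /F2 => ->; last 5 first.
- exact: bF.
- exact: bounded_functional_prod.
- by move=> x y /(_ i); rewrite inE eqxx => ->.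
- move=> x y xy; rewrite !big_seq; apply: eq_bigr => j js.
  by rewrite xy// inE.
- by rewrite disjoints1 inE.
rewrite exprS ler_pM//.
- by apply: mean_ge0 => t; rewrite addr_ge0// mulr_ge0.
- apply: mean_ge0 => t; apply: prodr_ge0 => j _; by rewrite addr_ge0// mulr_ge0.
- have bi : @bounded_measurable R _ _ (fun t => \1_bad (X i t)).
    exact: (bounded_functional_measurable X (bounded_functional_indic i mbad)).
  rewrite meanD; [|exact: bounded_measurable_cst|exact: bounded_measurableZ].
  rewrite meanZ// mean_cst lerD2l ler_wpM2l// mean_indic -lee_fin fineK//.
  by rewrite fin_num_measure// -[_ @^-1` _]setTI; exact: measurable_funP.
- exact: IH.
Qed.

Variables (V : finType) (N : V -> {set I}) (k : nat) (delta : R).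
Hypothesis N_card : forall x, (#|N x| <= k)%N.
Hypothesis N_inv : forall i, (#|[set x | i \in N x]%SET| <= k)%N.
Hypothesis delta01 : 0 < delta < 1.
Hypothesis q_ge0 : 0 <= q.
Hypothesis q_small : (1 + delta ^- k * q) ^+ k <= 2.

(** Equal to [delta ^ (1 - b)], where [b] counts the bad coordinates in [N x]. It is
[delta] if there is none and at least 1 otherwise, and it is a product over coordinates,
so that the dependence between different [x] can be handled. *)
Definition penalty (z : I -> R) (x : V) : R :=
  delta * \prod_(i in N x) (1 + (delta^-1 - 1) * \1_bad (z i)).

Let delta_gt0 : 0 < delta. Proof. by case/andP: delta01. Qed.
Let delta_inv : 1 <= delta^-1.
Proof. by rewrite invf_ge1//; apply: ltW; case/andP: delta01. Qed.

Lemma penalty_good z x : delta <= penalty z x.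
Proof.
rewrite /penalty ler_peMr ?(ltW delta_gt0)//.
elim/big_ind : _ => [//|a b a1 b1|i _]; first by rewrite mulr_ege1.
by rewrite lerDl mulr_ge0// subr_ge0.
Qed.

Lemma penalty_bad z x i : i \in N x -> bad (z i) -> 1 <= penalty z x.
Proof.
move=> iN bi; rewrite /penalty (bigD1 i)//= indicE mem_set// mulr1 addrCA subrr addr0 mulrA.
rewrite mulfV ?gt_eqF// mul1r.
elim/big_ind : _ => [//|a b a1 b1|j _]; first by rewrite mulr_ege1.
by rewrite lerDl mulr_ge0// subr_ge0.
Qed.

Lemma bounded_functional_penalty x : bounded_functional (penalty^~ x).
Proof.
apply: bounded_functionalM; first exact: bounded_functional_cst.
apply: bounded_functional_prod => i; apply: bounded_functionalD; first exact: bounded_functional_cst.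
apply: bounded_functionalM; first exact: bounded_functional_cst.
exact: bounded_functional_indic.
Qed.

(** Regroup the factors by coordinate: a bad coordinate contributes at most [k] times,
once for each [x] whose neighborhood contains it. *)
Lemma prod_penalty_le z (A : {set V}) : \prod_(x in A) penalty z x <=
  delta ^+ #|A| * \prod_(i in (\bigcup_(x in A) N x)%SET) (1 + delta ^- k * \1_bad (z i)).
Proof.
rewrite big_split/= prodr_const ler_wpM2l ?exprn_ge0 ?(ltW delta_gt0)//.
rewrite (exchange_big_dep (mem (\bigcup_(x in A) N x)%SET))/=; last first.
  by move=> x i xA iN; apply/bigcupP; exists x.
apply: ler_prod => i iA.
rewrite prodr_const exprn_ge0/=; last by rewrite addr_ge0// mulr_ge0// subr_ge0.
rewrite indicE; case: (_ \in _); last by rewrite !mulr0 !addr0 expr1n.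
rewrite !mulr1 addrCA subrr addr0 -exprVn.
have : (#|[pred x | (x \in A) && (i \in N x)]| <= k)%N.
  by apply: leq_trans (N_inv i); apply: subset_leq_card; apply/fintype.subsetP => x; rewrite !inE => /andP[].
move=> h; rewrite (le_trans (ler_weXn2l delta_inv h))//.
by rewrite lerDr.
Qed.

(** At most [k * #|A|] coordinates are involved, and [q_small] makes each group of [k]
cost a factor 2 only. *)
Lemma mean_prod_penalty (A : {set V}) :
  mean P (fun t => \prod_(x in A) penalty (X^~ t) x) <= (2 * delta) ^+ #|A|.
Proof.
have bP : bounded_measurable (fun t => \prod_(x in A) penalty (X^~ t) x).
  apply: (bounded_functional_measurable X (F := fun z => \prod_(x in A) penalty z x)).
  by apply: bounded_functional_prod => x; exact: bounded_functional_penalty.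
pose J := (\bigcup_(x in A) N x)%SET.
have bJ : bounded_measurable (fun t => \prod_(i in J) (1 + delta ^- k * \1_bad (X i t))).
  apply: (bounded_functional_measurable X (F := fun z => \prod_(i in J) (1 + delta ^- k * \1_bad (z i)))).
  apply: bounded_functional_prod => i; apply: bounded_functionalD; first exact: bounded_functional_cst.
  apply: bounded_functionalM; first exact: bounded_functional_cst.
  exact: bounded_functional_indic.
have h := le_mean P bP (bounded_measurableZ (delta ^+ #|A|) bJ) (fun t => prod_penalty_le (X^~ t) A).
apply: le_trans h _.
rewrite meanZ// exprMn [leRHS]mulrC ler_wpM2l ?exprn_ge0 ?(ltW delta_gt0)//.
have c0 : 0 <= delta ^- k by rewrite invr_ge0 exprn_ge0// ltW.
rewrite (le_trans (mean_prod_bad _ c0 q_ge0))//.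
rewrite (le_trans (y := ((1 + delta ^- k * q) ^+ k) ^+ #|A|))//; last first.
  by apply: lerXn2r; rewrite ?nnegrE// exprn_ge0// addr_ge0// mulr_ge0.
rewrite -exprM ler_weXn2l ?lerDl ?mulr_ge0//.
rewrite mulnC -sum_nat_const /J.
elim/big_rec2 : _ => [|x m B _ mB]; first by rewrite cards0.
by rewrite (leq_trans (leq_card_setU _ _).1)// leq_add.
Qed.

End BadCoordinates.

(** * Exponential decay of the influence of far weights *)

Section Config.
Variables (R : realType) (G : sgraph).
Let I : finType := (edge G + G)%type.
Implicit Types (S : {set G}) (e : edge G) (v : G) (x : I -> R).

Definition config_activity x := edge_activity (fun e => x (inl e)) (fun v => x (inr v)).

Lemma config_activity_gt0 x e : 0 < config_activity x e.
Proof. exact: edge_activity_gt0. Qed.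

Definition coords S : {set I} :=
  [set i : edge G + G | match i with inl e => val e \subset S | inr v => v \in S end]%SET.

Definition config_free S v x := free_prob (config_activity x) S v.

Lemma measurable_functional_activity e : measurable_functional (fun x => config_activity x e).
Proof.
rewrite /config_activity /edge_activity; apply: (@measurable_functional_comp _ _ expR) => //.
apply: measurable_functionalD; first exact: measurable_functional_coord.
apply: (@measurable_functional_comp _ _ -%R) => //.
by apply: measurable_functional_sum => v; exact: measurable_functional_coord.
Qed.

Lemma measurable_functional_matching_sum S :
  measurable_functional (fun x => matching_sum (config_activity x) S).
Proof.
apply: measurable_functional_sum => M; apply: measurable_functional_prod => e.
exact: measurable_functional_activity.
Qed.

Lemma config_free_ge0 S v x : 0 <= config_free S v x.
Proof. by apply/ltW/free_prob_gt0 => e; exact: config_activity_gt0. Qed.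

Lemma config_free_le1 S v x : config_free S v x <= 1.
Proof. by apply: free_prob_le1 => e; exact: config_activity_gt0. Qed.

Lemma bounded_functional_free S v : bounded_functional (config_free S v).
Proof.
split; last by exists 1 => x; rewrite ger0_norm ?config_free_le1// config_free_ge0.
apply: measurable_functional_div; try exact: measurable_functional_matching_sum.
by move=> x; apply/ltW/matching_sum_gt0 => e; exact: config_activity_gt0.
Qed.

Lemma depends_on_matching_sum S S' : S' \subset S ->
  depends_on (coords S) (fun x => matching_sum (config_activity x) S').
Proof.
move=> S'S x y xy; apply: eq_bigr => M /andP[_ /insideP MS]; apply: eq_bigr => e eM.
have eS := fintype.subset_trans (MS e eM) S'S.
rewrite /config_activity /edge_activity xy ?inE//; congr (expR (_ - _)); apply: eq_bigr => v ve.
by rewrite xy// inE (fintype.subsetP eS).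
Qed.

Lemma depends_on_free S v : depends_on (coords S) (config_free S v).
Proof.
move=> x y xy; rewrite /config_free /free_prob.
by rewrite !(depends_on_matching_sum _ xy)// subD1set.
Qed.

(** All weights entering the activities of the edges at [v]. *)
Definition nearby v : {set I} :=
  [set i : edge G + G | match i with inl e => v \in val e | inr u => (u == v) || adj v u end]%SET.

Lemma card_sumset (A : {set I}) : #|A| = (#|[set e : edge G | inl e \in A]%SET| + #|[set v : G | inr v \in A]%SET|)%N.
Proof.
rewrite -!sum1_card big_sumType /=; congr (_ + _)%N; by apply: eq_bigl => i; rewrite inE.
Qed.

Lemma card_nearby D v : (degree v <= D)%N -> (#|nearby v| <= 2 * D + 2)%N.
Proof.
move=> dD; rewrite card_sumset.
have h1 : (#|[set e : edge G | inl e \in nearby v]%SET| <= D)%N.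
  apply: leq_trans dD; apply: leq_trans (card_incident v).
  by apply: subset_leq_card; apply/fintype.subsetP => e; rewrite !inE.
have h2 : (#|[set u : G | inr u \in nearby v]%SET| <= D.+1)%N.
  apply: leq_trans (_ : #|v |: [set u : G | adj v u]%SET| <= _)%N.
    by apply: subset_leq_card; apply/fintype.subsetP => e; rewrite !inE.
  by rewrite cardsU1 (leq_add (leq_b1 _) dD).
lia.
Qed.

Lemma card_nearby_inv D i : (forall v : G, degree v <= D)%N ->
  (#|[set v | i \in nearby v]%SET| <= 2 * D + 2)%N.
Proof.
move=> dD; case: i => [e|u].
  apply: leq_trans (_ : #|val e| <= _)%N; last by rewrite card_edge_val; lia.
  by apply: subset_leq_card; apply/fintype.subsetP => v; rewrite !inE.
apply: leq_trans (_ : #|u |: [set v : G | adj u v]%SET| <= _)%N.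
  apply: subset_leq_card; apply/fintype.subsetP => v; rewrite !inE eq_sym => /orP[->//|].
  by rewrite adj_sym => ->; rewrite orbT.
have := dD u; rewrite cardsU1 /degree; case: (_ \notin _) => /=; lia.
Qed.

Lemma config_activity_bounds a x e : (forall v, v \in val e -> `|x (inr v)| <= a) -> `|x (inl e)| <= a ->
  expR (- (3 * a)) <= config_activity x e <= expR (3 * a).
Proof.
move=> ha he; rewrite /config_activity /edge_activity !ler_expR.
have [y [z [ve yz _]]] := edge_pair e.
rewrite ve big_setU1 ?inE//= big_set1.
have := ha y; have := ha z; move: he; rewrite ve !inE !eqxx orbT => + /(_ isT) + /(_ isT).
rewrite !ler_norml; lra.
Qed.

Lemma local_activity_good a x v D : (degree v <= D)%N ->
  (forall i, i \in nearby v -> `|x i| <= a) ->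
  local_activity (config_activity x) v <= D%:R * expR (3 * a).
Proof.
move=> dD h; rewrite /local_activity.
apply: (@le_trans _ _ (\sum_(e in incident v) expR (3 * a))).
  apply: ler_sum => e; rewrite inE => ve.
  have /andP[//] : expR (- (3 * a)) <= config_activity x e <= expR (3 * a).
  apply: config_activity_bounds; last by apply: h; rewrite inE.
  move=> u ue; apply: h; rewrite inE; have [E _ ad] := otherP ve.
  by move: ue; rewrite E !inE => /orP[->//|/eqP ->]; rewrite ad orbT.
rewrite sumr_const -[_ *+ _]mulr_natl ler_wpM2r ?expR_ge0// ler_nat.
exact: leq_trans (card_incident v) dD.
Qed.

End Config.

Section Decay.
Context (R : realType) (G : sgraph) d (T : measurableType d) (P : probability T R).
Let I : finType := (edge G + G)%type.
Context (X : I -> {RV P >-> R}).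
Hypothesis indep : mutually_independent P X.
Variables (D : nat) (a q : R) (m : nat).
Hypothesis degree_le : forall v : G, (degree v <= D)%N.
Let bad : set R := [set y | a < `|y|].
Hypothesis badq : forall i, (P (X i @^-1` bad) <= q%:E)%E.
Let k := (2 * D + 2)%N.
Let delta : R := (4 * D.+1%:R)^-1.
Hypothesis q_ge0 : 0 <= q.
Hypothesis q_small : (1 + delta ^- k * q) ^+ k <= 2.
Hypothesis m_gt0 : (0 < m)%N.
Hypothesis m_large : (D%:R * expR (3 * a) / (1 + D%:R * expR (3 * a))) ^+ m <= delta.

Let delta01 : 0 < delta < 1.
Proof.
have h : 1 <= D.+1%:R :> R by rewrite ler1n.
have h4 : 1 < 4 * D.+1%:R :> R by lra.
by rewrite /delta invr_gt0 (lt_trans ltr01 h4)/= invf_lt1// (lt_trans ltr01 h4).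
Qed.

Let mbad : measurable bad.
Proof. exact: measurable_norm_gt. Qed.

Let pen (x : I -> R) v := penalty bad (nearby (G:=G)) delta x v.

(** If no weight near [v] is bad, the local activity is bounded and the choice of [m]
applies; otherwise the penalty is at least 1. *)
Lemma contraction_penalty x v : contraction_rate (config_activity x) v ^+ m <= pen x v.
Proof.
have lp e : 0 < config_activity x e by exact: config_activity_gt0.
have [|] := pselect (exists2 i, i \in nearby v & bad (x i)).
  move=> [i iv bi]; apply: le_trans (penalty_bad delta01 iv bi).
  by rewrite exprn_ile1 ?contraction_rate_ge0 ?contraction_rate_le1.
move=> h; apply: le_trans (penalty_good bad (nearby (G:=G)) delta01 x v).
apply: le_trans m_large; apply: lerXn2r.
- by rewrite nnegrE contraction_rate_ge0.
- by rewrite nnegrE divr_ge0 ?addr_ge0 ?mulr_ge0 ?expR_ge0.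
have := @local_activity_good R G a x v D (degree_le v).
have [L0 T0] : 0 <= local_activity (config_activity x) v /\ 0 <= D%:R * expR (3 * a).
  by split; [exact: local_activity_ge0|rewrite mulr_ge0 ?expR_ge0].
move=> H; have {H} : local_activity (config_activity x) v <= D%:R * expR (3 * a).
  by apply: H => i iv; rewrite leNgt; apply/negP => bi; apply: h; exists i.
rewrite /contraction_rate; set L := local_activity _ _; set B := _ * _ => LB.
by rewrite ler_pdivrMr ?ltr_pwDl// mulrAC ler_pdivlMr ?ltr_pwDl//; nra.
Qed.

Let walk r S v t : R := walk_sum (pen (X^~ t)) r S v.

Lemma bounded_functional_walk r S v : bounded_functional (fun x => walk_sum (pen x) r S v).
Proof.
elim: r S v => [|r IH] S v /=; first exact: bounded_functional_cst.
apply: bounded_functionalM; first exact: bounded_functional_penalty.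
by apply: bounded_functional_sum => e; exact: IH.
Qed.

(** The penalties along a walk are dependent, so the induction carries the set [A] of
the vertices visited so far and takes expectations only at the end. A step offers at
most [D] edges and brings a new factor [2 * delta = (2 * D.+1)^-1], which halves the
bound. *)
Lemma mean_walk r (S : {set G}) v (A : {set G}) : v \in S -> [disjoint A & S]%B ->
  mean P (fun t => (\prod_(z in A) pen (X^~ t) z) * walk r S v t) <=
  (2 * delta) ^+ #|A| * 2^-1 ^+ r.
Proof.
have bpen : bounded_functional (fun x => \prod_(z in A) pen x z).
  by apply: bounded_functional_prod => z; exact: bounded_functional_penalty.
elim: r S v A {bpen} => [|r IH] S v A vS AS.
  under eq_mean do rewrite /walk /= mulr1.
  by rewrite expr0 mulr1; apply: mean_prod_penalty => // [z|i|]; [exact: card_nearby (degree_le z)|exact: card_nearby_inv|].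
have vA : v \notin A by move: AS; rewrite disjoint_sym => /disjointFr/(_ vS) ->.
rewrite (@eq_mean _ _ _ _ _ (fun t => \sum_(e in incident v | val e \subset S)
   ((\prod_(z in v |: A) pen (X^~ t) z) * walk r (S :\ v) (other v e) t))); last first.
  by move=> t; rewrite -mulr_sumr big_setU1//= /walk /= mulrCA mulrA.
rewrite mean_sum; last first.
  move=> e _; apply: (bounded_functional_measurable X (F := fun x =>
    (\prod_(z in (v |: A)%SET) pen x z) * walk_sum (pen x) r (S :\ v) (other v e))).
  apply: bounded_functionalM; last exact: bounded_functional_walk.
  by apply: bounded_functional_prod => z; exact: bounded_functional_penalty.
apply: (@le_trans _ _ (\sum_(e in incident v | val e \subset S) (2 * delta) ^+ #|A|.+1 * 2^-1 ^+ r)).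
  apply: ler_sum => e /andP[]; rewrite inE => ve eS.
  have -> : #|A|.+1 = #|v |: A|%SET by rewrite cardsU1 vA.
  apply: IH.
    have [_ ov _] := otherP ve; rewrite !inE ov (fintype.subsetP eS)//; exact: other_in.
  rewrite finset.disjoints_subset; apply/fintype.subsetP => z; rewrite !inE => /predU1P[->|zA]; first by rewrite eqxx.
  by rewrite (disjointFr AS zA) andbF.
have d0 : 0 <= 2 * delta by case/andP: delta01 => /ltW; lra.
apply: (@le_trans _ _ (\sum_(e in incident v) (2 * delta) ^+ #|A|.+1 * 2^-1 ^+ r)).
  rewrite [leRHS](bigID (fun e : edge G => val e \subset S))/= lerDl sumr_ge0// => e _.
  by rewrite mulr_ge0// exprn_ge0// invr_ge0.
rewrite sumr_const -[_ *+ _]mulr_natl !exprS.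
have : #|incident v|%:R * (2 * delta) <= 2^-1.
  apply: (@le_trans _ _ (D.+1%:R * (2 * delta))).
    rewrite ler_wpM2r// ler_nat; apply: leq_trans (card_incident v) _.
    exact: leq_trans (degree_le v) _.
  rewrite /delta; have : D.+1%:R != 0 :> R by rewrite pnatr_eq0.
  move: (D.+1%:R : R) => n n0; rewrite (_ : n * _ = 2^-1)//; by field.
have e0 : 0 <= (2 * delta) ^+ #|A| * 2^-1 ^+ r by rewrite mulr_ge0 ?exprn_ge0 ?invr_ge0.
move=> /(ler_wpM2l e0); congr (_ <= _); ring.
Qed.

Let gamma : R := expR (- (ln 2 / m.+1%:R)).

Let gammaX : gamma ^+ m.+1 = 2^-1.
Proof.
rewrite /gamma -expRM_natl mulrN mulrCA mulfV ?pnatr_eq0// mulr1 expRN lnK// posrE; lra.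
Qed.

(** Let [s = gamma ^+ r] and let [Y] be the decay, a number in the unit interval. Then
[Y <= s + Y ^+ m / s ^+ m], and the mean of [Y ^+ m] is at most [2^-1 ^+ r = s ^+ m.+1]
by the bound on walks. So both terms have mean at most [s]. *)
Lemma mean_free_dist r (S : {set G}) v : (forall y, dist_le r v y -> y \in S) ->
  mean P (fun t => `|config_free [set: G]%SET v (X^~ t) - config_free S v (X^~ t)|) <=
  2 * gamma ^+ r.
Proof.
move=> rS; set s := gamma ^+ r.
have s0 : 0 < s by rewrite exprn_gt0// expR_gt0.
have sm : s ^+ m.+1 = 2^-1 ^+ r by rewrite /s -exprM mulnC exprM gammaX.
have bf U : bounded_measurable (fun t => config_free U v (X^~ t)).
  exact (bounded_functional_measurable X (bounded_functional_free R U v)).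
have bw : bounded_measurable (walk r [set: G]%SET v).
  exact (bounded_functional_measurable X (bounded_functional_walk r _ v)).
have bn := bounded_measurable_norm (bounded_measurableB (bf [set: G]%SET) (bf S)).
have bs := bounded_measurableD (bounded_measurable_cst T s) (bounded_measurableZ (s ^- m) bw).
apply: (@le_trans _ _ (mean P (fun t => s + s ^- m * walk r [set: G]%SET v t))).
  apply: le_mean => // t.
  have lp e : 0 < config_activity (X^~ t) e by exact: config_activity_gt0.
  have := free_prob_dist lp (S := [set: G]%SET) (S' := S) (x := v) (r := r).
  rewrite -/(config_free _ _ _) -/(config_free _ _ _) => H.
  apply: le_trans (H _) _; first by move=> y /rS ->; rewrite inE.
  have dm := decay_expn lp r [set: G]%SET v m_gt0 (contraction_penalty (X^~ t)).
  have d0 := decay_ge0 lp r [set: G]%SET v.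
  have d1 := decay_le1 lp r [set: G]%SET v.
  have w0 : 0 <= walk r [set: G]%SET v t by apply: le_trans dm; rewrite exprn_ge0.
  (* A Markov inequality with threshold s. *)
  have [ds|sd] := leP (decay (config_activity (X^~ t)) r [set: G]%SET v) s.
    by rewrite (le_trans ds)// lerDl mulr_ge0// invr_ge0 exprn_ge0// ltW.
  rewrite (le_trans d1)// (@le_trans _ _ (s ^- m * walk r [set: G]%SET v t))//; last first.
    by rewrite lerDr ltW.
  rewrite [leRHS]mulrC (ler_pdivlMr _ _ (exprn_gt0 m s0)) mul1r (le_trans _ dm)//.
  by apply: lerXn2r; rewrite ?nnegrE ?(ltW s0)// ltW.
rewrite meanD//; [|exact: bounded_measurable_cst|exact: bounded_measurableZ].
rewrite mean_cst meanZ// mulr_natl mulr2n lerD2l.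
have := @mean_walk r [set: G]%SET v finset.set0; rewrite inE cards0 expr0 mul1r => /(_ isT).
rewrite finset.disjoints_subset finset.sub0set => /(_ isT) h.
rewrite mulrC (ler_pdivrMr _ _ (exprn_gt0 m s0)) -exprS sm (le_trans _ h)// le_eqVlt; apply/orP; left; apply/eqP.
by apply: eq_mean => t; rewrite big_set0 mul1r.
Qed.

End Decay.

(** * Translation of the Gaussian law *)

Section Density.
Local Open Scope ereal_scope.
Import HBNNSimple.
Context d (T : measurableType d) (R : realType).
Variables (mu nu : {measure set T -> \bar R}) (p : T -> R).
Hypothesis p_ge0 : forall x, (0 <= p x)%R.
Hypothesis mp : measurable_fun setT p.
Hypothesis nuE : forall A, measurable A -> nu A = \int[mu]_(x in A) (p x)%:E.

Let density_nnsfun (h : {nnsfun T >-> R}) :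
  \int[nu]_x (h x)%:E = \int[mu]_x ((h x)%:E * (p x)%:E).
Proof.
rewrite integralT_nnsfun sintegralE.
transitivity (\int[mu]_x (\sum_(y \in range h) ((y * \1_(h @^-1` [set y]) x)%:E * (p x)%:E))); last first.
  apply: eq_integral => x _.
  rewrite -ge0_mule_fsuml => [|y]; last exact: nnfun_muleindic_ge0.
  by rewrite fsumEFin// -(fimfunE _ x).
rewrite ge0_integral_fsum//; last 2 first.
- move=> y; apply: emeasurable_funM => //; apply/measurable_EFinP => //.
  exact: measurable_funM.
- by move=> y x _; apply: mule_ge0; [exact: nnfun_muleindic_ge0|rewrite lee_fin].
apply: eq_fsbigr => r; rewrite inE => -[t _ <-].
under eq_integral do rewrite EFinM -muleA.
rewrite ge0_integralZl//; last 3 first.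
- by apply: emeasurable_funM => //; apply/measurable_EFinP.
- by move=> x _; rewrite mule_ge0 ?lee_fin.
- by rewrite lee_fin.
congr (_ * _); rewrite nuE// integral_mkcond; apply: eq_integral => x _.
by rewrite patchE indicE; case: (_ \in _); rewrite ?mul1e ?mul0e.
Qed.

(** For simple functions this is linearity; monotone convergence gives the rest. *)
Lemma ge0_integral_density (f : T -> \bar R) : measurable_fun setT f -> (forall x, 0 <= f x) ->
  \int[nu]_x f x = \int[mu]_x (f x * (p x)%:E).
Proof.
move=> mf f0.
pose h := nnsfun_approx measurableT mf.
have fE x : f x = lim ((EFin \o h n) x @[n --> \oo]).
  by apply/esym/cvg_lim => //; exact: cvg_nnsfun_approx.
have fpE x : f x * (p x)%:E = lim (((h n) x)%:E * (p x)%:E @[n --> \oo]).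
  apply/esym/cvg_lim => //; apply: cvgeZr => //.
  exact: cvg_nnsfun_approx.
have -> : \int[nu]_x f x = lim (\int[nu]_x ((h n) x)%:E @[n --> \oo]).
  under eq_integral do rewrite fE.
  apply: monotone_convergence => //.
  - by move=> n; apply/measurable_EFinP.
  - by move=> n x _; rewrite lee_fin.
  - by move=> x _ a b ab; rewrite lee_fin; exact/lefP/nd_nnsfun_approx.
have -> : \int[mu]_x (f x * (p x)%:E) = lim (\int[mu]_x (((h n) x)%:E * (p x)%:E) @[n --> \oo]).
  under eq_integral do rewrite fpE.
  apply: monotone_convergence => //.
  - by move=> n; apply: emeasurable_funM => //; apply/measurable_EFinP.
  - by move=> n x _; rewrite mule_ge0// lee_fin.
  - by move=> x _ a b ab; rewrite lee_wpmul2r ?lee_fin//; exact/lefP/nd_nnsfun_approx.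
by under eq_fun do rewrite density_nnsfun.
Qed.

End Density.

Section Gaussian.
Context (R : realType).
Notation mu := (@lebesgue_measure R).

(** The translate of Lebesgue measure has the same values on intervals. *)
Lemma lebesgue_translation (c : R) (f : R -> \bar R) : measurable_fun setT f ->
  (forall x, 0 <= f x)%E -> (\int[mu]_x f (x + c)%R = \int[mu]_x f x)%E.
Proof.
move=> mf f0.
pose tr : measurableTypeR R -> measurableTypeR R := fun x => x + c.
have mt : measurable_fun setT tr by exact: measurable_funD.
transitivity (\int[pushforward mu tr]_x f x)%E.
  by rewrite ge0_integral_pushforward.
apply: eq_measure_integral => A mA _.
apply/esym/lebesgue_measure_unique => //.
move=> _ [[a b] /= _ <-]; rewrite /pushforward /=.
rewrite (_ : tr @^-1` _ = `]a - c, b - c]%classic); last first.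
  by apply/seteqP; split => x /=; rewrite !in_itv/= ltrBlDr lerBrDr.
by rewrite !lebesgue_measure_itv/= !lte_fin ltrD2r -!EFinB; case: ifP => // _; congr (_%:E); ring.
Qed.

(** The density of the normal law with mean [eps] and variance 1 with respect to the
standard one. *)
Definition tilt (eps y : R) := expR (eps * y - eps ^+ 2 / 2).

Lemma gaussian_shift (eps : R) (f : R -> R) : measurable_fun setT f -> (forall x, 0 <= f x) ->
  (\int[normal_prob 0 1]_y (tilt eps y * f y)%R%:E = \int[normal_prob 0 1]_y (f (y + eps)%R)%:E)%E.
Proof.
move=> mf f0.
have mp : measurable_fun setT (@normal_pdf R 0 1) by exact: measurable_normal_pdf.
have p0 x : 0 <= normal_pdf 0 1 x :> R by exact: normal_pdf_ge0.
have mtilt : measurable_fun setT (tilt eps).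
  apply: measurableT_comp => //; apply: measurable_funB => //; exact: measurable_funM.
have mtf : measurable_fun setT (fun y => tilt eps y * f y) by exact: measurable_funM.
have mfs : measurable_fun setT (fun y : R => f (y + eps)).
  by apply: (measurableT_comp mf); exact: measurable_funD.
have nE A : measurable A -> normal_prob 0 1 A = (\int[mu]_(x in A) (normal_pdf 0 1 x)%:E)%E by [].
rewrite (@ge0_integral_density _ (measurableTypeR R) R mu (normal_prob 0 1) _ p0 mp nE (fun y => (tilt eps y * f y)%:E)); last 2 first.
- exact/measurable_EFinP.
- by move=> x; rewrite lee_fin mulr_ge0// expR_ge0.
rewrite (@ge0_integral_density _ (measurableTypeR R) R mu (normal_prob 0 1) _ p0 mp nE (fun y => (f (y + eps))%:E)); last 2 first.
- exact/measurable_EFinP.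
- by move=> x; rewrite lee_fin.
rewrite -(@lebesgue_translation eps (fun y => (tilt eps y * f y)%:E * (normal_pdf 0 1 y)%:E)%E).
- apply: eq_integral => y _; rewrite -!EFinM; congr (_%:E).
  rewrite !normal_pdfE ?oner_eq0// /normal_fun /tilt [_ * f _]mulrC -!mulrA; congr (_ * _).
  by rewrite mulrCA; congr (_ * _); rewrite -expRD; congr expR; field.
- by apply: emeasurable_funM; exact/measurable_EFinP.
- by move=> x; rewrite mule_ge0 ?lee_fin// mulr_ge0// expR_ge0.
Qed.

End Gaussian.

(** * A variance bound by translation of coordinates *)

Section Tilt.
Context (R : realType) d (T : measurableType d) (P : probability T R) (I : finType)
  (X : I -> {RV P >-> R}) (eps : R).
Hypothesis indep : mutually_independent P X.

Definition shift_coords (s : pred I) (x : I -> R) : I -> R := fun i => x i + (if s i then eps else 0).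

Lemma measurable_functional_shift s F : measurable_functional F ->
  measurable_functional (fun x => F (shift_coords s x)).
Proof.
move=> mF d' T' X' mX'; apply: (mF _ _ (fun i t => X' i t + (if s i then eps else 0))) => i.
exact: measurable_funD.
Qed.

Lemma measurable_tilt : measurable_fun setT (tilt eps).
Proof.
by apply: measurableT_comp => //; apply: measurable_funB => //; exact: measurable_funM.
Qed.

(** Resampling isolates the coordinate [i]: with the others fixed, it is a statement on
the one-dimensional Gaussian law. *)
Lemma gaussian_coord_shift i (F : (I -> R) -> R) :
  (forall A : set R, measurable A -> distribution P (X i) A = normal_prob 0 1 A) ->
  measurable_functional F -> (forall x, 0 <= F x) ->
  (\int[P]_t (tilt eps (X i t) * F (X^~ t))%:E = \int[P]_t (F (shift_coords (pred1 i) (X^~ t)))%:E)%E.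
Proof.
move=> law mF F0.
have mL : measurable_functional (fun x : I -> R => tilt eps (x i) * F x).
  apply: measurable_functionalM => //.
  apply: (@measurable_functional_comp _ _ (tilt eps)); first exact: measurable_tilt.
  exact: measurable_functional_coord.
rewrite (indep_resample indep [set~ i]%SET mL); last first.
  by move=> x; rewrite mulr_ge0// expR_ge0.
rewrite (indep_resample indep [set~ i]%SET (measurable_functional_shift (pred1 i) mF))//.
apply: eq_integral => s _.
pose k (y : R) := F (fun j => if j == i then y else X j s).
have mk : measurable_fun setT k.
  by apply: (mF _ _ (fun j y => if j == i then y else X j s)) => j; case: eqVneq.
have mkE (h : R -> R) : measurable_fun setT h -> (forall y, 0 <= h y) ->
    (\int[P]_t (h (X i t))%:E = \int[normal_prob 0 1]_y (h y)%:E)%E.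
  move=> mh h0.
  have mXi : measurable_fun setT (X i) by [].
  have mY : measurable_fun setT (X i : T -> measurableTypeR R).
    by move=> mT A mA; exact: (mXi mT A mA).
  pose Y : {mfun T >-> measurableTypeR R} :=
    HB.pack (X i : T -> measurableTypeR R) (isMeasurableFun.Build _ _ _ _ _ mY).
  rewrite -(@ge0_integral_distribution _ _ _ (measurableTypeR R) _ P Y (fun y => (h y)%:E)).
  - by apply: eq_measure_integral => A mA _; exact: law.
  - exact/measurable_EFinP.
  - by move=> y; rewrite lee_fin.
transitivity (\int[P]_t (tilt eps (X i t) * k (X i t))%:E)%E.
  apply: eq_integral => t _; rewrite !inE eqxx /=; congr ((_ * F _)%:E).
  by apply/funext => j; rewrite !inE; case: eqVneq => [->|].
rewrite (mkE (fun y => tilt eps y * k y)); last 2 first.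
- by apply: measurable_funM => //; exact: measurable_tilt.
- by move=> y; rewrite mulr_ge0// ?expR_ge0// F0.
rewrite gaussian_shift//; last by move=> y; exact: F0.
rewrite -(mkE (fun y => k (y + eps))); last 2 first.
- by apply: (measurableT_comp mk); exact: measurable_funD.
- by move=> y; exact: F0.
apply: eq_integral => t _; congr ((F _)%:E); apply/funext => j.
by rewrite /shift_coords !inE /=; case: eqVneq => [->|]; rewrite ?addr0.
Qed.

Definition likelihood (s : seq I) (x : I -> R) := \prod_(i <- s) tilt eps (x i).

Lemma likelihood_ge0 s x : 0 <= likelihood s x.
Proof. by apply: prodr_ge0 => i _; exact: expR_ge0. Qed.

Lemma measurable_functional_likelihood s : measurable_functional (likelihood s).
Proof.
apply: measurable_functional_prod => i.
apply: (@measurable_functional_comp _ _ (tilt eps)); first exact: measurable_tilt.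
exact: measurable_functional_coord.
Qed.

(** The coordinates are shifted one at a time. *)
Lemma likelihood_shift s (F : (I -> R) -> R) : uniq s ->
  (forall i, i \in s -> forall A : set R, measurable A ->
     distribution P (X i) A = normal_prob 0 1 A) ->
  measurable_functional F -> (forall x, 0 <= F x) ->
  (\int[P]_t (likelihood s (X^~ t) * F (X^~ t))%:E =
   \int[P]_t (F (shift_coords (mem s) (X^~ t)))%:E)%E.
Proof.
elim: s F => [|i s IH] F /=.
  move=> _ _ mF F0; apply: eq_integral => t _.
  rewrite /likelihood big_nil mul1r; congr ((F _)%:E); apply/funext => j.
  by rewrite /shift_coords /= addr0.
move=> /andP[iNs us] law mF F0.
transitivity (\int[P]_t (tilt eps (X i t) * (likelihood s (X^~ t) * F (X^~ t)))%:E)%E.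
  by apply: eq_integral => t _; rewrite /likelihood big_cons mulrA.
rewrite (@gaussian_coord_shift i (fun x => likelihood s x * F x)); last 3 first.
- by apply: law; rewrite mem_head.
- by apply: measurable_functionalM => //; exact: measurable_functional_likelihood.
- by move=> x; rewrite mulr_ge0// likelihood_ge0.
transitivity (\int[P]_t (likelihood s (X^~ t) * F (shift_coords (pred1 i) (X^~ t)))%:E)%E.
  apply: eq_integral => t _; congr ((_ * _)%:E); rewrite /likelihood !big_seq.
  apply: eq_bigr => j js; rewrite /shift_coords /=; case: eqVneq => [ji|]; rewrite ?addr0//.
  by rewrite -ji js in iNs.
rewrite (IH (fun x => F (shift_coords (pred1 i) x)))//; last 2 first.
- by move=> j js; apply: law; rewrite inE js orbT.
- exact: measurable_functional_shift.
apply: eq_integral => t _; congr ((F _)%:E); apply/funext => j.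
rewrite /shift_coords /= inE; case: eqVneq => [->|_] /=; last by rewrite addr0.
by rewrite (negbTE iNs) addr0.
Qed.

(** The Hammersley-Chapman-Robbins inequality: if shifting the coordinates in [s] by
[eps] moves the mean of [F] by [gap], then the variance of [F] is at least [gap ^+ 2]
divided by the chi-square distance of the shift. It is left in the quadratic form,
before optimization over [c]. *)
Lemma variance_shift_bound s (F : (I -> R) -> R) : uniq s ->
  (forall i, i \in s -> forall A : set R, measurable A ->
     distribution P (X i) A = normal_prob 0 1 A) ->
  bounded_functional F ->
  let m := mean P (fun t => F (X^~ t)) in
  let gap := mean P (fun t => F (shift_coords (mem s) (X^~ t))) - m in
  forall c : R, 2 * c * gap - c ^+ 2 * (expR ((size s)%:R * eps ^+ 2) - 1) <=
    mean P (fun t => (F (X^~ t) - m) ^+ 2).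
Proof.
move=> us law bF m gap c.
pose L t := likelihood s (X^~ t).
have mL : measurable_fun setT L.
  exact: (measurable_functional_likelihood s).
have L0 t : 0 <= L t by exact: likelihood_ge0.
have EL : (\int[P]_t (L t)%:E = 1)%E.
  have := likelihood_shift us law (F := fun=> 1) (@measurable_functional_cst _ _ 1) (fun=> ler01).
  rewrite /= integral_cst//= mul1e (_ : P _ = 1%E); last exact: probability_setT.
  move=> <-.
  by apply: eq_integral => t _; rewrite mulr1.
have EL2 : (\int[P]_t (L t ^+ 2)%:E = (expR ((size s)%:R * eps ^+ 2))%:E)%E.
  have := likelihood_shift us law (@measurable_functional_likelihood s) (@likelihood_ge0 s).
  under eq_integral do rewrite -expr2.
  move=> ->; transitivity (\int[P]_t ((expR ((size s)%:R * eps ^+ 2))%:E * (L t)%:E))%E.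
    apply: eq_integral => t _; rewrite -EFinM; congr (_%:E).
    have -> : expR ((size s)%:R * eps ^+ 2) = \prod_(i <- s) expR (eps ^+ 2).
      by rewrite -expR_sum big_const_seq count_predT iter_addr_0 mulr_natl.
    rewrite /L /likelihood -big_split/= !big_seq; apply: eq_bigr => i iS.
    by rewrite /shift_coords /= iS /tilt -expRD; congr expR; ring.
  rewrite ge0_integralZl ?EL ?mule1 ?lee_fin ?expR_ge0//.
    exact/measurable_EFinP.
  by move=> t _; rewrite lee_fin.
have iL : P.-integrable setT (EFin \o L).
  apply/integrableP; split; first exact/measurable_EFinP.
  by under eq_integral do rewrite /= ger0_norm//; rewrite EL ltry.
have iL2 : P.-integrable setT (EFin \o (fun t => L t ^+ 2)).
  apply/integrableP; split; first by apply/measurable_EFinP; exact: measurable_funX.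
  by under eq_integral do rewrite /= ger0_norm// ?sqr_ge0//; rewrite EL2 ltry.
have bS (g : (I -> R) -> R) : bounded_functional g -> bounded_functional (fun x => g (shift_coords (mem s) x)).
  by move=> [mg [C gC]]; split; [exact: measurable_functional_shift|exists C].
have ELg (g : (I -> R) -> R) : bounded_functional g ->
    P.-integrable setT (EFin \o (fun t => g (X^~ t) * L t)) /\
    \int[P]_t (g (X^~ t) * L t) = mean P (fun t => g (shift_coords (mem s) (X^~ t))).
  move=> bg; have [mg [C gC]] := bg.
  have bgX := bounded_functional_measurable X bg.
  have igL : P.-integrable setT (EFin \o (fun t => g (X^~ t) * L t)).
    have iCL : P.-integrable setT (EFin \o (fun t => C * L t)).
      have := integrableZl measurableT C iL.
      by apply: eq_integrable => // t _; rewrite /= EFinM.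
    apply: le_integrable iCL => //; first by apply/measurable_EFinP/measurable_funM => //; exact: bgX.1.
    move=> t _ /=; rewrite lee_fin !normrM ler_wpM2r//.
    exact: le_trans (gC _) (ler_norm _).
  split => //.
  have gC0 x : 0 <= g x + C by have := gC x; rewrite ler_norml; lra.
  have bgC : bounded_functional (fun x => g x + C).
    by apply: bounded_functionalD => //; exact: bounded_functional_cst.
  have H := likelihood_shift us law bgC.1 gC0.
  have bsg := bounded_functional_measurable X (bS _ bg).
  have bsgC := bounded_functional_measurable X (bS _ bgC).
  have : \int[P]_t (g (X^~ t) * L t + C * L t) = mean P (fun t => g (shift_coords (mem s) (X^~ t)) + C).
    rewrite /mean /Rintegral -H; congr fine; apply: eq_integral => t _; congr (_%:E).
    by rewrite /L; ring.
  have iCL : P.-integrable setT (EFin \o (fun t => C * L t)).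
    have := integrableZl measurableT C iL.
    by apply: eq_integrable => // t _; rewrite /= EFinM.
  rewrite RintegralD// RintegralZl// meanD//; last exact: bounded_measurable_cst.
  by rewrite mean_cst {2}/Rintegral EL /= mulr1 => /addIr.
(* The square to be expanded is that of F - m - c * (L - 1), written as u - c * L. *)
pose u (x : I -> R) := F x - m + c.
have bu : bounded_functional u.
  apply: bounded_functionalD; last exact: bounded_functional_cst.
  by apply: bounded_functionalD => //; exact: bounded_functional_cst.
have buX := bounded_functional_measurable X bu.
have bFX := bounded_functional_measurable X bF.
have [iuL EuL] := ELg _ bu.
have i1 : P.-integrable setT (EFin \o (fun t => u (X^~ t) ^+ 2)).
  by apply: bounded_measurable_integrable; exact: bounded_measurableX.
have i2 : P.-integrable setT (EFin \o (fun t => - 2 * c * (u (X^~ t) * L t))).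
  have := integrableZl measurableT (- 2 * c) iuL.
  by apply: eq_integrable => // t _; rewrite /= EFinM.
have i3 : P.-integrable setT (EFin \o (fun t => c ^+ 2 * L t ^+ 2)).
  have := integrableZl measurableT (c ^+ 2) iL2.
  by apply: eq_integrable => // t _; rewrite /= EFinM.
have : 0 <= \int[P]_t ((u (X^~ t) ^+ 2 + (- 2 * c * (u (X^~ t) * L t))) + c ^+ 2 * L t ^+ 2).
  apply: Rintegral_ge0 => t _; have := sqr_ge0 (u (X^~ t) - c * L t).
  by congr (0 <= _); ring.
rewrite RintegralD//; last first.
  have := integrableD measurableT i1 i2.
  by apply: eq_integrable.
rewrite RintegralD// !RintegralZl// EuL (_ : \int[P]_x L x ^+ 2 = expR ((size s)%:R * eps ^+ 2)); last by rewrite /Rintegral EL2 /=.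
have -> : mean P (fun t => u (shift_coords (mem s) (X^~ t))) = gap + c.
  have bsF := bounded_functional_measurable X (bS _ bF).
  rewrite /u meanD; [|exact: bounded_measurableB bsF (bounded_measurable_cst _ m)|exact: bounded_measurable_cst].
  rewrite meanB//; last exact: bounded_measurable_cst.
  by rewrite !mean_cst.
have -> : \int[P]_t (u (X^~ t) ^+ 2) = mean P (fun t => (F (X^~ t) - m) ^+ 2) + c ^+ 2.
  have bc (c0 : R) := bounded_measurable_cst T c0.
  have bFm := bounded_measurableB bFX (bc m).
  rewrite -[LHS]/(mean P (fun t => u (X^~ t) ^+ 2)).
  rewrite (@eq_mean _ _ _ _ _ (fun t => (F (X^~ t) - m) ^+ 2 + (2 * c * (F (X^~ t) - m) + c ^+ 2))); last first.
    by move=> t; rewrite /u; ring.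
  rewrite meanD//; [|exact: bounded_measurableX|by apply: bounded_measurableD => //; exact: bounded_measurableZ].
  rewrite meanD//; last exact: bounded_measurableZ.
  by rewrite meanZ// meanB// !mean_cst -/m subrr mulr0 add0r.
rewrite /gap; set A := mean P _; set B := mean P _; nra.
Qed.

End Tilt.

(** * Calculus on the real line *)

Section Calculus.
Variable R : realType.
Implicit Types (F f : R -> R) (x y : R).

Lemma is_derive_continuous F dF : (forall x, is_derive x (1 : R) F (dF x)) -> continuous F.
Proof.
move=> d x; apply: differentiable_continuous; apply/derivable1_diffP.
by have := d x; case.
Qed.

Lemma mean_value_on F dF x y : (forall z, x <= z <= y -> is_derive z (1 : R) F (dF z)) -> x <= y ->
  exists2 z, x <= z <= y & F y - F x = dF z * (y - x).
Proof.
move=> d xy; have cF : {within `[x, y], continuous F}.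
  apply: derivable_within_continuous => z; rewrite in_itv/= => zxy.
  by have := d z zxy; case.
have dF' z : z \in `]x, y[ -> is_derive z (1 : R) F (dF z).
  by rewrite in_itv/= => /andP[/ltW xz /ltW zy]; apply: d; rewrite xz.
have [z + ->] := @MVT_segment R F dF x y xy dF' cF.
by rewrite in_itv/= => zxy; exists z.
Qed.

Lemma mean_value F dF x y : (forall z, is_derive z (1 : R) F (dF z)) -> x <= y ->
  exists2 z, x <= z <= y & F y - F x = dF z * (y - x).
Proof. by move=> d; apply: mean_value_on. Qed.

Lemma lipschitz_of_derive F dF B : (forall x, is_derive x (1 : R) F (dF x)) ->
  (forall x, `|dF x| <= B) -> forall x y, `|F y - F x| <= B * `|y - x|.
Proof.
move=> d dB x y; wlog xy : x y / x <= y => [H|].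
  have [xy|/ltW yx] := leP x y; first exact: H.
  by rewrite distrC [`|y - x|]distrC; exact: H.
by have [z _ ->] := mean_value d xy; rewrite normrM ler_wpM2r.
Qed.

(** The remainder is not sharp (the factor 1/2 is missing), which makes the mean value
theorem sufficient. *)
Lemma taylor2 F F1 F2 B : (forall x, is_derive x (1 : R) F (F1 x)) ->
  (forall x, is_derive x (1 : R) F1 (F2 x)) -> (forall x, `|F2 x| <= B) ->
  forall x y, `|F y - F x - F1 x * (y - x)| <= B * (y - x) ^+ 2.
Proof.
move=> d1 d2 B2 x y; have L := lipschitz_of_derive d2 B2.
have B0 : 0 <= B by rewrite (le_trans _ (B2 0)).
have [z zxy E] : exists2 z, `|z - x| <= `|y - x| & F y - F x = F1 z * (y - x).
  have [xy|/ltW yx] := leP x y.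
    have [z /andP[xz zy] E] := mean_value d1 xy; exists z => //.
    by rewrite !ger0_norm ?subr_ge0// lerD2r.
  have [z /andP[yz zx] E] := mean_value d1 yx; exists z; last first.
    by rewrite -opprB E; ring.
  by rewrite !ler0_norm ?subr_le0// !opprB lerD2l lerN2.
rewrite E -mulrBl normrM -(normr_id (y - x)) expr2.
have -> : (y - x) * (y - x) = `|y - x| * `|y - x| by rewrite -!expr2 real_normK ?num_real.
rewrite mulrA normr_id ler_wpM2r// (le_trans (L x z))// ler_wpM2l//.
Qed.

(** A quadratic remainder suffices for differentiability. This covers functions given by
cases, to which the rules of differentiation do not apply at the break points. *)
Lemma is_derive_of_taylor F x d K : (forall y, `|F y - F x - d * (y - x)| <= K * (y - x) ^+ 2) ->
  is_derive x (1 : R) F d.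
Proof.
move=> h.
suff H : h^-1 *: (F (h *: (1 : R) + x) - F x) @[h --> 0^'] --> d.
  apply: DeriveDef; first by apply/cvg_ex; exists d.
  exact: cvg_lim H.
have K0 : 0 <= K
  by have := h (x + 1); rewrite (_ : x + 1 - x = 1) ?expr1n ?mulr1; [exact: le_trans|ring].
apply/cvgrPdist_le => e e0; near=> r.
have r0 : r != 0 by near: r; exact: nbhs_dnbhs_neq.
have -> : d - r^-1 *: (F (r *: (1 : R) + x) - F x) = - (r^-1 * (F (r + x) - F x - d * (r + x - x))).
  by rewrite /GRing.scale /= mulr1 addrK; field.
rewrite normrN normrM normfV mulrC ler_pdivrMr ?normr_gt0//.
rewrite (le_trans (h _))// addrK -real_normK ?num_real// expr2 mulrA ler_wpM2r//.
have : `|r| <= e / (K + 1) by near: r; apply: dnbhs0_le; rewrite divr_gt0// ltr_pwDr.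
rewrite ler_pdivlMr ?ltr_pwDr// => H; have := normr_ge0 r; nra.
Unshelve. all: by end_near. Qed.

Lemma is_derive_bigsum (J : Type) (r : seq J) (p : pred J) (f df : J -> R -> R) (x : R) :
  (forall j, is_derive x 1 (f j) (df j x)) ->
  is_derive x 1 (fun s => \sum_(j <- r | p j) f j s) (\sum_(j <- r | p j) df j x).
Proof.
move=> dfj; elim: r => [|j r IH].
  rewrite big_nil (_ : (fun _ => _) = cst 0); first exact: is_derive_cst.
  by apply/funext => s; rewrite big_nil.
rewrite big_cons; case pj : (p j).
  rewrite (_ : (fun _ => _) = f j + (fun s => \sum_(j <- r | p j) f j s)); last first.
    by apply/funext => s; rewrite big_cons pj.
  exact: is_deriveD.
rewrite (_ : (fun _ => _) = (fun s => \sum_(j <- r | p j) f j s))//.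
by apply/funext => s; rewrite big_cons pj.
Qed.

Lemma is_derive_cmul (c u a : R) (f : R -> R) : is_derive u (1 : R) f a ->
  is_derive u (1 : R) (fun v => c * f v) (c * a).
Proof.
move=> fa; rewrite (_ : (fun v => _) = (cst c : R -> R) * f)//.
have := @is_deriveM R R (cst c) f u 1 0 a (is_derive_cst _ _ _) fa.
by rewrite /GRing.scale /= mulr0 addr0.
Qed.

Lemma is_derive_quot (f g : R -> R) (s a b : R) :
  is_derive s (1 : R) f a -> is_derive s (1 : R) g b -> g s != 0 ->
  is_derive s (1 : R) (fun u => f u / g u) ((a * g s - f s * b) / g s ^+ 2).
Proof.
move=> fa gb g0; have := @is_deriveM R R f (fun y => (g y)^-1) s 1 a _ fa (is_deriveV g0 gb).
rewrite (_ : (fun u => f u / g u) = f * (fun y => (g y)^-1))// /GRing.scale /= => H.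
by apply: (is_derive_eq H); field.
Qed.

Lemma is_derive_cexp (c k u : R) : is_derive u (1 : R) (fun u => c * expR (k * u)) (c * (k * expR (k * u))).
Proof.
apply: is_derive_cmul; rewrite mulrC -[X in _ * X]mulr1.
exact: (is_derive1_comp (is_derive_expR (k * u)) (is_derive_cmul k (is_derive_id u 1))).
Qed.

Definition sqr_pos (u : R) := Num.max 0 u ^+ 2.

Lemma is_derive_sqr_pos x : is_derive x (1 : R) sqr_pos (2 * Num.max 0 x).
Proof.
apply: (@is_derive_of_taylor _ _ _ 1) => y; rewrite /sqr_pos mul1r ler_norml.
have h1 := sqr_ge0 (y - x); have h2 := sqr_ge0 x; have h3 := sqr_ge0 y.
rewrite /Num.max; case: ltP => y0; case: ltP => x0; apply/andP; split; rewrite ?expr0n /= ?mulr0 ?mul0r.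
all: try (by move: h1 h2 h3; rewrite !expr2; nra).
Qed.

(** A piecewise quadratic function descending from 1 on the left of 0 to 0 on the right
of 1, with a Lipschitz derivative, obtained by adding truncated parabolas. *)
Definition smoothstep (u : R) := 1 - 2 * sqr_pos u + 4 * sqr_pos (u - 2^-1) - 2 * sqr_pos (u - 1).
Definition smoothstep' (u : R) := - (4 * Num.max 0 u) + 8 * Num.max 0 (u - 2^-1) - 4 * Num.max 0 (u - 1).

Lemma smoothstep_le0 u : u <= 0 -> smoothstep u = 1.
Proof. by rewrite /smoothstep /sqr_pos /Num.max => u0; do 3 case: ltP => ?; nra. Qed.

Lemma smoothstep_ge1 u : 1 <= u -> smoothstep u = 0.
Proof. by rewrite /smoothstep /sqr_pos /Num.max => u0; do 3 case: ltP => ?; nra. Qed.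

Lemma smoothstep01 u : 0 <= smoothstep u <= 1.
Proof. by rewrite /smoothstep /sqr_pos /Num.max; do 3 case: ltP => ?; apply/andP; split; nra. Qed.

Lemma smoothstep'_bound u : `|smoothstep' u| <= 2.
Proof. by rewrite /smoothstep' /Num.max ler_norml; do 3 case: ltP => ?; apply/andP; split; lra. Qed.

Lemma is_derive_comp_affine F d (k b x : R) : is_derive (k * x + b) (1 : R) F d ->
  is_derive x (1 : R) (fun y => F (k * y + b)) (k * d).
Proof.
move=> dF.
have aff : is_derive x (1 : R) (fun y : R => k * y + b) k.
  apply: (@is_derive_of_taylor _ _ _ 0) => y.
  by rewrite mul0r (_ : _ - _ = 0) ?normr0//; ring.
have := @is_derive1_comp R F (fun y => k * y + b) x d k dF aff; rewrite mulrC; apply.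
Qed.
End Calculus.

(** * Derivative of the mean size under a uniform tilt *)

Section GibbsDerivative.
Variables (R : realType) (G : sgraph) (lam : edge G -> R).
Hypothesis lam_gt0 : forall e, 0 < lam e.

(** The activities after adding [s] to every edge weight. *)
Definition tilted (s : R) (e : edge G) : R := lam e * expR s.

Lemma tilted_gt0 s e : 0 < tilted s e.
Proof. by rewrite mulr_gt0// expR_gt0. Qed.

Lemma activity_tilted s M : activity (tilted s) M = activity lam M * expR (#|M|%:R * s).
Proof.
rewrite /activity /tilted big_split/=; congr (_ * _).
by rewrite prodr_const -expRM_natl.
Qed.

Definition gibbs_size (s : R) : R := gibbs_mean (tilted s) (fun M => #|M|%:R).

Definition gibbs_size_variance (s : R) : R :=
  gibbs_mean (tilted s) (fun M => #|M|%:R ^+ 2) - gibbs_size s ^+ 2.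

(** The mean size is the derivative of the logarithm of the matching sum, a moment
generating function of the number of edges; its own derivative is the variance. *)
Lemma is_derive_gibbs_size (s : R) : is_derive s (1 : R) gibbs_size (gibbs_size_variance s).
Proof.
pose m k (u : R) : R := \sum_(M in matchings G) (#|M|%:R ^+ k * activity lam M) * expR (#|M|%:R * u).
have dm k (u : R) : is_derive u (1 : R) (m k) (m k.+1 u).
  apply: is_derive_eq.
    apply: (@is_derive_bigsum R _ (index_enum _) (fun M => M \in matchings G)
      (fun M u => #|M|%:R ^+ k * activity lam M * expR (#|M|%:R * u))
      (fun M u => #|M|%:R ^+ k * activity lam M * (#|M|%:R * expR (#|M|%:R * u))) u).
    by move=> M; exact: is_derive_cexp.
  by apply: eq_bigr => M _; rewrite exprS; ring.
have mE k u : gibbs_mean (tilted u) (fun M => #|M|%:R ^+ k) = m k u / m 0%N u.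
  rewrite /gibbs_mean matching_sumT /m; congr (_ / _); apply: eq_bigr => M _.
    by rewrite activity_tilted mulrA.
  by rewrite activity_tilted expr0 mul1r.
have m0 u : m 0%N u != 0.
  rewrite /m (_ : \sum_(M in _) _ = matching_sum (tilted u) [set: G]%SET).
    by rewrite gt_eqF// matching_sum_gt0// => e; exact: tilted_gt0.
  rewrite matching_sumT; apply: eq_bigr => M _.
  by rewrite activity_tilted expr0 mul1r.
have gE : gibbs_size = fun u => m 1%N u * (m 0%N u)^-1.
  by apply/funext => u; rewrite -mE /gibbs_size; apply: eq_gibbs_mean => M _; rewrite expr1.
rewrite gE; have H := is_derive_quot (dm 1%N s) (dm 0%N s) (m0 s).
apply: (is_derive_eq H).
rewrite /gibbs_size_variance mE gE.
have := m0 s; move: (m 0%N s) (m 1%N s) (m 2%N s) => a b c a0; by field.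
Qed.

Lemma gibbs_size_increase (eps kappa : R) : 0 <= eps ->
  (forall s, 0 <= s <= eps -> kappa <= gibbs_size_variance s) ->
  eps * kappa <= gibbs_size eps - gibbs_size 0.
Proof.
move=> e0 hk.
have [c /andP[c0 ce] ->] := mean_value is_derive_gibbs_size e0.
by rewrite subr0 mulrC ler_wpM2r// hk// c0 ce.
Qed.

End GibbsDerivative.

(** * The variance of the mean size is of order of the number of edges *)

Section SizeFunctional.
Variables (R : realType) (G : sgraph).
Let I : finType := (edge G + G)%type.
Implicit Types (e : edge G) (x : edge G + G -> R).

Definition size_functional x : R := gibbs_mean (config_activity x) (fun M => #|M|%:R).

Lemma size_functionalE x :
  size_functional x = 2^-1 * \sum_(v : G) (1 - config_free [set: G]%SET v x).
Proof. by apply: gibbs_mean_card => e; exact: config_activity_gt0. Qed.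

Lemma bounded_functional_size : bounded_functional size_functional.
Proof.
rewrite (_ : size_functional = fun x => 2^-1 * \sum_(v : G) (1 + -1 * config_free [set: G]%SET v x)).
  apply: bounded_functionalM; first exact: bounded_functional_cst.
  apply: bounded_functional_sum => v.
  apply: bounded_functionalD; first exact: bounded_functional_cst.
  apply: bounded_functionalM; first exact: bounded_functional_cst.
  exact: bounded_functional_free.
apply/funext => x; rewrite size_functionalE; congr (_ * _); apply: eq_bigr => v _.
by rewrite mulN1r.
Qed.

Definition edge_coord : {set I} := [set i : edge G + G | if i is inl _ then true else false]%SET.

Lemma card_edge_coord : #|edge_coord| = #|edge G|.
Proof.
rewrite card_sumset (_ : [set e | _]%SET = [set: edge G]%SET); last by apply/setP => e; rewrite !inE.
rewrite (_ : [set v | _]%SET = finset.set0); last by apply/setP => v; rewrite !inE.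
by rewrite cards0 addn0 cardsT.
Qed.

Lemma config_activity_shift eps x :
  config_activity (shift_coords eps (mem (enum edge_coord)) x) = tilted (config_activity x) eps.
Proof.
apply/funext => e; rewrite /config_activity /edge_activity /tilted -expRD /shift_coords /=.
rewrite !mem_enum !inE; congr expR; rewrite addrAC; congr (_ + _).
by congr (_ - _); apply: eq_bigr => v _; rewrite mem_enum inE addr0.
Qed.

Lemma tilted0 (l : edge G -> R) : tilted l 0 = l.
Proof. by apply/funext => e; rewrite /tilted expR0 mulr1. Qed.

Section lower_bound.
Variables (D : nat) (a : R).
Hypothesis degree_le : forall v : G, (degree v <= D)%N.

Definition activity_bound : R := D%:R * expR (3 * a + 1).
(** A lower bound for the contribution of an edge to [gibbs_variance_ge] when all
weights near it are at most [a] in absolute value and the tilt is at most 1, which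
accounts for the summand 1 in the exponents. *)
Definition edge_variance : R :=
  expR (- (3 * a)) / (1 + activity_bound) ^+ 2 / (1 + expR (3 * a + 1)).

Let edge_coords e : {set I} := (\bigcup_(v in val e) nearby v)%SET.

Lemma activity_bound_ge0 : 0 <= activity_bound.
Proof. by rewrite mulr_ge0// expR_ge0. Qed.

Lemma edge_variance_gt0 : 0 < edge_variance.
Proof.
have := activity_bound_ge0; have := expR_gt0 (3 * a + 1); have := expR_gt0 (- (3 * a)) => *.
by rewrite /edge_variance !divr_gt0// ?exprn_gt0// ltr_pwDl// ltW.
Qed.

(** The probability of an edge is its activity times two successive free probabilities,
each bounded below in terms of the local activity. *)
Lemma edge_variance_le e x s : 0 <= s <= 1 ->
  (forall i, i \in edge_coords e -> `|x i| <= a) ->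
  edge_variance <= edge_prob (tilted (config_activity x) s) e / (1 + tilted (config_activity x) s e).
Proof.
move=> /andP[s0 s1] good; set l := tilted (config_activity x) s.
have l0 f : 0 < l f by apply: tilted_gt0 => ?; exact: config_activity_gt0.
have nb v : v \in val e -> forall i, i \in nearby v -> `|x i| <= a.
  by move=> ve i iv; apply: good; apply/finset.bigcupP; exists v.
have [y [z [E yz _]]] := edge_pair e.
have ye : y \in val e by rewrite E !inE eqxx.
have /andP[lo hi] : expR (- (3 * a)) <= config_activity x e <= expR (3 * a).
  apply: config_activity_bounds => [v ve|]; first by apply: (nb v ve); rewrite inE eqxx.
  by apply: (nb y ye); rewrite inE.
have es1 : 1 <= expR s by rewrite -expR0 ler_expR.
have es2 : expR s <= expR 1 by rewrite ler_expR.
have llo : expR (- (3 * a)) <= l e.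
  by rewrite /l /tilted (le_trans lo)// ler_peMr// ltW// config_activity_gt0.
have lhi : l e <= expR (3 * a + 1).
  by rewrite /l /tilted expRD ler_pM ?expR_ge0// ltW// config_activity_gt0.
have la v : v \in val e -> local_activity l v <= activity_bound.
  move=> ve; have := local_activity_good (degree_le v) (nb v ve).
  rewrite /local_activity /l /tilted -mulr_suml /activity_bound expRD mulrA => h.
  by rewrite ler_pM ?expR_ge0// sumr_ge0// => f _; exact/ltW/config_activity_gt0.
have fp S v : v \in val e -> (1 + activity_bound)^-1 <= free_prob l S v.
  move=> ve; apply: le_trans (free_prob_ge l0 S v).
  have ? := activity_bound_ge0; have ? := local_activity_ge0 l0 v.
  by rewrite lef_pV2 ?posrE ?ltr_pwDl// lerD2l la.
rewrite /edge_prob (edge_prob_free l0 ye) /edge_variance.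
have B0 := activity_bound_ge0.
have i0 : 0 <= (1 + activity_bound)^-1 by rewrite invr_ge0; lra.
apply: ler_pM.
- by rewrite divr_ge0 ?expR_ge0// exprn_ge0//; lra.
- by rewrite invr_ge0 addr_ge0// expR_ge0.
- rewrite expr2 invfM mulrA; apply: ler_pM => //; [by rewrite mulr_ge0 ?expR_ge0| |].
    by apply: ler_pM => //; rewrite ?expR_ge0// fp.
  by apply: fp; exact: other_in.
- by rewrite lef_pV2 ?posrE ?addr_gt0 ?expR_gt0// lerD2l.
Qed.

(** If some nearby weight is large, the left side is nonpositive. In this linear form
the bound can be averaged over the weights. *)
Lemma edge_term_ge e x s : 0 <= s <= 1 ->
  edge_variance * (1 - \sum_(i in edge_coords e) \1_[set y | a < `|y|] (x i)) <=
  edge_prob (tilted (config_activity x) s) e / (1 + tilted (config_activity x) s e).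
Proof.
move=> s01; have l0 f : 0 < tilted (config_activity x) s f by apply: tilted_gt0 => ?; exact: config_activity_gt0.
have ev := edge_variance_gt0.
have [good|] := pselect (forall i, i \in edge_coords e -> `|x i| <= a).
  rewrite (le_trans _ (edge_variance_le s01 good))// ler_piMr ?(ltW ev)// gerBl sumr_ge0//.
move=> /existsNP[i /not_implyP[iE]] /negP; rewrite -ltNge => bi.
have : edge_variance * (1 - \sum_(i in edge_coords e) \1_[set y | a < `|y|] (x i)) <= 0.
  rewrite mulr_ge0_le0 ?(ltW ev)// subr_le0 (bigD1 i)//= indicE mem_set// lerDl sumr_ge0//.
move/le_trans; apply; rewrite divr_ge0 ?edge_prob_ge0// addr_ge0// ltW//.
Qed.

Lemma size_shift_ge (E : {set edge G}) eps x : E \in matchings G -> 0 <= eps <= 1 ->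
  eps * edge_variance * \sum_(e in E) (1 - \sum_(i in edge_coords e) \1_[set y | a < `|y|] (x i)) <=
  size_functional (shift_coords eps (mem (enum edge_coord)) x) - size_functional x.
Proof.
move=> Em /andP[e0 e1]; rewrite /size_functional config_activity_shift.
have l0 f : 0 < config_activity x f by exact: config_activity_gt0.
rewrite -[X in _ - gibbs_mean X _]tilted0 -mulrA.
apply: (gibbs_size_increase l0 e0) => s /andP[s0 se].
have ls f : 0 < tilted (config_activity x) s f by exact: tilted_gt0.
apply: le_trans (gibbs_variance_ge ls Em); rewrite mulr_sumr; apply: ler_sum => e _.
by apply: edge_term_ge; rewrite s0 (le_trans se).
Qed.

End lower_bound.

Section variance.
Context d (T : measurableType d) (P : probability T R) (X : I -> {RV P >-> R}).
Hypothesis indep : mutually_independent P X.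
Hypothesis gaussian : forall e (A : set R), measurable A ->
  distribution P (X (inl e)) A = normal_prob 0 1 A.
Variables (D : nat) (a q : R).
Hypothesis degree_le : forall v : G, (degree v <= D)%N.
Hypothesis badq : forall i, (P (X i @^-1` [set y | (a < `|y|)%R]) <= q%:E)%E.
Hypothesis q_small : (4 * D + 4)%:R * q <= 2^-1.

Let edge_coords e : {set I} := (\bigcup_(v in val e) nearby v)%SET.

(** The shift by [#|E| ^ (-1/2)] has chi-square distance [expR 1 - 1] whatever the graph
is, and it raises the mean by order [#|E| ^ (1/2)]. *)
Lemma size_variance_ge : (0 < #|edge G|)%N ->
  (edge_variance D a / (4 * D.+1%:R)) ^+ 2 / (expR 1 - 1) * #|edge G|%:R <=
  var P (fun t => size_functional (X^~ t)).
Proof.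
move=> n0; rewrite /var; set m := mean P (fun t => size_functional (X^~ t)).
have [E Em hE] := large_matching degree_le.
set n : R := #|edge G|%:R.
have n1 : 1 <= n by rewrite ler1n.
pose eps : R := (Num.sqrt n)^-1.
have sn : 0 < Num.sqrt n by rewrite sqrtr_gt0; lra.
have eps0 : 0 < eps by rewrite invr_gt0.
have eps1 : eps <= 1 by rewrite invf_le1// -sqrtr1 ler_sqrt//; lra.
have epsn : n * eps ^+ 2 = 1.
  by rewrite /eps exprVn sqr_sqrtr ?mulfV ?gt_eqF//; lra.
have bF := bounded_functional_size.
have law i : i \in enum edge_coord -> forall A : set R, measurable A ->
     distribution P (X i) A = normal_prob 0 1 A.
  by rewrite mem_enum inE; case: i => // e _ A; exact: gaussian.
have := @variance_shift_bound R _ T P I X eps indep (enum edge_coord) size_functional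
  (enum_uniq _) law bF.
rewrite /= -/m -cardE card_edge_coord epsn.
set gap := _ - m; set V := mean P _; move=> HV.
(* The lower bound on the gap, half of the edges of E being good on average. *)
pose Delta := eps * edge_variance D a * (#|E|%:R / 2).
have ev := edge_variance_gt0 D a.
have D0 : 0 <= Delta by apply: mulr_ge0; [apply: mulr_ge0; exact: ltW|rewrite divr_ge0].
have gD : Delta <= gap.
  have bs : bounded_functional (fun x => size_functional (shift_coords eps (mem (enum edge_coord)) x)).
    have [mF [C FC]] := bF; split; last by exists C => x; exact: FC.
    exact: measurable_functional_shift.
  have bad_m := measurable_norm_gt a.
  pose g e x : R := 1 + -1 * \sum_(i in edge_coords e) \1_[set y | a < `|y|] (x i).
  have bg e : bounded_functional (g e).
    apply: bounded_functionalD; first exact: bounded_functional_cst.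
    apply: bounded_functionalM; first exact: bounded_functional_cst.
    by apply: bounded_functional_sum => i; exact: bounded_functional_indic.
  have bsX := bounded_functional_measurable X bs.
  have bFX := bounded_functional_measurable X bF.
  have bgX e := bounded_functional_measurable X (bg e).
  rewrite /gap /m -meanB//.
  apply: (@le_trans _ _ (mean P (fun t => eps * edge_variance D a * \sum_(e in E) g e (X^~ t)))); last first.
    apply: le_mean; first by apply: bounded_measurableZ; exact: bounded_measurable_sum.
      exact: bounded_measurableB.
    move=> t; rewrite (le_trans _ (@size_shift_ge D a degree_le E eps (X^~ t) Em _))//; last first.
      by rewrite (ltW eps0).
    by under eq_bigr do rewrite /g mulN1r.
  rewrite meanZ; last exact: bounded_measurable_sum.
  apply: ler_wpM2l; first by apply: mulr_ge0; exact: ltW.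
  rewrite mean_sum//.
  rewrite mulrC mulr_natr -sumr_const; apply: ler_sum => e _.
  have bi i : @bounded_measurable R _ _ (fun t => \1_[set y | a < `|y|] (X i t)).
    exact (bounded_functional_measurable X (bounded_functional_indic i bad_m)).
  rewrite /g meanD; [|exact: bounded_measurable_cst|by apply: bounded_measurableZ; exact: bounded_measurable_sum].
  rewrite mean_cst meanZ; last exact: bounded_measurable_sum.
  rewrite mean_sum//.
  suff : \sum_(i in edge_coords e) mean P (fun t => \1_[set y | a < `|y|] (X i t)) <= 2^-1 by lra.
  apply: (@le_trans _ _ (\sum_(i in edge_coords e) q)).
    apply: ler_sum => i _; rewrite mean_indic// -lee_fin fineK//.
    by rewrite fin_num_measure// -[_ @^-1` _]setTI; exact: measurable_funP.
  rewrite sumr_const -[_ *+ _]mulr_natl (le_trans _ q_small)// ler_wpM2r//.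
    have := badq (inl e); apply: contraTT; rewrite -!ltNge => q0.
    by rewrite (lt_le_trans _ (measure_ge0 _ _))// lte_fin.
  rewrite ler_nat /edge_coords.
  apply: (@leq_trans (\sum_(v in val e) (2 * D + 2))%N); last first.
    by rewrite sum_nat_const card_edge_val; lia.
  elim/big_rec2 : _ => [|v k B _ kB]; first by rewrite cards0.
  by rewrite (leq_trans (leq_card_setU _ _).1)// leq_add// card_nearby.
set v := expR 1 - 1 in HV *.
have v0 : 0 < v by rewrite subr_gt0 -[ltLHS]expR0 ltr_expR.
apply: (@le_trans _ _ (Delta ^+ 2 / v)); last first.
  (* The optimal coefficient for the quadratic bound. *)
  have := HV (Delta / v); apply: le_trans.
  have -> : (Delta / v) ^+ 2 * v = Delta ^+ 2 / v by field; rewrite gt_eqF.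
  have : 2 * (Delta / v) * Delta <= 2 * (Delta / v) * gap.
    by rewrite ler_wpM2l// mulr_ge0// divr_ge0// ltW.
  have -> : 2 * (Delta / v) * Delta = 2 * (Delta ^+ 2 / v) by field; rewrite gt_eqF.
  lra.
rewrite mulrAC ler_wpM2r ?invr_ge0 ?(ltW v0)//.
have nE : n / (2 * D.+1%:R) <= #|E|%:R.
  rewrite ler_pdivrMr ?mulr_gt0// mulrC.
  rewrite /n -[2]/(2%:R) -!natrM ler_nat (leq_trans hE)// leq_mul2r leq_mul2l leqnSn !orbT//.
have -> : (edge_variance D a / (4 * D.+1%:R)) ^+ 2 * n =
   (eps * edge_variance D a * ((n / (2 * D.+1%:R)) / 2)) ^+ 2.
  have : n = n ^+ 2 * eps ^+ 2 by rewrite expr2 -mulrA epsn mulr1.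
  have : D.+1%:R != 0 :> R by rewrite pnatr_eq0.
  move: (D.+1%:R : R) => k k0 {1}->; by field.
apply: lerXn2r; rewrite ?nnegrE//.
  by apply: mulr_ge0; [apply: mulr_ge0; exact: ltW|rewrite !divr_ge0 ?mulr_ge0//; lra].
rewrite /Delta; apply: ler_wpM2l; first by apply: mulr_ge0; exact: ltW.
by rewrite ler_pM2r// invr_gt0.
Qed.

End variance.
End SizeFunctional.

(** * Gaussian density and tails *)

Section Stein.
Variable R : realType.
Notation mu := (@lebesgue_measure R).
Notation phi := (@normal_pdf R 0 1).

Lemma normal_density x : phi x = normal_peak 1 * expR (- (x ^+ 2 / 2)).
Proof.
rewrite normal_pdfE ?oner_eq0// /normal_fun subr0 expr1n; congr (_ * expR _); by field.
Qed.

Lemma normal_density_gt0 x : 0 < phi x.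
Proof. by rewrite normal_density mulr_gt0 ?expR_gt0// normal_peak_gt0 ?oner_eq0. Qed.

Lemma normal_density_le x : phi x <= normal_peak 1.
Proof. by apply: normal_pdf_ub; rewrite oner_eq0. Qed.

Lemma is_derive_normal_density x : is_derive x (1 : R) phi (- x * phi x).
Proof.
have h : is_derive x (1 : R) (fun y : R => - (y ^+ 2 / 2)) (- x).
  apply: (@is_derive_of_taylor _ _ _ _ (2^-1)) => y.
  rewrite (_ : _ - _ - _ = - (2^-1 * (y - x) ^+ 2)); last by field.
  by rewrite normrN ger0_norm// mulr_ge0// ?invr_ge0// sqr_ge0.
have e := @is_derive1_comp R expR (fun y : R => - (y ^+ 2 / 2)) x _ _ (is_derive_expR _) h.
have H := @is_deriveM R R (cst (normal_peak 1)) _ x 1 0 _ (is_derive_cst _ _ _) e.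
rewrite [X in is_derive _ _ X _](_ : _ = cst (normal_peak 1) * (expR \o (fun y : R => - (y ^+ 2 / 2)))); last first.
  by apply/funext => y; rewrite normal_density.
by apply: (is_derive_eq H); rewrite normal_density /GRing.scale /=; ring.
Qed.

Lemma integrable_phi (A : set (measurableTypeR R)) : measurable A -> mu.-integrable A (EFin \o phi).
Proof.
by move=> mA; apply: integrableS (subsetT A) _ => //; exact: integrable_normal_pdf.
Qed.

Section primitive.
Variable g : R -> R.
Hypothesis cg : continuous g.
Hypothesis g01 : forall x, 0 <= g x <= 1.

Definition gaussian_primitive x := \int[mu]_(y in `]-oo, x]) (g y * phi y).

Lemma integrable_gphi (A : set (measurableTypeR R)) : measurable A ->
  mu.-integrable A (EFin \o (fun y => g y * phi y)).
Proof.
move=> mA; have mg : measurable_fun setT g by exact: continuous_measurable_fun.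
apply: (le_integrable mA _ _ (integrable_phi mA)).
  apply/measurable_EFinP; apply: measurable_funS (subsetT A) _ => //.
  by apply: measurable_funM => //; exact: measurable_normal_pdf.
move=> y _ /=; rewrite lee_fin normrM ler_piMl//.
by have /andP[g0 g1] := g01 y; rewrite ger0_norm.
Qed.

Lemma is_derive_primitive x : is_derive x (1 : R) gaussian_primitive (g x * phi x).
Proof.
have [] := @continuous_FTC1 R (fun y => g y * phi y) -oo%O x (x + 1).
- by rewrite ltrDl.
- exact: integrable_gphi.
- by rewrite ltNyr.
- by apply: cvgM; [exact: cg|apply: continuous_normal_pdf; rewrite oner_eq0].
by move=> dF FE; apply: DeriveDef => //; rewrite -FE derive1E.
Qed.

End primitive.

Definition Phi x : R := fine (normal_prob 0 1 `]-oo, x]).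

Lemma PhiE x : Phi x = gaussian_primitive (fun=> 1) x.
Proof. by rewrite /gaussian_primitive; under eq_Rintegral do rewrite mul1r. Qed.

Lemma is_derive_Phi x : is_derive x (1 : R) Phi (phi x).
Proof.
rewrite (_ : Phi = gaussian_primitive (fun=> 1)); last exact/funext/PhiE.
have := @is_derive_primitive (fun=> 1) _ _ x.
by rewrite mul1r; apply => [y|y]; [exact: cvg_cst|rewrite ler01 lexx].
Qed.

Lemma Phi_cvg : Phi x @[x --> +oo] --> (1 : R) /\ Phi x @[x --> -oo] --> (0 : R).
Proof.
have mid : measurable_fun setT (idfun : measurableTypeR R -> R).
  by move=> mT A mA; rewrite setTI.
pose X : {RV (normal_prob 0 1 : probability (measurableTypeR R) R) >-> R} :=
  HB.pack (idfun : measurableTypeR R -> R) (isMeasurableFun.Build _ _ _ _ _ mid).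
have E x : Phi x = fine (cdf X x) by [].
by split; under eq_fun do rewrite E; apply: fine_cvg; [exact: cvg_cdfy1|exact: cvg_cdfNy0].
Qed.

Section mills.
Variable S : R -> R.
Hypothesis dS : forall x, is_derive x (1 : R) S (- phi x).
Hypothesis S0 : S x @[x --> +oo] --> (0 : R).

Let small e x : 0 < e -> exists y, [/\ x <= y, 1 <= y, e^-1 <= y & `|S y| <= e].
Proof.
move=> e0.
have : \forall y \near +oo, `|S y| <= e.
  have /cvgrPdist_le/(_ e e0) := S0; apply: filterS => y; by rewrite sub0r normrN.
move=> H; have : \forall y \near +oo, [/\ x <= y, 1 <= y, e^-1 <= y & `|S y| <= e].
  near=> y; split; near: y; [apply: nbhs_pinfty_ge; exact: num_real|apply: nbhs_pinfty_ge; exact: num_real|apply: nbhs_pinfty_ge; exact: num_real|exact: H].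
by move/filter_ex.
Unshelve. all: by end_near. Qed.

(** The difference of the two sides is decreasing and tends to 0 at infinity, so it is
nonnegative. *)
Lemma mills_upper x : 1 <= x -> S x <= phi x / x.
Proof.
move=> x1.
have dA (y : R) : 1 <= y -> is_derive y (1 : R) (fun y => phi y / y - S y) (- (phi y / y ^+ 2)).
  move=> y1; have y0 : y != 0 by lra.
  have H := @is_deriveM R R phi (fun y => y^-1) y 1 _ _ (is_derive_normal_density y)
    (@is_deriveV R id y 1 1 y0 (is_derive_id _ _)).
  have H2 := is_deriveB H (dS y).
  apply: (is_derive_eq H2); rewrite /GRing.scale /=; field.
  by [].
rewrite -subr_ge0 leNgt; apply/negP => neg.
set A := phi x / x - S x in neg.
(* A negative value at x would persist to the right, where the tail is small. *)
have [|y [xy y1 _ Sy]] := @small (- A / 2) x; first by lra.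
have dAz (z : R) : x <= z <= y ->
    is_derive z (1 : R) (fun y => phi y / y - S y) (- (phi z / z ^+ 2)).
  by move=> /andP[xz zy]; apply: dA; lra.
have [z /andP[xz zy] E] := mean_value_on dAz xy.
have : phi y / y - S y <= A.
  rewrite -subr_le0 E mulr_le0_ge0 ?subr_ge0// oppr_le0 divr_ge0 ?sqr_ge0//.
  exact/ltW/normal_density_gt0.
have : 0 <= phi y / y by rewrite divr_ge0 ?(ltW (normal_density_gt0 y))//; lra.
move: Sy; rewrite ler_norml; lra.
Qed.

(** Again the difference of the two sides is decreasing and tends to 0. *)
Lemma mills_lower x : 1 <= x -> x * phi x / (1 + x ^+ 2) <= S x.
Proof.
move=> x1.
have p2 (y : R) : 1 + y ^+ 2 != 0 :> R by rewrite gt_eqF// ltr_pwDl// sqr_ge0.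
have dA (y : R) : is_derive y (1 : R) (fun y => S y - y * phi y / (1 + y ^+ 2)) (- (2 * phi y / (1 + y ^+ 2) ^+ 2)).
  have q : is_derive y (1 : R) (fun y : R => 1 + y ^+ 2) (2 * y).
    apply: (@is_derive_of_taylor _ _ _ _ 1) => z.
    by rewrite (_ : _ - _ - _ = (z - y) ^+ 2) ?mul1r ?ger0_norm ?sqr_ge0//; ring.
  have H := @is_deriveM R R id phi y 1 _ _ (is_derive_id _ _) (is_derive_normal_density y).
  have H1 := @is_deriveM R R _ (fun y => (1 + y ^+ 2)^-1) y 1 _ _ H
    (@is_deriveV R (fun y : R => 1 + y ^+ 2) y _ 1 (p2 y) q).
  have H2 := is_deriveB (dS y) H1.
  apply: (is_derive_eq H2); rewrite /GRing.scale /= -[(_ * _) y]/(y * phi y); have := p2 y; move: (phi y) => u h; by field.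
rewrite -subr_ge0 leNgt; apply/negP => neg.
set A := S x - x * phi x / (1 + x ^+ 2) in neg.
(* The correction term is at most K / y, and y is taken beyond the inverse of the tolerance. *)
pose K := 1 + normal_peak (1 : R).
have K1 : 1 <= K by rewrite lerDl normal_peak_ge0.
have [|y [xy y1 ey Sy]] := @small (- A / (3 * K)) x.
  by rewrite divr_gt0 ?oppr_gt0//; lra.
have [z /andP[xz zy] E] := mean_value dA xy.
have h1 : S y - y * phi y / (1 + y ^+ 2) <= A.
  rewrite -subr_le0 E mulr_le0_ge0 ?subr_ge0// oppr_le0 divr_ge0 ?sqr_ge0// mulr_ge0//.
  exact/ltW/normal_density_gt0.
set e := - A / (3 * K) in ey Sy.
have e0 : 0 < e by rewrite divr_gt0 ?oppr_gt0//; lra.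
have h2 : y * phi y / (1 + y ^+ 2) <= K * e.
  have y0 : 0 < y by lra.
  rewrite ler_pdivrMr ?ltr_pwDl ?sqr_ge0//.
  have ye : 1 <= e * y by move: ey; rewrite -[e^-1]mul1r ler_pdivrMr// mulrC.
  have pK : phi y <= K by rewrite (le_trans (normal_density_le y))// lerDr.
  have p0 := normal_density_gt0 y.
  have : y * phi y <= y * K by rewrite ler_wpM2l// ltW.
  have : y * K * 1 <= y * K * (e * y) by rewrite ler_wpM2l// mulr_ge0//; lra.
  have : 0 <= K * e by rewrite mulr_ge0//; lra.
  nra.
have h3 : 3 * (K * e) = - A by rewrite /e; field; lra.
have h4 : e <= K * e by rewrite ler_peMl// ltW.
move: Sy; rewrite ler_norml; lra.
Qed.

(** What the Stein equation needs from the ratio [M] of tail to density: on the tail its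
solution is a multiple of [M], the derivative a multiple of [x * M - 1], and the second
derivative involves [x * (x * M - 1)]. *)
Lemma mills_bounds x : 1 <= x ->
  [/\ 0 <= S x / phi x <= 1, `|x * (S x / phi x) - 1| <= 1 & x * `|x * (S x / phi x) - 1| <= 1].
Proof.
move=> x1; have p0 := normal_density_gt0 x; have x0 : 0 < x by lra.
have lo := mills_lower x1; have hi := mills_upper x1.
set M := S x / phi x.
have SM : S x = M * phi x by rewrite /M divfK// gt_eqF.
have hM : x * M <= 1.
  move: hi; rewrite SM ler_pdivlMr// mulrAC -ler_pdivlMr// divff ?gt_eqF// mulrC//.
have lM : x / (1 + x ^+ 2) <= M.
  by move: lo; rewrite SM mulrAC ler_pM2r.
have x2 : 0 < 1 + x ^+ 2 by rewrite ltr_pwDl// sqr_ge0.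
have lM' : x <= M * (1 + x ^+ 2) by rewrite -ler_pdivrMr.
have M0 : 0 <= M by apply: le_trans lM; rewrite divr_ge0// ltW.
have E : `|x * M - 1| = 1 - x * M by rewrite ler0_norm ?opprB// subr_le0.
have M1 : M <= 1 by nra.
rewrite M0 M1 E; split => //; first by nra.
suff : x * (1 - x * M) <= M by lra.
nra.
Qed.

End mills.
End Stein.

(** * The Stein equation for a smooth cut-off *)

Section SteinSolution.
Variable R : realType.
Notation phi := (@normal_pdf R 0 1).
Notation Phi := (@Phi R).
Variables (t eps : R).
Hypothesis eps_gt0 : 0 < eps.

Definition ramp (x : R) := smoothstep (eps^-1 * x + - (t / eps)).
Definition ramp' (x : R) := eps^-1 * smoothstep' (eps^-1 * x + - (t / eps)).

Lemma ramp_arg x : eps^-1 * x + - (t / eps) = (x - t) / eps.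
Proof. by field; rewrite gt_eqF. Qed.

Lemma ramp01 x : 0 <= ramp x <= 1. Proof. exact: smoothstep01. Qed.

Lemma ramp_le x : x <= t -> ramp x = 1.
Proof.
move=> xt; rewrite /ramp ramp_arg; apply: smoothstep_le0.
by rewrite ler_pdivrMr// mul0r subr_le0.
Qed.

Lemma ramp_ge x : t + eps <= x -> ramp x = 0.
Proof.
move=> xt; rewrite /ramp ramp_arg; apply: smoothstep_ge1.
by rewrite ler_pdivlMr// mul1r lerBrDl.
Qed.

Lemma is_derive_ramp x : is_derive x (1 : R) ramp (ramp' x).
Proof.
apply: (@is_derive_comp_affine R (@smoothstep R)).
rewrite /smoothstep /smoothstep'; set u := _ + _.
have sp (c v : R) : is_derive v (1 : R) (fun u => sqr_pos (u - c)) (2 * Num.max 0 (v - c)).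
  have := @is_derive_comp_affine R (@sqr_pos R) (2 * Num.max 0 (v - c)) 1 (- c) v.
  rewrite !mul1r => H; have := H (is_derive_sqr_pos _).
  by congr is_derive; apply/funext => w; rewrite mul1r.
have H1 := is_derive_cmul (-2) (is_derive_sqr_pos u).
have H2 := is_derive_cmul 4 (sp (2^-1) u).
have H3 := is_derive_cmul (-2) (sp 1 u).
have H := is_deriveD (is_deriveD (is_deriveD (is_derive_cst (1 : R) u (1 : R)) H1) H2) H3.
rewrite [X in is_derive _ _ X _](_ : _ = cst 1 + (fun u => -2 * sqr_pos u) + (fun u => 4 * sqr_pos (u - 2^-1)) +
   (fun u => -2 * sqr_pos (u - 1))); last first.
  by apply/funext => w; rewrite !fctE /cst; ring.
by apply: (is_derive_eq H); ring.
Qed.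

Lemma ramp'_bound x : `|ramp' x| <= 2 / eps.
Proof.
rewrite /ramp' normrM ger0_norm ?invr_ge0 ?(ltW eps_gt0)// mulrC.
by rewrite ler_wpM2r ?invr_ge0 ?(ltW eps_gt0)// smoothstep'_bound.
Qed.

Lemma continuous_ramp : continuous ramp.
Proof. exact: is_derive_continuous is_derive_ramp. Qed.

Let H := gaussian_primitive ramp.
(** The full Gaussian mean of the ramp, as the ramp vanishes beyond [t + eps]. *)
Definition ramp_mean := H (t + eps).
Notation c := ramp_mean.

Let dH x : is_derive x (1 : R) H (ramp x * phi x).
Proof. by apply: is_derive_primitive; [exact: continuous_ramp|exact: ramp01]. Qed.

Let H_left x : x <= t -> H x = Phi x.
Proof.
move=> xt; rewrite PhiE; apply: eq_Rintegral => y; rewrite inE /= in_itv/= => yx.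
by rewrite ramp_le// (le_trans yx).
Qed.

Let H_right x : t + eps <= x -> H x = c.
Proof.
move=> xt; have [z /andP[z1 z2] E] := mean_value dH xt.
by apply/eqP; rewrite -subr_eq0 E ramp_ge// !mul0r.
Qed.

Lemma ramp_mean_ge : Phi t <= c.
Proof.
rewrite -(H_left (lexx t)) -subr_ge0.
have [|z _ ->] := mean_value dH (_ : t <= t + eps); first by rewrite lerDl ltW.
rewrite addrC addKr mulr_ge0 ?(ltW eps_gt0)// mulr_ge0 ?(ltW (normal_density_gt0 _))//.
by case/andP: (ramp01 z).
Qed.

Lemma ramp_mean_le : c <= Phi (t + eps).
Proof.
rewrite PhiE; apply: le_Rintegral => //.
- by apply: integrable_gphi => //; [exact: continuous_ramp|exact: ramp01].
- apply: integrable_gphi => //; first by move=> ?; exact: cvg_cst.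
  by move=> ?; rewrite ler01 lexx.
- move=> y _; rewrite ler_wpM2r ?(ltW (normal_density_gt0 _))//.
  by case/andP: (ramp01 y).
Qed.

Let Phi01 x : 0 <= Phi x <= 1.
Proof.
rewrite fine_ge0//= -[leRHS]/(fine 1%E) fine_le// ?fin_num_measure//.
exact: probability_le1.
Qed.

Lemma ramp_mean01 : 0 <= c <= 1.
Proof.
have := ramp_mean_le; have := ramp_mean_ge.
have /andP[? ?] := Phi01 t; have /andP[? ?] := Phi01 (t + eps).
by move=> *; apply/andP; split; lra.
Qed.

(** The solution of [f' - x * f = ramp - c] that stays bounded at both ends. *)
Definition stein_fun x := (H x - c * Phi x) / phi x.
(** The derivative of [stein_fun], read off from the Stein equation. *)
Definition stein_fun1 x := x * stein_fun x + ramp x - c.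
Definition stein_fun2 x := stein_fun x + x * stein_fun1 x + ramp' x.

Lemma is_derive_stein x : is_derive x (1 : R) stein_fun (stein_fun1 x).
Proof.
have p0 : phi x != 0 by rewrite gt_eqF// normal_density_gt0.
have cP := @is_deriveM R R (cst c) Phi x 1 0 _ (is_derive_cst _ _ _) (is_derive_Phi x).
have N := is_deriveB (dH x) cP.
have D := @is_deriveM R R _ (fun y => (phi y)^-1) x 1 _ _ N
  (@is_deriveV R phi x _ 1 p0 (is_derive_normal_density x)).
apply: (is_derive_eq D); rewrite /GRing.scale /= /stein_fun1 /stein_fun.
rewrite -[(_ - _ : R -> R) x]/(H x - c * Phi x).
move: p0; move: (phi x) (H x) (Phi x) (ramp x) (cst c x) => u h f r k p0; rewrite /cst. 
by field.
Qed.

Lemma is_derive_stein1 x : is_derive x (1 : R) stein_fun1 (stein_fun2 x).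
Proof.
have xf := @is_deriveM R R id stein_fun x 1 _ _ (is_derive_id _ _) (is_derive_stein x).
have D := is_deriveB (is_deriveD xf (is_derive_ramp x)) (is_derive_cst c x (1 : R)).
apply: (is_derive_eq D); rewrite /GRing.scale /= /stein_fun2; ring.
Qed.

(** Here the ramp is 0 and the solution is [c] times the ratio of the upper tail to the
density. *)
Lemma stein_right x : t + eps <= x -> 1 <= x ->
  [/\ `|stein_fun x| <= 1, `|stein_fun1 x| <= 1 & `|x * stein_fun1 x| <= 1].
Proof.
move=> xt x1; have /andP[c0 c1] := ramp_mean01.
have dS y : is_derive y (1 : R) (fun y => 1 - Phi y) (- phi y).
  have D := is_deriveB (is_derive_cst (1 : R) y (1 : R)) (is_derive_Phi y).
  by apply: (is_derive_eq D); rewrite sub0r.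
have S0 : 1 - Phi y @[y --> +oo] --> (0 : R).
  by rewrite -(subrr 1); apply: cvgB; [exact: cvg_cst|exact: (Phi_cvg R).1].
pose M := (1 - Phi x) / phi x.
have [/andP[M0 M1] b1 b2] : [/\ 0 <= M <= 1, `|x * M - 1| <= 1 & x * `|x * M - 1| <= 1].
  by have H0 := mills_bounds dS S0 x1; exact H0.
have fE : stein_fun x = c * M.
  by rewrite /stein_fun H_right// /M mulrA; congr (_ / _); ring.
have f1E : stein_fun1 x = c * (x * M - 1).
  by rewrite /stein_fun1 fE ramp_ge//; ring.
have x0 : 0 <= x by lra.
rewrite fE f1E; clearbody M; split.
- by rewrite ger0_norm ?mulr_ge0// mulr_ile1.
- by rewrite normrM ger0_norm// mulr_ile1.
- rewrite mulrCA normrM [`|c|]ger0_norm// mulr_ile1// normrM ger0_norm//.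
Qed.

(** The mirror image of [stein_right], with the lower tail and the factor [1 - c]. *)
Lemma stein_left x : x <= t -> x <= -1 ->
  [/\ `|stein_fun x| <= 1, `|stein_fun1 x| <= 1 & `|x * stein_fun1 x| <= 1].
Proof.
move=> xt x1; have /andP[c0 c1] := ramp_mean01.
have phiN y : phi (- y) = phi y by rewrite !normal_density sqrrN.
have dS y : is_derive y (1 : R) (fun y => Phi (- y)) (- phi y).
  have D := @is_derive_comp_affine R Phi _ (-1) 0 y (is_derive_Phi _).
  rewrite (_ : (fun y => Phi (- y)) = fun y => Phi (-1 * y + 0)); last first.
    by apply/funext => z; rewrite mulN1r addr0.
  by apply: (is_derive_eq D); rewrite mulN1r addr0 mulN1r phiN.
have S0 : Phi (- y) @[y --> +oo] --> (0 : R).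
  by have /cvgNy_compNP := (Phi_cvg R).2.
have mx1 : 1 <= - x by lra.
pose M := Phi x / phi x.
have [/andP[M0 M1] b1 b2] : [/\ 0 <= M <= 1, `|- x * M - 1| <= 1 & - x * `|- x * M - 1| <= 1].
  by have := mills_bounds dS S0 mx1; rewrite phiN opprK.
have fE : stein_fun x = (1 - c) * M.
  by rewrite /stein_fun H_left// /M mulrA; congr (_ / _); ring.
have f1E : stein_fun1 x = - ((1 - c) * (- x * M - 1)).
  by rewrite /stein_fun1 fE ramp_le//; ring.
have d0 : 0 <= 1 - c by lra.
have d1 : 1 - c <= 1 by lra.
rewrite fE f1E; clearbody M; split.
- by rewrite ger0_norm ?mulr_ge0// mulr_ile1.
- by rewrite normrN normrM ger0_norm// mulr_ile1.
- rewrite mulrN -mulNr mulrCA normrM [`|1 - c|]ger0_norm// mulr_ile1// normrM ger0_norm//; lra.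
Qed.

(** Only existence of a bound matters, as [t] and [eps] stay fixed while the graph
grows: the tail estimates cover all but a compact interval, where continuity is
enough. *)
Lemma stein_bounds : exists B, [/\ 0 <= B, forall x, `|stein_fun x| <= B,
  forall x, `|stein_fun1 x| <= B & forall x, `|stein_fun2 x| <= B].
Proof.
pose A := Num.max 1 (Num.max (t + eps) (- t)).
have [A1 At Ant] : [/\ 1 <= A, t + eps <= A & - t <= A].
  by rewrite /A !le_max !lexx !orbT.
have cf : continuous stein_fun by exact: is_derive_continuous is_derive_stein.
have cfn : {within `[- A, A], continuous (fun x => `|stein_fun x|)}.
  by apply: continuous_subspaceT => x; apply: cvg_norm; exact: cf.
have [|x0 _ xmax] := EVT_max _ cfn; first by lra.
pose K := 1 + `|stein_fun x0|.
have K1 : 1 <= K by rewrite lerDl.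
have K0 : 0 <= K by lra.
pose B1 := A * K + 2.
pose e2 := 2 / eps.
have e20 : 0 <= e2 by rewrite divr_ge0// ltW.
pose B := K + A * B1 + e2 + B1.
have /andP[c0 c1] := ramp_mean01.
have all x : [/\ `|stein_fun x| <= K, `|stein_fun1 x| <= B1 & `|x * stein_fun1 x| <= A * B1].
  have B11 : 1 <= B1 by rewrite /B1; nra.
  have AB : 1 <= A * B1 by nra.
  have [xA|xA] := leP A x.
    have [h1 h2 h3] := @stein_right x (le_trans At xA) (le_trans A1 xA).
    by split; [exact: le_trans K1|exact: le_trans B11|exact: le_trans AB].
  have [xA'|xA'] := leP x (- A).
      have xt' : x <= t by lra.
    have x1' : x <= -1 by lra.
    have [h1 h2 h3] := stein_left xt' x1'.
    by split; [exact: le_trans K1|exact: le_trans B11|exact: le_trans AB].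
  have fK : `|stein_fun x| <= K.
    rewrite (le_trans (xmax x _))// ?lerDr// in_itv/=; apply/andP; split; lra.
  have xAn : `|x| <= A by rewrite ler_norml; apply/andP; split; lra.
  have f1 : `|stein_fun1 x| <= B1.
    rewrite /stein_fun1 /B1 -addrA (le_trans (ler_normD _ _))// lerD//.
      by rewrite normrM ler_pM.
    have /andP[r0 r1] := ramp01 x; rewrite ler_norml; apply/andP; split; lra.
  split => //; rewrite normrM ler_pM//.
have B10 : 0 <= B1 by rewrite /B1; nra.
have AB0 : 0 <= A * B1 by nra.
exists B; rewrite /B; split; first by lra.
- by move=> x; have [h _ _] := all x; lra.
- by move=> x; have [_ h _] := all x; lra.
move=> x; have [h1 h2 h3] := all x; have h4 := ramp'_bound x.
rewrite /stein_fun2 (le_trans (ler_normD _ _))//.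
have := ler_normD (stein_fun x) (x * stein_fun1 x); rewrite -/e2 in h4; lra.
Qed.

End SteinSolution.

(** * Stein bound under local dependence *)

Section LocalDependence.
Context (R : realType) d (T : measurableType d) (P : probability T R) (I V : finType)
  (X : I -> {RV P >-> R}).
Hypothesis indep : mutually_independent P X.
Variables (J : V -> {set I}) (xi : V -> (I -> R) -> R).
Hypothesis xi_bounded : forall x, bounded_functional (xi x).
Hypothesis xi_dep : forall x, depends_on (J x) (xi x).
Hypothesis xi_le1 : forall x z, `|xi x z| <= 1.
Hypothesis xi_mean : forall x, mean P (fun t => xi x (X^~ t)) = 0.

Definition neighborhood x : {set V} := [set y : V | ~~ [disjoint J x & J y]%B]%SET.
Variable Delta : nat.
Hypothesis card_neighborhood : forall x, (#|neighborhood x| <= Delta)%N.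

Let E (F : (I -> R) -> R) := mean P (fun t => F (X^~ t)).
Let N := neighborhood.

Lemma neighborhood_sym x y : (x \in N y) = (y \in N x).
Proof. by rewrite !inE disjoint_sym. Qed.

Let bX (F : (I -> R) -> R) : bounded_functional F -> bounded_measurable (fun t => F (X^~ t)).
Proof. by move=> bF; exact (bounded_functional_measurable X bF). Qed.

Let pc x y := E (fun z => xi x z * xi y z).
Let eta x y z := xi x z * xi y z - pc x y.

Let b_xixi x y : bounded_functional (fun z => xi x z * xi y z).
Proof. by apply: bounded_functionalM. Qed.

Let b_eta x y : bounded_functional (eta x y).
Proof. by apply: bounded_functionalD; [exact: b_xixi|exact: bounded_functional_cst]. Qed.

Let xixi_le1 x y z : `|xi x z * xi y z| <= 1.
Proof. by rewrite normrM mulr_ile1. Qed.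

Let pc_le1 x y : `|pc x y| <= 1.
Proof. by apply: mean_norm_le => [|t]; [exact: (bX (b_xixi x y))|exact: xixi_le1]. Qed.

Let eta_le2 x y z : `|eta x y z| <= 2.
Proof. have := ler_normB (xi x z * xi y z) (pc x y); have := xixi_le1 x y z; have := pc_le1 x y; rewrite /eta; lra. Qed.

Let eta_mean x y : E (eta x y) = 0.
Proof.
rewrite /E /eta meanB; [|exact: (bX (b_xixi x y))|exact: bounded_measurable_cst].
by rewrite mean_cst subrr.
Qed.

Let dep_eta x y : depends_on (J x :|: J y)%SET (eta x y).
Proof.
move=> z z' zz'; rewrite /eta.
have -> : xi x z = xi x z' by apply: xi_dep => i iJ; apply: zz'; rewrite inE iJ.
by have -> : xi y z = xi y z' by apply: xi_dep => i iJ; apply: zz'; rewrite inE iJ orbT.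
Qed.

Let linked x y x' y' : nat := ((x' \in N x) + (x' \in N y) + (y' \in N x) + (y' \in N y))%N.

Let cov_eta x y x' y' : E (fun z => eta x y z * eta x' y' z) <= 4 * (linked x y x' y')%:R.
Proof.
have [l0|l1] := posnP (linked x y x' y'); last first.
  apply: (@le_trans _ _ 4); last by rewrite ler_peMr// ler1n.
  apply: le_trans (ler_norm _) _; apply: mean_norm_le => [|t].
    by exact: (bX (bounded_functionalM (b_eta x y) (b_eta x' y'))).
  have := eta_le2 x y (X^~ t); have := eta_le2 x' y' (X^~ t); rewrite normrM.
  have := normr_ge0 (eta x y (X^~ t)); have := normr_ge0 (eta x' y' (X^~ t)); nra.
rewrite l0 mulr0.
have -> : E (fun z => eta x y z * eta x' y' z) = E (eta x y) * E (eta x' y').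
  apply: (mean_indep indep (J := (J x :|: J y)%SET) (K := (J x' :|: J y')%SET)) => //.
  move/eqP: l0; rewrite /linked !addn_eq0 !eqb0 !inE !negbK => /andP[/andP[/andP[h1 h2] h3] h4].
  move: h1 h2 h3 h4; rewrite -!setI_eq0 => /eqP h1 /eqP h2 /eqP h3 /eqP h4.
  by rewrite finset.setIUl !finset.setIUr h1 h2 h3 h4 !finset.setU0.
by rewrite eta_mean mul0r.
Qed.

Let count1 (A : {set V}) n : (#|A| <= n)%N -> (\sum_x \sum_(y in N x) (x \in A) <= n * Delta)%N.
Proof.
move=> An; apply: (@leq_trans (\sum_(x in A) Delta)); last by rewrite sum_nat_const leq_mul2r An orbT.
rewrite [leqRHS]big_mkcond /=; apply: leq_sum => x _; case: (x \in A).
  by rewrite sum1_card.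
by rewrite sum_nat_const muln0.
Qed.

Let count2 (A : {set V}) n : (#|A| <= n)%N -> (\sum_x \sum_(y in N x) (y \in A) <= n * Delta)%N.
Proof.
move=> An; rewrite (exchange_big_dep xpredT)//= (leq_trans _ (count1 An))//.
apply: leq_sum => y _; rewrite (eq_bigl (fun x => x \in N y))// => x.
by rewrite neighborhood_sym.
Qed.

Let count_linked x y : (\sum_x' \sum_(y' in N x') linked x y x' y' <= 4 * (Delta * Delta))%N.
Proof.
rewrite /linked.
under eq_bigr do rewrite !big_split /=.
rewrite !big_split/= (_ : 4 = 1 + 1 + 1 + 1)%N// !mulnDl !mul1n.
by apply: leq_add; first apply: leq_add; first apply: leq_add; [exact: count1|exact: count1|exact: count2|exact: count2].
Qed.

Let pairs z := \sum_x \sum_(y in N x) eta x y z.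

Let b_pairs : bounded_functional pairs.
Proof. by apply: bounded_functional_sum => x; apply: bounded_functional_sum => y; exact: b_eta. Qed.

(** Of the terms [eta x y * eta x' y'], only those where the pairs are linked can have
nonzero mean, and there are at most [4 * Delta ^ 3] linked ones per vertex [x]. *)
Let pairs_second_moment : E (fun z => pairs z ^+ 2) <= 16 * (#|V|%:R * Delta%:R ^+ 3).
Proof.
have -> : E (fun z => pairs z ^+ 2) =
    \sum_x \sum_(y in N x) \sum_x' \sum_(y' in N x') E (fun z => eta x y z * eta x' y' z).
  have bs x y : bounded_functional (fun z => \sum_x' \sum_(y' in N x') eta x y z * eta x' y' z).
    apply: bounded_functional_sum => x'; apply: bounded_functional_sum => y'.
    exact: bounded_functionalM.
  rewrite (_ : E _ = E (fun z => \sum_x \sum_(y in N x) \sum_x' \sum_(y' in N x') eta x y z * eta x' y' z)).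
    have bs2 x : bounded_functional (fun z => \sum_(y in N x) \sum_x' \sum_(y' in N x') eta x y z * eta x' y' z).
      by apply: bounded_functional_sum => y; exact: bs.
    rewrite /E mean_sum; last by move=> x _; exact (bX (bs2 x)).
    apply: eq_bigr => x _; rewrite mean_sum; last by move=> y _; exact (bX (bs x y)).
    apply: eq_bigr => y _; rewrite mean_sum; last first.
      move=> x' _; apply: (bX (F := fun z => \sum_(y' in N x') eta x y z * eta x' y' z)).
      by apply: bounded_functional_sum => y'; exact: bounded_functionalM.
    apply: eq_bigr => x' _; rewrite mean_sum// => y' _.
    exact: (bX (bounded_functionalM (b_eta x y) (b_eta x' y'))).
  apply: eq_mean => t; rewrite expr2 /pairs mulr_suml; apply: eq_bigr => x _.
  rewrite mulr_suml; apply: eq_bigr => y _; rewrite mulr_sumr; apply: eq_bigr => x' _.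
  by rewrite mulr_sumr.
apply: (@le_trans _ _ (\sum_x \sum_(y in N x) (16 * (Delta%:R * Delta%:R)))).
  apply: ler_sum => x _; apply: ler_sum => y _.
  apply: (@le_trans _ _ (\sum_x' \sum_(y' in N x') 4 * (linked x y x' y')%:R)).
    by apply: ler_sum => x' _; apply: ler_sum => y' _; exact: cov_eta.
  under eq_bigr do rewrite -mulr_sumr -natr_sum.
  rewrite -mulr_sumr -natr_sum (_ : 16 = 4 * 4%:R)//; last by rewrite -natrM.
  by rewrite -mulrA ler_wpM2l// -!natrM ler_nat count_linked.
apply: (@le_trans _ _ (\sum_(x : V) (Delta%:R * (16 * (Delta%:R * Delta%:R))))).
  apply: ler_sum => x _; rewrite sumr_const -[_ *+ _]mulr_natl ler_wpM2r ?mulr_ge0//.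
  by rewrite ler_nat card_neighborhood.
rewrite sumr_const -[_ *+ _]mulr_natl le_eqVlt; apply/orP; left; apply/eqP.
by rewrite cardE -cardT; ring.
Qed.

Let S z := \sum_x xi x z.
Let b_S : bounded_functional S. Proof. by apply: bounded_functional_sum. Qed.
Let v := E (fun z => S z ^+ 2).

(** Uncorrelated pairs drop out of the variance. *)
Let vE : v = \sum_x \sum_(y in N x) pc x y.
Proof.
rewrite /v /E.
rewrite (_ : mean _ _ = E (fun z => \sum_x \sum_y xi x z * xi y z)); last first.
  apply: eq_mean => t; rewrite expr2 /S mulr_suml; apply: eq_bigr => x _.
  by rewrite mulr_sumr.
rewrite /E mean_sum; last by move=> x _; apply: (bX (F := fun z => \sum_y xi x z * xi y z)); apply: bounded_functional_sum => y.
apply: eq_bigr => x _; rewrite mean_sum; last by move=> y _; exact: (bX (b_xixi x y)).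
rewrite (bigID (fun y => y \in N x))/= [X in _ + X]big1 ?addr0// => y; rewrite !inE negbK => Jxy.
by rewrite (mean_indep indep (xi_bounded x) (xi_bounded y) (@xi_dep x) (@xi_dep y))// xi_mean mul0r.
Qed.

Let A x z := \sum_(y in N x) xi y z.
Let A_le x z : `|A x z| <= Delta%:R.
Proof.
apply: le_trans (ler_norm_sum _ _ _) _.
apply: (@le_trans _ _ (\sum_(y in N x) 1)); first by apply: ler_sum.
by rewrite sumr_const ler_nat card_neighborhood.
Qed.

Let pairsE z : pairs z = \sum_x xi x z * A x z - v.
Proof.
rewrite vE -sumrB; apply: eq_bigr => x _; rewrite /A mulr_sumr -sumrB.
by [].
Qed.

Variables (s B : R) (f f1 : R -> R).
Hypothesis s_gt0 : 0 < s.
Hypothesis mf : measurable_fun setT f.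
Hypothesis mf1 : measurable_fun setT f1.
Hypothesis f_bounded : forall u, `|f u| <= B.
Hypothesis f1_bounded : forall u, `|f1 u| <= B.
Hypothesis f_taylor : forall u u', `|f u' - f u - f1 u * (u' - u)| <= B * (u' - u) ^+ 2.

Let W z := s * S z.
Let B_ge0 : 0 <= B. Proof. exact: le_trans (f_bounded 0). Qed.

Let b_comp (g : R -> R) (F : (I -> R) -> R) : measurable_fun setT g -> (forall u, `|g u| <= B) ->
  measurable_functional F -> bounded_functional (fun z => g (F z)).
Proof. by move=> mg gB mF; split; [exact: measurable_functional_comp|exists B]. Qed.

Let b_W : bounded_functional W.
Proof. by apply: bounded_functionalM => //; exact: bounded_functional_cst. Qed.

Let b_A x : bounded_functional (A x).
Proof. by apply: bounded_functional_sum. Qed.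

Let Wx x z := W z - s * A x z.
Let b_Wx x : bounded_functional (Wx x).
Proof.
rewrite (_ : Wx x = fun z => W z + - s * A x z); last by apply/funext => z; rewrite /Wx mulNr.
apply: bounded_functionalD => //.
by apply: bounded_functionalM => //; exact: bounded_functional_cst.
Qed.

(** After removing the neighborhood of [x], the sum is independent of [xi x]. *)
Let decoupled x : E (fun z => xi x z * f (Wx x z)) = 0.
Proof.
have -> : E (fun z => xi x z * f (Wx x z)) = E (xi x) * E (fun z => f (Wx x z)).
  apply: (mean_indep indep (J := J x) (K := (\bigcup_(y in ~: N x) J y)%SET)) => //.
  - by apply: b_comp => //; exact: (b_Wx x).1.
  - move=> z z' zz'.
    have E1 u : Wx x u = s * \sum_(y in ~: N x) xi y u.
      rewrite /Wx /W -mulrBr /S /A (bigID (fun y => y \in N x))/= addrAC subrr add0r.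
      by congr (_ * _); apply: eq_bigl => y; rewrite !inE.
    rewrite !E1; congr (f (_ * _)); apply: eq_bigr => y yN.
    by apply: xi_dep => i iJ; apply: zz'; apply/finset.bigcupP; exists y.
  - rewrite -setI_eq0; apply/eqP; apply/setP => i; rewrite !inE; apply/negP => /andP[iJx /finset.bigcupP[y]].
    by rewrite !inE negbK => /disjointFr/(_ iJx) ->.
by rewrite /E xi_mean mul0r.
Qed.

(** Up to the scaling by [s]: with [W_x] the sum [W] deprived of the neighborhood of
[x], each [xi x * f W_x] has mean zero, so the mean of [W * f W] is that of [\sum_x xi x
* (f W - f W_x)]. Expanding to first order leaves [f1 W] times [\sum_x xi x * A x],
which concentrates around its mean, the variance [v]. The three terms of the bound are
the Taylor remainder, the fluctuation of that sum, and the normalization error. *)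
Lemma stein_local_dependence :
  `|E (fun z => W z * f (W z)) - E (fun z => f1 (W z))| <=
  B * (#|V|%:R * Delta%:R ^+ 2 * s ^+ 3 + s ^+ 2 * Num.sqrt (16 * (#|V|%:R * Delta%:R ^+ 3)) +
       `|s ^+ 2 * v - 1|).
Proof.
pose err x z := f (Wx x z) - f (W z) - f1 (W z) * (Wx x z - W z).
have b_fW : bounded_functional (fun z => f (W z)) by apply: b_comp => //; exact: b_W.1.
have b_f1W : bounded_functional (fun z => f1 (W z)) by apply: b_comp => //; exact: b_W.1.
have b_fWx x : bounded_functional (fun z => f (Wx x z)) by apply: b_comp => //; exact: (b_Wx x).1.
have bc := @bounded_functional_cst R I.
have err_le x z : `|err x z| <= B * (s ^+ 2 * Delta%:R ^+ 2).
  apply: le_trans (f_taylor _ _) _; rewrite ler_wpM2l// /Wx addrAC subrr add0r sqrrN exprMn.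
  by rewrite ler_wpM2l ?sqr_ge0// -real_normK ?num_real// lerXn2r ?nnegrE.
have b_err x : bounded_functional (fun z => xi x z * err x z).
  apply: bounded_functionalM => //; rewrite (_ : err x = fun z => f (Wx x z) + (-1 * f (W z) +
    f1 (W z) * (s * A x z))); last by apply/funext => z; rewrite /err /Wx; ring.
  apply: bounded_functionalD => //; apply: bounded_functionalD; first exact: bounded_functionalM.
  by apply: bounded_functionalM => //; exact: bounded_functionalM.
(* Decoupled part, Taylor remainder, fluctuation of the pair sum, and main term. *)
have split1 z : W z * f (W z) =
    s * \sum_x xi x z * f (Wx x z) + (- s * (\sum_x xi x z * err x z) +
      (s ^+ 2 * (f1 (W z) * pairs z) + s ^+ 2 * v * f1 (W z))).
  have -> : W z * f (W z) = s * \sum_x xi x z * f (Wx x z) + (- s * (\sum_x xi x z * err x z) +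
      s ^+ 2 * f1 (W z) * \sum_x xi x z * A x z).
    rewrite {1}/W /S !mulr_sumr mulr_suml -!big_split/=; apply: eq_bigr => x _.
    by rewrite /err /Wx; ring.
  by rewrite pairsE; ring.
have b_sum1 : bounded_functional (fun z => \sum_x xi x z * f (Wx x z)).
  by apply: bounded_functional_sum => x; exact: bounded_functionalM.
have b_sum2 : bounded_functional (fun z => \sum_x xi x z * err x z).
  by apply: bounded_functional_sum => x.
have b_f1p : bounded_functional (fun z => f1 (W z) * pairs z) by exact: bounded_functionalM.
have -> : E (fun z => W z * f (W z)) = - s * E (fun z => \sum_x xi x z * err x z) +
   (s ^+ 2 * E (fun z => f1 (W z) * pairs z) + s ^+ 2 * v * E (fun z => f1 (W z))).
  rewrite /E (@eq_mean _ _ _ _ _ _ (fun t => split1 (X^~ t))).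
  have h c F : bounded_functional F -> bounded_measurable (fun t => c * F (X^~ t)).
    by move=> bF; apply: bounded_measurableZ; exact (bX bF).
  have h1 := h s _ b_sum1; have h2 := h (- s) _ b_sum2.
  have h3 := h (s ^+ 2) _ b_f1p; have h4 := h (s ^+ 2 * v) _ b_f1W.
  have h34 := bounded_measurableD h3 h4; have h234 := bounded_measurableD h2 h34.
  rewrite (meanD P h1 h234) (meanD P h2 h34) (meanD P h3 h4).
  rewrite (meanZ P _ (bX b_sum1)) (meanZ P _ (bX b_sum2)) (meanZ P _ (bX b_f1p)) (meanZ P _ (bX b_f1W)).
  rewrite mean_sum; last by move=> x _; exact (bX (bounded_functionalM (xi_bounded x) (b_fWx x))).
  by rewrite big1 ?mulr0 ?add0r// => x _; exact: decoupled.
set E1 := E (fun z => \sum_x _); set E2 := E (fun z => f1 (W z) * pairs z); set E3 := E (fun z => f1 (W z)).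
have hE1 : `|E1| <= #|V|%:R * (B * (s ^+ 2 * Delta%:R ^+ 2)).
  apply: mean_norm_le => [|t]; first exact (bX b_sum2).
  apply: le_trans (ler_norm_sum _ _ _) _.
  apply: (@le_trans _ _ (\sum_(x : V) (B * (s ^+ 2 * Delta%:R ^+ 2)))).
    by apply: ler_sum => x _; rewrite normrM -[leRHS]mul1r ler_pM.
  by rewrite sumr_const -[_ *+ _]mulr_natl cardE -cardT.
have hE2 : `|E2| <= B * Num.sqrt (16 * (#|V|%:R * Delta%:R ^+ 3)).
  have bp := bounded_measurable_norm (bX b_pairs).
  apply: (@le_trans _ _ (B * E (fun z => `|pairs z|))).
    apply: le_trans (mean_norm P (bX b_f1p)) _; rewrite /E -meanZ//.
    apply: le_mean; [exact: bounded_measurable_norm (bX b_f1p)|exact: bounded_measurableZ|].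
    by move=> t; rewrite normrM ler_wpM2r.
  rewrite ler_wpM2l// -(ler_pXn2r (_ : 0 < 2)%N)// ?nnegrE//; last first.
    by apply: mean_ge0 => t.
  rewrite sqr_sqrtr ?mulr_ge0 ?exprn_ge0//.
  apply: le_trans (sqr_mean_le P bp) _; apply: le_trans pairs_second_moment.
  rewrite le_eqVlt; apply/orP; left; apply/eqP; apply: eq_mean => t.
  by rewrite real_normK ?num_real.
have hE3 : `|E3| <= B by apply: mean_norm_le => [|t]; [exact (bX b_f1W)|exact: f1_bounded].
have -> : - s * E1 + (s ^+ 2 * E2 + s ^+ 2 * v * E3) - E3 =
   - s * E1 + (s ^+ 2 * E2 + (s ^+ 2 * v - 1) * E3) by ring.
apply: le_trans (ler_normD _ _) _.
rewrite mulrDr mulrDr -addrA; apply: lerD.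
  rewrite normrM normrN [`|s|]ger0_norm ?(ltW s_gt0)//.
  apply: (@le_trans _ _ (s * (#|V|%:R * (B * (s ^+ 2 * Delta%:R ^+ 2))))).
    by rewrite ler_wpM2l// ltW.
  by rewrite le_eqVlt; apply/orP; left; apply/eqP; ring.
apply: le_trans (ler_normD _ _) _; apply: lerD.
  rewrite normrM [`|s ^+ 2|]ger0_norm ?sqr_ge0// [leRHS]mulrCA ler_wpM2l ?sqr_ge0//.
by rewrite normrM mulrC ler_wpM2r.
Qed.

End LocalDependence.

(** * Normal approximation on a fixed graph *)

Lemma dist_le_sym (G : sgraph) r (x y : G) : dist_le r x y -> dist_le r y x.
Proof.
move=> /existsP[k /existsP[p /andP[xp /eqP yE]]].
have sz : size (rev (belast x p)) == k by rewrite size_rev size_belast size_tuple.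
apply/existsP; exists k; apply/existsP; exists (Tuple sz) => /=.
rewrite -yE; apply/andP; split.
  by rewrite rev_path (eq_path (e' := @adj G)) // => a b; rewrite adj_sym.
by case: (tval p) => [|a s] //=; rewrite rev_cons last_rcons.
Qed.

Section FixedGraph.
Context (R : realType) (G : sgraph) d (T : measurableType d) (P : probability T R).
Let I : finType := (edge G + G)%type.
Context (X : I -> {RV P >-> R}).
Hypothesis indep : mutually_independent P X.
Variables (r b : nat) (eta : R).
Hypothesis local_approx : forall v : G,
  mean P (fun t => `|config_free [set: G]%SET v (X^~ t) - config_free (Defs.ball v r) v (X^~ t)|) <= eta.
Hypothesis card_ball : forall v : G, (#|Defs.ball v r| <= b)%N.

Let msize t : R := size_functional (X^~ t).
Let sigma : R := Num.sqrt (var P msize).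
Hypothesis sigma_gt0 : 0 < sigma.
Let n : R := #|G|%:R.

Let bfree S v : bounded_measurable (fun t => config_free S v (X^~ t)).
Proof. exact (bounded_functional_measurable X (bounded_functional_free R S v)). Qed.

Let bsize : bounded_measurable msize.
Proof. exact (bounded_functional_measurable X (bounded_functional_size R G)). Qed.

Let centered t := msize t - mean P msize.

Let free_local v t := config_free (Defs.ball v r) v (X^~ t).
Let mloc v := mean P (free_local v).
Let xi (v : G) (z : I -> R) := 2^-1 * (mloc v + -1 * config_free (Defs.ball v r) v z).

Let mloc01 v : 0 <= mloc v <= 1.
Proof.
rewrite mean_ge0 => [|t]; last exact: config_free_ge0.
rewrite -[leRHS](mean_cst P 1); apply: le_mean; [exact: bfree|exact: bounded_measurable_cst|].
by move=> t; exact: config_free_le1.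
Qed.

Let xi_half v z : `|xi v z| <= 2^-1.
Proof.
have /andP[m0 m1] := mloc01 v.
have p0 := config_free_ge0 (Defs.ball v r) v z; have p1 := config_free_le1 (Defs.ball v r) v z.
by rewrite /xi ler_norml; apply/andP; split; lra.
Qed.

Let xi_bounded v : bounded_functional (xi v).
Proof.
apply: bounded_functionalM; first exact: bounded_functional_cst.
apply: bounded_functionalD; first exact: bounded_functional_cst.
apply: bounded_functionalM; first exact: bounded_functional_cst.
exact: bounded_functional_free.
Qed.

Let xi_dep v : depends_on (coords (Defs.ball v r)) (xi v).
Proof. by move=> z z' zz'; rewrite /xi (depends_on_free _ zz'). Qed.

Let xi_mean v : mean P (fun t => xi v (X^~ t)) = 0.
Proof.
have b1 := bounded_measurable_cst T (mloc v); have b2 := bounded_measurableZ (-1) (bfree (Defs.ball v r) v).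
rewrite /xi meanZ; last exact: bounded_measurableD.
rewrite meanD// meanZ; last exact: bfree.
by rewrite mean_cst -/(mloc v); ring.
Qed.

(** Two balls that share an edge or a vertex have centers within two steps of length
[r]. *)
Let card_nbh v : (#|neighborhood (fun v : G => coords (Defs.ball v r)) v| <= b * b)%N.
Proof.
apply: (@leq_trans #|(\bigcup_(z in Defs.ball v r) Defs.ball z r)%SET|).
  apply: subset_leq_card; apply/fintype.subsetP => y.
  rewrite !inE -setI_eq0 => /set0Pn[i]; rewrite !inE.
  have mem z : z \in Defs.ball v r -> z \in Defs.ball y r -> y \in (\bigcup_(z in Defs.ball v r) Defs.ball z r)%SET.
    by move=> zv zy; apply/finset.bigcupP; exists z => //; move: zy; rewrite !inE; exact: dist_le_sym.
  case: i => [e|z] /andP[h1 h2]; last exact: (mem z).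
  have [a [a' [E _ _]]] := edge_pair e.
  apply: (mem a); [apply: (fintype.subsetP h1)|apply: (fintype.subsetP h2)]; by rewrite E !inE eqxx.
apply: (@leq_trans (#|Defs.ball v r| * b)%N); last by rewrite leq_mul2r card_ball orbT.
rewrite -sum_nat_const; elim/big_rec2 : _ => [|z k B _ kB]; first by rewrite cards0.
by rewrite (leq_trans (leq_card_setU _ _).1)// leq_add.
Qed.

Let S t := \sum_v xi v (X^~ t).

Let bS : bounded_measurable S.
Proof.
exact (bounded_functional_measurable X (bounded_functional_sum (index_enum G) xpredT xi_bounded)).
Qed.

Let bcentered : bounded_measurable centered.
Proof. by apply: bounded_measurableB => //; exact: bounded_measurable_cst. Qed.

Let mean_size_free : mean P msize = \sum_(v : G) 2^-1 * (1 - mean P (fun t => config_free [set: G]%SET v (X^~ t))).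
Proof.
rewrite (@eq_mean _ _ _ P _ (fun t => \sum_(v : G) 2^-1 * (1 - config_free [set: G]%SET v (X^~ t)))); last first.
  by move=> t; rewrite /msize size_functionalE mulr_sumr.
have bc := bounded_measurable_cst T (1 : R).
rewrite mean_sum; last by move=> v _; apply: bounded_measurableZ; exact: bounded_measurableB.
apply: eq_bigr => v _; rewrite meanZ; last exact: bounded_measurableB.
by rewrite meanB// mean_cst.
Qed.

Let centeredE t : centered t = \sum_(v : G) 2^-1 * (mean P (fun t => config_free [set: G]%SET v (X^~ t)) - config_free [set: G]%SET v (X^~ t)).
Proof.
rewrite /centered mean_size_free /msize size_functionalE mulr_sumr -sumrB.
by apply: eq_bigr => v _; ring.
Qed.

(** Localization is applied to the variables and to their means. *)
Let mean_centered_S : mean P (fun t => `|centered t - S t|) <= n * eta.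
Proof.
pose D v t := config_free [set: G]%SET v (X^~ t) - config_free (Defs.ball v r) v (X^~ t).
have bD v : bounded_measurable (D v) by exact: bounded_measurableB.
have bDn v := bounded_measurable_norm (bD v).
have bc (c : R) := bounded_measurable_cst T c.
have bs v : bounded_measurable (fun t => 2^-1 * (eta + `|D v t|)).
  by apply: bounded_measurableZ; exact: bounded_measurableD.
apply: (@le_trans _ _ (mean P (fun t => \sum_(v : G) 2^-1 * (eta + `|D v t|)))).
  apply: le_mean; [exact/bounded_measurable_norm/bounded_measurableB|exact: bounded_measurable_sum|].
  move=> t; rewrite centeredE /S -sumrB; apply: le_trans (ler_norm_sum _ _ _) _.
  apply: ler_sum => v _.
  rewrite (_ : _ - xi v _ = 2^-1 * (mean P (D v) - D v t)); last first.
    by rewrite /D meanB// /xi /mloc /free_local; ring.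
  rewrite normrM ger0_norm ?invr_ge0// ler_wpM2l ?invr_ge0// (le_trans (ler_normB _ _))// lerD2r.
  exact: le_trans (mean_norm P (bD v)) (local_approx v).
rewrite mean_sum//; apply: (@le_trans _ _ (\sum_(v : G) eta)); last first.
  by rewrite sumr_const -[_ *+ _]mulr_natl cardE -cardT.
apply: ler_sum => v _; rewrite meanZ; last exact: bounded_measurableD.
rewrite meanD// mean_cst; have := local_approx v; rewrite -/(D v); lra.
Qed.

Let S_le t : `|S t| <= n / 2.
Proof.
apply: le_trans (ler_norm_sum _ _ _) _.
apply: (@le_trans _ _ (\sum_(v : G) 2^-1)); first by apply: ler_sum.
by rewrite sumr_const -[_ *+ _]mulr_natl cardE -cardT.
Qed.

Let centered_le t : `|centered t| <= n / 2.
Proof.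
rewrite centeredE; apply: le_trans (ler_norm_sum _ _ _) _.
apply: (@le_trans _ _ (\sum_(v : G) 2^-1)); last first.
  by rewrite sumr_const -[_ *+ _]mulr_natl cardE -cardT.
apply: ler_sum => v _; set m := mean _ _.
have m0 : 0 <= m by apply: mean_ge0 => u; exact: config_free_ge0.
have m1 : m <= 1.
  rewrite -[leRHS](mean_cst P 1); apply: le_mean; [exact: bfree|exact: bounded_measurable_cst|].
  by move=> u; exact: config_free_le1.
have p0 := config_free_ge0 [set: G]%SET v (X^~ t); have p1 := config_free_le1 [set: G]%SET v (X^~ t).
by rewrite ler_norml; apply/andP; split; lra.
Qed.

Let varE : var P msize = sigma ^+ 2.
Proof. by rewrite sqr_sqrtr// mean_ge0// => t; exact: sqr_ge0. Qed.

(** Both sums are at most [n / 2], so their squares differ by at most [n] times their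
difference. *)
Let second_moment_S : `|sigma ^- 2 * mean P (fun t => S t ^+ 2) - 1| <= n ^+ 2 * eta / sigma ^+ 2.
Proof.
have s2 : 0 < sigma ^+ 2 by rewrite exprn_gt0.
rewrite (_ : _ - 1 = (mean P (fun t => S t ^+ 2) - var P msize) / sigma ^+ 2); last first.
  by rewrite varE mulrBl mulfV ?gt_eqF// mulrC.
rewrite normrM [`|_^-1|]ger0_norm ?invr_ge0 ?(ltW s2)// ler_wpM2r ?invr_ge0 ?(ltW s2)//.
have b2S := bounded_measurableX 2 bS; have b2c := bounded_measurableX 2 bcentered.
rewrite /var -[mean P (fun t => (_ - _) ^+ 2)]/(mean P (fun t => centered t ^+ 2)) -meanB//.
have bdiff := bounded_measurable_norm (bounded_measurableB bcentered bS).
apply: le_trans (mean_norm P _) _; first exact: bounded_measurableB.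
apply: (@le_trans _ _ (mean P (fun t => n * `|centered t - S t|))).
  apply: le_mean; [exact/bounded_measurable_norm/bounded_measurableB|exact: bounded_measurableZ|].
  move=> t; rewrite subr_sqr normrM mulrC distrC ler_wpM2r//.
  have := ler_normD (S t) (centered t); have := S_le t; have := centered_le t; lra.
by rewrite meanZ// expr2 -mulrA ler_wpM2l.
Qed.

(** The mean size is first replaced by the sum of the local variables, to which the
Stein bound applies; the cut-off is Lipschitz, so the replacement costs its Lipschitz
constant times the mean error. *)
Lemma size_normal_approximation (t0 eps B : R) : 0 < eps ->
  (forall x, `|stein_fun t0 eps x| <= B) -> (forall x, `|stein_fun1 t0 eps x| <= B) ->
  (forall x, `|stein_fun2 t0 eps x| <= B) ->
  `|mean P (fun t => ramp t0 eps ((msize t - mean P msize) / sigma)) - ramp_mean t0 eps| <=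
  2 / eps * (n * eta / sigma) +
  B * (n * (b * b)%:R ^+ 2 * sigma^-1 ^+ 3 +
       sigma^-1 ^+ 2 * Num.sqrt (16 * (n * (b * b)%:R ^+ 3)) + n ^+ 2 * eta / sigma ^+ 2).
Proof.
move=> eps0 Bf Bf1 Bf2.
have s0 : 0 < sigma^-1 by rewrite invr_gt0.
have B0 : 0 <= B by exact: le_trans (Bf 0).
have dr := is_derive_ramp t0 eps; have ds := is_derive_stein t0 eps.
have ds1 := is_derive_stein1 t0 eps.
have mr : measurable_fun setT (ramp t0 eps).
  by apply: continuous_measurable_fun; exact: is_derive_continuous dr.
have ms : measurable_fun setT (stein_fun t0 eps).
  by apply: continuous_measurable_fun; exact: is_derive_continuous ds.
have ms1 : measurable_fun setT (stein_fun1 t0 eps).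
  by apply: continuous_measurable_fun; exact: is_derive_continuous ds1.
have ft := taylor2 ds ds1 Bf2.
have := @stein_local_dependence R _ T P I G X indep (fun v : G => coords (Defs.ball v r)) xi xi_bounded
  xi_dep _ xi_mean (b * b)%N card_nbh sigma^-1 B _ _ s0 ms ms1 Bf Bf1 ft.
have xi1 v z : `|xi v z| <= 1 by apply: le_trans (xi_half v z) _; lra.
move=> /(_ xi1).
set Wf := mean P _; set f1W := mean P _; rewrite -/n.
pose W t := sigma^-1 * S t.
have bW : bounded_measurable W by exact: bounded_measurableZ.
have bcomp (h : R -> R) (C : R) (Y : T -> R) : measurable_fun setT h -> (forall x, `|h x| <= C) ->
    bounded_measurable Y -> bounded_measurable (fun t => h (Y t)).
  by move=> mh hC bY; split; [exact: measurableT_comp mh bY.1|exists C].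
have r1 x : `|ramp t0 eps x| <= 1.
  by have /andP[h0 h1] := ramp01 t0 eps x; rewrite ger0_norm.
have brW := bcomp _ _ W mr r1 bW.
have bfW := bcomp _ _ W ms Bf bW.
have bf1W := bcomp _ _ W ms1 Bf1 bW.
have E1 : mean P (fun t => ramp t0 eps (W t)) - ramp_mean t0 eps = - (Wf - f1W).
  rewrite /Wf /f1W -[mean P (fun t => _ * _ * _)]/(mean P (fun t => W t * stein_fun t0 eps (W t))).
  rewrite -[mean P (fun t => stein_fun1 t0 eps _)]/(mean P (fun t => stein_fun1 t0 eps (W t))).
  have bWf := bounded_measurableM bW bfW.
  rewrite (@eq_mean _ _ _ P _ (fun t => ramp_mean t0 eps + (stein_fun1 t0 eps (W t) - W t * stein_fun t0 eps (W t)))).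
    rewrite meanD; [|exact: bounded_measurable_cst|exact: bounded_measurableB].
    by rewrite mean_cst meanB//; ring.
  by move=> t; rewrite /stein_fun1; ring.
move=> stein.
pose Y t := (msize t - mean P msize) / sigma.
have bY : bounded_measurable Y.
  by apply: bounded_measurableM => //; exact: bounded_measurable_cst.
have brY := bcomp _ _ Y mr r1 bY.
have YW : `|mean P (fun t => ramp t0 eps (Y t)) - mean P (fun t => ramp t0 eps (W t))| <= 2 / eps * (n * eta / sigma).
  rewrite -meanB//; apply: le_trans (mean_norm P _) _; first exact: bounded_measurableB.
  have bn := bounded_measurable_norm (bounded_measurableB bcentered bS).
  apply: (@le_trans _ _ (mean P (fun t => 2 / eps / sigma * `|centered t - S t|))).
    apply: le_mean; [exact/bounded_measurable_norm/bounded_measurableB|exact: bounded_measurableZ|].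
    move=> t; have := lipschitz_of_derive dr (ramp'_bound t0 eps0) (W t) (Y t).
    move=> /le_trans; apply; rewrite -mulrA ler_wpM2l//; first by rewrite divr_ge0// ltW.
    rewrite (_ : Y t - W t = sigma^-1 * (centered t - S t)); last by rewrite /Y /W /centered; ring.
    by rewrite normrM ger0_norm// ltW.
  rewrite meanZ// [n * eta / sigma]mulrC mulrA ler_wpM2l//.
  by rewrite !divr_ge0// ltW.
rewrite -[mean P (fun t => ramp _ _ _)]/(mean P (fun t => ramp t0 eps (Y t))).
rewrite -(subrKA (mean P (fun t => ramp t0 eps (W t)))).
apply: le_trans (ler_normD _ _) _; apply: lerD => //.
rewrite E1 normrN; apply: le_trans stein _; rewrite ler_wpM2l// lerD2l.
by rewrite exprVn; exact: second_moment_S.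
Qed.

End FixedGraph.

(** * Choice of the parameters *)

Section Constants.
Variable R : realType.

(** The events shrink to the empty set as [a] grows. *)
Lemma tail_small (Q : probability (measurableTypeR R) R) (q : R) : 0 < q ->
  exists A : R, forall a, A <= a -> (Q [set y : R | (a < `|y|)%R] <= q%:E)%E.
Proof.
move=> q0.
pose S (k : nat) : set (measurableTypeR R) := [set y : R | k%:R < `|y|].
have mS (a : R) : measurable ([set y : R | a < `|y|] : set (measurableTypeR R)).
  exact: measurable_norm_gt.
have : Q \o S @ \oo --> Q (\bigcap_k S k).
  apply: nonincreasing_cvg_mu => //.
  - by rewrite (le_lt_trans (probability_le1 Q (mS 0%:R)))// ltry.
  - by move=> k; exact: mS.
  - by apply: bigcap_measurable => // k _; exact: mS.
  - move=> i j ij; apply/subsetPset => y /=; apply: le_lt_trans; by rewrite ler_nat.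
have -> : \bigcap_k S k = set0.
  rewrite -subset0 => y /(_ (Num.truncn `|y|).+1 I) /= h.
  by have := truncnS_gt `|y|; rewrite ltNge (ltW h).
rewrite measure0 => h.
have : \forall k \near \oo, (Q (S k) <= q%:E)%E.
  have /fine_cvgP [hf /cvgrPdist_le/(_ q q0)] := h; move: hf; apply: filterS2 => k fk.
  rewrite sub0r normrN ger0_norm ?fine_ge0// => H.
  by rewrite -[leLHS]fineK// lee_fin.
move=> [N _ /(_ N (leqnn N)) HN]; exists N%:R => a Na.
apply: le_trans HN; apply: le_measure; rewrite ?inE; [exact: mS|exact: mS|].
by move=> y /=; exact: le_lt_trans.
Qed.

(** The bound follows from [1 + y <= expR y] with [y = ln 2 / k]. *)
Lemma small_tail_parameter (k : nat) (delta : R) : (0 < k)%N -> 0 < delta ->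
  exists2 q, 0 < q & (1 + delta ^- k * q) ^+ k <= 2.
Proof.
move=> k0 d0; exists (delta ^+ k * (ln 2 / k%:R)).
  by rewrite mulr_gt0 ?exprn_gt0// divr_gt0 ?ln_gt0 ?ltr0n// ltr1n.
rewrite mulKf ?gt_eqF ?exprn_gt0//.
have l2 : 0 <= ln 2 / k%:R :> R by rewrite divr_ge0// ln_ge0// ler1n.
apply: (@le_trans _ _ (expR (ln 2 / k%:R) ^+ k)).
  by apply: lerXn2r; rewrite ?nnegrE ?expR_ge0 ?addr_ge0// expR_ge1Dx.
by rewrite -expRM_natl mulrCA mulfV ?pnatr_eq0 -?lt0n// mulr1 lnK// posrE.
Qed.

Lemma power_small (B delta : R) : 0 <= B -> 0 < delta ->
  exists2 m, (0 < m)%N & (B / (1 + B)) ^+ m <= delta.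
Proof.
move=> B0 d0; pose m := (Num.truncn (`|ln delta| * (1 + B))).+1; exists m => //.
have B1 : 0 < 1 + B by rewrite ltr_pwDl.
apply: (@le_trans _ _ (expR (- (1 + B)^-1) ^+ m)).
  apply: lerXn2r; rewrite ?nnegrE ?expR_ge0 ?divr_ge0 ?(ltW B1)//.
  have := expR_ge1Dx (- (1 + B)^-1); apply: le_trans.
  by rewrite le_eqVlt; apply/orP; left; apply/eqP; field; rewrite gt_eqF.
rewrite -expRM_natl -[leRHS]lnK// ler_expR mulrN lerNl.
have : `|ln delta| * (1 + B) <= m%:R by apply/ltW/truncnS_gt.
rewrite -ler_pdivlMr// => h; apply: le_trans h.
by rewrite -normrN ler_norm.
Qed.

(** With [u] the eighth root of [n] and [x] its inverse, neighborhoods have size of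
order [u], the standard deviation is at least of order [u ^+ 4], and localization has
error [x ^+ 32]. Each term of the error is then at most of order [x ^+ 2], up to
constants. *)
Lemma error_asymptotics (n Delta sigma eta K k0 u x eps B : R) :
  0 < eps -> 0 <= B -> 1 <= K -> 0 < k0 -> 1 <= u -> u * x = 1 ->
  n = u ^+ 8 -> 0 <= eta <= 2 * x ^+ 32 -> 0 <= Delta <= K * u -> k0 * u ^+ 4 <= sigma ->
  2 / eps * (n * eta / sigma) +
  B * (n * Delta ^+ 2 * sigma^-1 ^+ 3 +
       sigma^-1 ^+ 2 * Num.sqrt (16 * (n * Delta ^+ 3)) + n ^+ 2 * eta / sigma ^+ 2) <=
  (2 / eps * (2 / k0) + B * (K ^+ 2 / k0 ^+ 3 + 4 * K ^+ 2 / k0 ^+ 2 + 2 / k0 ^+ 2)) * x ^+ 2.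
Proof.
move=> e0 B0 K1 k00 u1 ux nE /andP[eta0 etax] /andP[D0 DK] sk.
have u0 : 0 < u by lra.
have xE : x = u^-1 by rewrite -[RHS]mulr1 -ux mulKf// gt_eqF.
have x0 : 0 < x by rewrite xE invr_gt0.
have x1 : x <= 1 by rewrite xE invf_le1.
have ku : 0 < k0 * u ^+ 4 by rewrite mulr_gt0// exprn_gt0.
have s0 : 0 < sigma by exact: lt_le_trans sk.
set s := sigma^-1.
have sp : 0 < s by rewrite invr_gt0.
have sx : s <= x ^+ 4 / k0.
  by rewrite /s (le_trans (y := (k0 * u ^+ 4)^-1))// ?lef_pV2// invfM mulrC xE exprVn.
have xX i j : (i <= j)%N -> x ^+ j <= x ^+ i by move=> ij; rewrite ler_wiXn2l// ltW.
have nx : n * x ^+ 8 = 1 by rewrite nE -exprMn ux expr1n.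
have n0 : 0 <= n by rewrite nE exprn_ge0// ltW.
have K0 : 0 <= K by lra.
have i0 : 0 <= k0^-1 by rewrite invr_ge0 ltW.
have t1 : n * eta / sigma <= 2 / k0 * x ^+ 2.
  apply: (@le_trans _ _ (n * (2 * x ^+ 32) * (x ^+ 4 / k0))).
    by rewrite ler_pM ?mulr_ge0 ?(ltW sp)// ler_wpM2l.
  rewrite (_ : _ * (x ^+ 4 / k0) = 2 / k0 * (n * x ^+ 8) * x ^+ 28); last by ring.
  by rewrite nx mulr1 ler_wpM2l ?mulr_ge0// xX.
have t2 : n * Delta ^+ 2 * s ^+ 3 <= K ^+ 2 / k0 ^+ 3 * x ^+ 2.
  apply: (@le_trans _ _ (n * (K * u) ^+ 2 * (x ^+ 4 / k0) ^+ 3)).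
    apply: ler_pM; rewrite ?mulr_ge0 ?exprn_ge0 ?(ltW sp)//.
      by rewrite ler_wpM2l// lerXn2r// nnegrE// mulr_ge0// ltW.
    by rewrite lerXn2r// nnegrE ?(ltW sp)// mulr_ge0// exprn_ge0// ltW.
  rewrite (_ : _ * _ ^+ 3 = K ^+ 2 * k0^-1 ^+ 3 * (n * x ^+ 8) * (u * x) ^+ 2 * x ^+ 2); last by ring.
  by rewrite nx ux expr1n !mulr1 exprVn.
have t3 : s ^+ 2 * Num.sqrt (16 * (n * Delta ^+ 3)) <= 4 * K ^+ 2 / k0 ^+ 2 * x ^+ 2.
  have sq : Num.sqrt (16 * (n * Delta ^+ 3)) <= 4 * K ^+ 2 * u ^+ 6.
    have h0 : 0 <= 4 * K ^+ 2 * u ^+ 6 by rewrite !mulr_ge0 ?exprn_ge0// ltW.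
    rewrite -[leRHS]ger0_norm// -sqrtr_sqr ler_wsqrtr// nE.
    have -> : (4 * K ^+ 2 * u ^+ 6) ^+ 2 = 16 * (u ^+ 8 * (K ^+ 4 * u ^+ 4)) by ring.
    rewrite ler_wpM2l// ler_wpM2l ?exprn_ge0 ?(ltW u0)//.
    apply: (@le_trans _ _ ((K * u) ^+ 3)); first by rewrite lerXn2r// nnegrE// mulr_ge0// ltW.
    rewrite exprMn ler_pM ?exprn_ge0 ?(ltW u0)// ler_weXn2l//.
  apply: (@le_trans _ _ ((x ^+ 4 / k0) ^+ 2 * (4 * K ^+ 2 * u ^+ 6))).
    apply: ler_pM; rewrite ?exprn_ge0 ?sqrtr_ge0 ?(ltW sp)//.
    by rewrite lerXn2r// nnegrE ?(ltW sp)// mulr_ge0// exprn_ge0// ltW.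
  rewrite (_ : _ * _ = 4 * K ^+ 2 * k0^-1 ^+ 2 * (u * x) ^+ 6 * x ^+ 2); last by ring.
  by rewrite ux expr1n !mulr1 exprVn.
have t4 : n ^+ 2 * eta / sigma ^+ 2 <= 2 / k0 ^+ 2 * x ^+ 2.
  rewrite -exprVn -/s.
  apply: (@le_trans _ _ (n ^+ 2 * (2 * x ^+ 32) * (x ^+ 4 / k0) ^+ 2)).
    apply: ler_pM; rewrite ?mulr_ge0 ?exprn_ge0 ?(ltW sp)//.
      by rewrite ler_wpM2l// exprn_ge0.
    by rewrite lerXn2r// nnegrE ?(ltW sp)// mulr_ge0// exprn_ge0// ltW.
  rewrite (_ : _ * _ ^+ 2 = 2 * k0^-1 ^+ 2 * (n * x ^+ 8) ^+ 2 * x ^+ 24); last by ring.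
  by rewrite nx expr1n mulr1 exprVn ler_wpM2l ?xX// divr_ge0// exprn_ge0// ltW.
rewrite [leRHS]mulrDl; apply: lerD.
  by rewrite -[leRHS]mulrA ler_wpM2l// divr_ge0// ltW.
rewrite -[leRHS]mulrA ler_wpM2l// [leRHS]mulrDl; apply: lerD => //.
by rewrite [leRHS]mulrDl; apply: lerD.
Qed.

End Constants.

(** * Convergence along the sequence of graphs *)

Section Sandwich.
Context (R : realType) d (T : measurableType d) (P : probability T R).

Lemma mean_indic_set (A : set T) : measurable A -> @mean R _ _ P (fun t => \1_A t) = fine (P A).
Proof. by move=> mA; rewrite /mean /Rintegral integral_indic// setIT. Qed.

(** The indicator of a half-line lies between two ramps, one ending and one beginning at
[t]. *)
Lemma cdf_sandwich (Y : T -> R) (t eps : R) : measurable_fun setT Y -> 0 < eps ->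
  mean P (fun u => ramp (t - eps) eps (Y u)) <= fine (P [set u | Y u <= t]) <=
  mean P (fun u => ramp t eps (Y u)).
Proof.
move=> mY e0.
have mA : measurable [set u | Y u <= t].
  rewrite (_ : mkset _ = Y @^-1` `]-oo, t]); first by rewrite -[_ @^-1` _]setTI; exact: mY.
  by apply/seteqP; split => u /=; rewrite in_itv.
have b1 : @bounded_measurable R _ _ (fun u => \1_[set u | Y u <= t] u).
  split; first exact: measurable_indic.
  by exists 1 => u; rewrite indicE; case: (_ \in _); rewrite ?normr1 ?normr0.
have br s : bounded_measurable (fun u => ramp s eps (Y u)).
  split; last by exists 1 => u; have /andP[h0 h1] := ramp01 s eps (Y u); rewrite ger0_norm.
  apply: (measurableT_comp _ mY); apply: continuous_measurable_fun.
  exact: is_derive_continuous (is_derive_ramp s eps).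
rewrite -mean_indic_set//; apply/andP; split; apply: le_mean => // u.
  rewrite indicE; case: (boolP (_ \in _)) => [_|].
    by case/andP: (ramp01 (t - eps) eps (Y u)).
  rewrite notin_setE /= => /negP; rewrite -ltNge => tY.
  by rewrite ramp_ge// subrK ltW.
rewrite indicE; case: (boolP (_ \in _)) => [|_]; last by case/andP: (ramp01 t eps (Y u)).
by rewrite inE /= => Yt; rewrite ramp_le.
Qed.

End Sandwich.

Lemma Phi_lipschitz (R : realType) (x y : R) : `|Phi y - Phi x| <= normal_peak 1 * `|y - x|.
Proof.
apply: lipschitz_of_derive; first exact: is_derive_Phi.
by move=> z; rewrite ger0_norm ?normal_density_le// ltW// normal_density_gt0.
Qed.

Section UniformConstants.
Context (R : realType) (G : nat -> sgraph) (d : nat -> measure_display)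
  (Omega : forall n, measurableType (d n)) (P : forall n, probability (Omega n) R)
  (w : forall n, edge (G n) -> {RV (P n) >-> R}) (nu : forall n, G n -> {RV (P n) >-> R})
  (Q : probability (measurableTypeR R) R) (D : nat).

Definition weight n (i : edge (G n) + G n) : {RV (P n) >-> R} :=
  match i with inl e => w e | inr x => nu x end.

Hypothesis degree_le : forall n, (max_degree (G n) <= D)%N.
Hypothesis indep : forall n, mutually_independent (P n) (@weight n).
Hypothesis edge_law : forall n (e : edge (G n)) (A : set R), measurable A ->
  distribution (P n) (w e) A = normal_prob 0 1 A.
Hypothesis vertex_law : forall n (x : G n) (A : set R), measurable A ->
  distribution (P n) (nu x) A = Q A.

Lemma degree_bound n (v : G n) : (degree v <= D)%N.
Proof. by apply: leq_trans (degree_le n); exact: leq_bigmax. Qed.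

(** There are only two laws among the weights, whatever [n] is. *)
Lemma uniform_tail (q : R) : 0 < q -> exists a : R, forall n i,
  (P n (@weight n i @^-1` [set y | (a < `|y|)%R]) <= q%:E)%E.
Proof.
move=> q0; have [A1 h1] := tail_small (normal_prob 0 1) q0; have [A2 h2] := tail_small Q q0.
pose a := Num.max A1 A2; exists a => n i.
have ma := measurable_norm_gt a.
case: i => [e|x] /=.
  have := edge_law e ma; rewrite /distribution /pushforward => ->.
  by apply: h1; rewrite le_max lexx.
have := vertex_law x ma; rewrite /distribution /pushforward => ->.
by apply: h2; rewrite le_max lexx orbT.
Qed.

Lemma uniform_decay : exists2 c : R, 0 < c & forall n r (S : {set G n}) (v : G n),
  (forall y, dist_le r v y -> y \in S) ->
  mean (P n) (fun t => `|config_free [set: G n]%SET v (fun i => weight i t) -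
                         config_free S v (fun i => weight i t)|) <=
  2 * expR (- c) ^+ r.
Proof.
pose k := (2 * D + 2)%N; pose delta : R := (4 * D.+1%:R)^-1.
have d0 : 0 < delta by rewrite invr_gt0 mulr_gt0.
have k0 : (0 < k)%N by rewrite /k addn2.
have [q q0 qk] := small_tail_parameter k0 d0.
have [a ha] := uniform_tail q0.
have B0 : 0 <= D%:R * expR (3 * a) by rewrite mulr_ge0 ?expR_ge0.
have [m m0 hm] := power_small B0 d0.
exists (ln 2 / m.+1%:R); first by rewrite divr_gt0 ?ln_gt0 ?ltr1n.
move=> n r S v hS.
exact: (@mean_free_dist R (G n) _ _ (P n) (@weight n) (@indep n) D a q m (@degree_bound n)
  (ha n) (ltW q0) qk m0 hm r S v hS).
Qed.

Lemma uniform_variance : exists2 kappa : R, 0 < kappa & forall n, (0 < #|edge (G n)|)%N ->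
  kappa * #|edge (G n)|%:R <= var (P n) (fun t => size_functional (fun i => weight i t)).
Proof.
pose q : R := (2 * (4 * D + 4)%:R)^-1.
have q0 : 0 < q by rewrite invr_gt0 mulr_gt0// ltr0n addn4.
have [a ha] := uniform_tail q0.
exists ((edge_variance D a / (4 * D.+1%:R)) ^+ 2 / (expR 1 - 1)).
  apply: divr_gt0.
    apply: exprn_gt0; apply: divr_gt0; [exact: edge_variance_gt0|by rewrite mulr_gt0].
  by rewrite subr_gt0 -[ltLHS]expR0 ltr_expR.
move=> n n0.
apply: (@size_variance_ge R (G n) _ _ (P n) (@weight n) (@indep n) (@edge_law n) D a q (@degree_bound n)) => //.
rewrite /q invfM mulrCA mulfV ?mulr1 ?pnatr_eq0 ?addn4//.
Qed.

End UniformConstants.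

Theorem corollary1p6 (R : realType) (G : nat -> sgraph)
  (d : nat -> measure_display) (Omega : forall n, measurableType (d n))
  (P : forall n, probability (Omega n) R)
  (w : forall n, edge (G n) -> {RV (P n) >-> R})
  (nu : forall n, G n -> {RV (P n) >-> R})
  (Q : probability (measurableTypeR R) R)
  (delta : R) (D : nat)
  (card_vertex : #|G n| @[n --> \oo] --> \oo)
  (delta_gt0 : 0 < delta)
  (card_edge : \forall n \near \oo, delta * #|G n|%:R <= #|edge_set (G n)|%:R)
  (degree_le : forall n, (max_degree (G n) <= D)%N)
  (subexp_growth : forall alpha : R, 0 < alpha ->
     exists K : R, forall n r : nat, (1 <= r)%N ->
       (volume_growth (G n) r)%:R <= K * expR (alpha * r%:R))
  (indep : forall n, mutually_independent (P n)
     (fun i : edge (G n) + G n =>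
        match i with inl e => w n e | inr x => nu n x end))
  (edge_law : forall n (e : edge (G n)) (A : set R), measurable A ->
     distribution (P n) (w n e) A = normal_prob 0 1 A)
  (vertex_law : forall n (x : G n) (A : set R), measurable A ->
     distribution (P n) (nu n x) A = Q A)
  (fourth_moment : (\int[Q]_y (y ^+ 4)%:E < +oo)%E) :
  cvg_in_distribution P (fun n => standardize (P n) (mean_size (w n) (nu n)))
    (normal_prob 0 1).
Proof.
have [c c0 hc] := uniform_decay degree_le indep edge_law vertex_law.
have [kap kap0 hkap] := uniform_variance degree_le indep edge_law vertex_law.
(* The radius will be about 4 * ln n / c, so a ball of that radius has of the order of n ^ (1/16) vertices at most. *)
have [K0 hK0] : exists K : R, forall n r : nat, (1 <= r)%N ->
    (volume_growth (G n) r)%:R <= K * expR (c / 64 * r%:R).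
  by apply: subexp_growth; rewrite divr_gt0.
pose K := Num.max 1 (K0 ^+ 2 * expR (2 * (c / 64))).
have K1 : 1 <= K by rewrite le_max lexx.
pose k0 := Num.sqrt (kap * delta).
have kd : 0 < kap * delta by rewrite mulr_gt0.
have k00 : 0 < k0 by rewrite sqrtr_gt0.
pose size (n : nat) : Omega n -> R := fun t => size_functional (fun i => weight w nu i t).
have sizeE n : mean_size (w n) (nu n) = size n :> (Omega n -> R).
  by apply/funext => t; rewrite /mean_size gibbs_expectationE.
have EE n : fine 'E_(P n)[mean_size (w n) (nu n)] = mean (P n) (size n).
  rewrite expectation_def /mean /Rintegral; congr fine; apply: eq_integral => t _.
  congr (_%:E); exact: (congr1 (fun f => f t) (sizeE n)).
have VE n : fine 'V_(P n)[mean_size (w n) (nu n)] = var (P n) (size n).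
  rewrite /variance covariance.unlock expectation.unlock /var /mean /Rintegral; congr fine.
  have := EE n; rewrite expectation.unlock => ->.
  by apply: eq_integral => t _; rewrite sizeE /= expr2.
pose Y (n : nat) : Omega n -> R := fun t => (size n t - mean (P n) (size n)) / Num.sqrt (var (P n) (size n)).
have YE n : standardize (P n) (mean_size (w n) (nu n)) = Y n :> (Omega n -> R).
  apply/funext => t; rewrite /standardize EE VE /Y; congr ((_ - _) / _).
  exact: (congr1 (fun f => f t) (sizeE n)).
have ramp_limit (t eps e : R) : 0 < eps -> 0 < e -> \forall n \near \oo,
    `|mean (P n) (fun u => ramp t eps (Y n u)) - ramp_mean t eps| <= e.
  move=> eps0 e0.
  have [B [B0 Bf Bf1 Bf2]] := stein_bounds t eps0.
  pose C := 2 / eps * (2 / k0) + B * (K ^+ 2 / k0 ^+ 3 + 4 * K ^+ 2 / k0 ^+ 2 + 2 / k0 ^+ 2).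
  have C0 : 0 < C.
    have KK : 0 <= K by lra.
    apply: ltr_pwDl; first by apply: mulr_gt0; exact: divr_gt0.
    by apply: mulr_ge0 => //; rewrite !addr_ge0 ?divr_ge0 ?mulr_ge0 ?exprn_ge0 ?(ltW k00).
  (* From this size on, the error C * n ^ (- 1/4) is at most e. *)
  pose M := Num.max 1 (expR (- (4 * ln (e / C)))).
  near=> n.
  have nM : M <= #|G n|%:R.
    have : ((Num.truncn M).+1 <= #|G n|)%N.
      by near: n; exact: (card_vertex _ (nbhs_infty_ge _)).
    by rewrite -(ler_nat R); apply: le_trans; exact/ltW/truncnS_gt.
  have n1 : 1 <= #|G n|%:R :> R by rewrite (le_trans _ nM)// le_max lexx.
  have ngt0 : 0 < #|G n|%:R :> R by lra.
  pose L : R := ln #|G n|%:R.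
  have nE : #|G n|%:R = expR L by rewrite lnK.
  have L0 : 0 <= L by rewrite ln_ge0.
  pose u := expR (L / 8); pose x := expR (- (L / 8)).
  have u1 : 1 <= u by rewrite -expR0 ler_expR divr_ge0.
  have ux : u * x = 1 by rewrite -expRD subrr expR0.
  have nu8 : #|G n|%:R = u ^+ 8 by rewrite nE -expRM_natl; congr expR; field.
  have cardE : #|edge (G n)| = #|edge_set (G n)| by rewrite card_sig.
  have edges : delta * #|G n|%:R <= #|edge (G n)|%:R.
    by rewrite cardE; near: n.
  have e_gt0 : (0 < #|edge (G n)|)%N.
    by rewrite -(ltr0n R); apply: lt_le_trans edges; rewrite mulr_gt0.
  have hvar : kap * delta * u ^+ 8 <= var (P n) (size n).
    by apply: le_trans (hkap n e_gt0); rewrite -mulrA ler_wpM2l ?(ltW kap0)// -nu8.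
  have u0 : 0 < u by lra.
  have hsig : k0 * u ^+ 4 <= Num.sqrt (var (P n) (size n)).
    have h4 : 0 <= k0 * u ^+ 4 by rewrite mulr_ge0 ?exprn_ge0// ltW.
    rewrite -[leLHS]ger0_norm// -sqrtr_sqr ler_wsqrtr//.
    by rewrite exprMn sqr_sqrtr ?(ltW kd)// -exprM.
  have sig0 : 0 < Num.sqrt (var (P n) (size n)).
    by apply: lt_le_trans hsig; rewrite mulr_gt0// exprn_gt0.
  (* With this radius the localization error is at most 2 * n ^ (- 4). *)
  pose r := (Num.truncn (4 * L / c)).+1.
  have r_ge : 4 * L / c <= r%:R by exact/ltW/truncnS_gt.
  have r_le : r%:R <= 4 * L / c + 1.
    by rewrite /r -natr1 lerD2r truncn_le divr_ge0 ?mulr_ge0 ?(ltW c0).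
  pose b := volume_growth (G n) r.
  have hb (v : G n) : (#|Defs.ball v r| <= b)%N by exact: (@leq_bigmax _ (fun x : G n => #|Defs.ball x r|) v).
  pose eta := 2 * expR (- c) ^+ r.
  have hloc (v : G n) : mean (P n) (fun t => `|config_free [set: G n]%SET v (fun i => weight w nu i t) -
       config_free (Defs.ball v r) v (fun i => weight w nu i t)|) <= eta.
    by apply: hc => y vy; rewrite inE.
  have heta : 0 <= eta <= 2 * x ^+ 32.
    rewrite mulr_ge0 ?exprn_ge0 ?expR_ge0//= ler_wpM2l// -!expRM_natl ler_expR.
    move: r_ge; rewrite ler_pdivrMr//; lra.
  have hDelta : 0 <= ((b * b)%:R : R) <= K * u.
    apply/andP; split; [exact: ler0n|rewrite natrM].
    have hb' : b%:R <= K0 * expR (c / 64 * r%:R) by exact: hK0.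
    apply: (@le_trans _ _ ((K0 * expR (c / 64 * r%:R)) * (K0 * expR (c / 64 * r%:R)))).
      by rewrite ler_pM.
    rewrite mulrACA -expRD -expr2.
    apply: (@le_trans _ _ (K0 ^+ 2 * (expR (2 * (c / 64)) * u))).
      rewrite ler_wpM2l ?sqr_ge0// -expRD ler_expR.
      move: r_le; rewrite -lerBlDr ler_pdivlMr//; lra.
    by rewrite mulrA ler_wpM2r ?(ltW u0)// le_max lexx orbT.
  have := @size_normal_approximation R (G n) _ _ (P n) (@weight _ _ _ _ _ w nu n) (indep n) r b eta
    hloc hb sig0 t eps B eps0 Bf Bf1 Bf2.
  move=> /le_trans; apply.
  have := error_asymptotics eps0 B0 K1 k00 u1 ux nu8 heta hDelta hsig.
  move=> /le_trans; apply; rewrite -/C.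
  rewrite mulrC -ler_pdivlMr// -[leRHS]lnK ?posrE ?divr_gt0// -expRM_natl ler_expR.
  have : expR (- (4 * ln (e / C))) <= expR L.
    by rewrite -nE; apply: le_trans nM; rewrite le_max lexx orbT.
  rewrite ler_expR; lra.
Unshelve. all: try by end_near.
move=> t _.
have Pfin n (A : set (Omega n)) : measurable A -> P n A \is a fin_num by move=> mA; exact: fin_num_measure.
have mYn n : measurable_fun setT (Y n) by rewrite -YE.
have cdfE n : @cdf _ _ R (P n) (standardize (P n) (mean_size (w n) (nu n))) t = (fine (P n [set u | Y n u <= t]))%:E.
  rewrite fineK; last first.
    apply: Pfin; rewrite (_ : mkset _ = Y n @^-1` `]-oo, t]); first by rewrite -[_ @^-1` _]setTI; exact: mYn.
    by apply/seteqP; split => u /=; rewrite in_itv.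
  rewrite /cdf /distribution /pushforward; congr (P n _).
  by apply/seteqP; split => u /=; rewrite in_itv /= YE.
under eq_fun do rewrite cdfE.
suff : (fine (P n [set u | Y n u <= t]))%:E @[n --> \oo] --> (Phi t)%:E.
  by rewrite /Phi fineK// fin_num_measure.
apply: cvg_EFin; first by near=> n.
apply/cvgrPdist_le => e e0.
pose pk : R := normal_peak 1.
have pk0 : 0 < pk by rewrite normal_peak_gt0 ?oner_eq0.
(* The distribution function of the limit varies by at most e / 2 over a ramp of this width. *)
pose eps := e / 2 / pk.
have eps0 : 0 < eps by rewrite !divr_gt0.
have e20 : 0 < e / 2 by rewrite divr_gt0.
near=> n.
have /andP[lo hi] := cdf_sandwich (P n) t (mYn n) eps0.
have h1 : `|mean (P n) (fun u => ramp t eps (Y n u)) - ramp_mean t eps| <= e / 2.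
  by near: n; exact: ramp_limit.
have h2 : `|mean (P n) (fun u => ramp (t - eps) eps (Y n u)) - ramp_mean (t - eps) eps| <= e / 2.
  by near: n; exact: ramp_limit.
have h3 := ramp_mean_le t eps; have h4 := ramp_mean_ge (t - eps) eps0.
have pe : pk * eps = e / 2 by rewrite /eps mulrC divfK// gt_eqF.
have h5 := Phi_lipschitz t (t + eps); have h6 := Phi_lipschitz (t - eps) t.
rewrite -/pk (_ : t + eps - t = eps) ?(ger0_norm (ltW eps0))// ?pe in h5; last by rewrite addrC addKr.
rewrite -/pk (_ : t - (t - eps) = eps) ?(ger0_norm (ltW eps0))// ?pe in h6; last by rewrite opprB addrC subrK.
move: h1 h2 h5 h6; rewrite !ler_norml /=; lra.
Unshelve. all: by end_near.
Qed.
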